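(* Let $\alpha>0$, $\beta>0$, and let $g:\mathbb{R}^3\times\mathbb{R}\to\mathbb{R}$ be a Lipschitz continuous function of $(x,t)$. Consider the regularized mean curvature flow velocity law $$v-\alpha\Delta_{\Gamma(X)}v-\beta\Delta_{\Gamma(X)}X=g(\cdot,t)\,\nu_{\Gamma(X)},\qquad\partial_tX(p,t)=v(X(p,t),t),$$ with $X(p,0)=p$ for $p\in\Gamma^0$, and assume it has a unique, sufficiently regular solution on $[0,T]$ with non-degenerate flow map $X(\cdot,t):\Gamma^0\to\Gamma(t)$. Let $(\mathbf{v},\mathbf{x})$ be the solution of the evolving surface finite element semidiscretization, $(\mathbf{v}^*,\mathbf{x}^* )$ the exact nodal values, $\mathbf{d}_{\mathbf{v}}$ the defect, and $\mathbf{e}_{\mathbf{v}}=\mathbf{v}-\mathbf{v}^*$, $\mathbf{e}_{\mathbf{x}}=\mathbf{x}-\mathbf{x}^*$ (as specified in the context). Suppose that the defect is bounded, with some $\kappa>1$ (and a constant $c$ independent of $h$ and $t$), by $$\|\mathbf{d}_{\mathbf{v}}(t)\|_{\star,\mathbf{x}^*(t)}\le ch^\kappa,\qquad t\in[0,T].$$ Then there exists $h_0>0$ such that for all $h\le h_0$ and $0\le t\le T$: $$\|\mathbf{e}_{\mathbf{x}}(t)\|_{\mathbf{K}(\mathbf{x}^*(t))}^2\le C\int_0^t\|\mathbf{d}_{\mathbf{v}}(s)\|_{\star,\mathbf{x}^*(s)}^2\,ds,$$ $$\|\mathbf{e}_{\mathbf{v}}(t)\|_{\mathbf{K}(\mathbf{x}^*(t))}^2\le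 C\|\mathbf{d}_{\mathbf{v}}(t)\|_{\star,\mathbf{x}^*(t)}^2+C\int_0^t\|\mathbf{d}_{\mathbf{v}}(s)\|_{\star,\mathbf{x}^*(s)}^2\,ds.$$ The constant $C$ is independent of $t$ and $h$, but depends on the final time $T$ and on the parameters $\alpha$ and $\beta$.
   Context: Surfaces. $\Gamma^0\subset\mathbb{R}^3$ is a smooth closed two-dimensional surface; $X:\Gamma^0\times[0,T]\to\mathbb{R}^3$ with $X(p,0)=p$; $\Gamma(t)=\Gamma(X(\cdot,t))=\{X(p,t):p\in\Gamma^0\}$; velocity $v$: $\partial_tX(p,t)=v(X(p,t),t)$. $\nu_\Gamma,\nabla_\Gamma,\Delta_\Gamma$ denote outer unit normal, tangential gradient, Laplace--Beltrami operator (componentwise on vector functions). $\Delta_{\Gamma(X)}X$ stands for $\Delta_{\Gamma(X)}\mathrm{id}=-H\nu_{\Gamma(X)}$, with $H$ the mean curvature of $\Gamma(X)$. Finite elements. $\Gamma^0$ is triangulated by an admissible (shape-regular, quasi-uniform) family of triangulations of maximal element diameter $h$, with all degree-$k$ nodes $x_1^0,\dots,x_N^0\in\Gamma^0$; $p_j=x_j^0$. A nodal vector $\mathbf{x}=(x_j)\in\mathbb{R}^{3N}$ defines the discrete surface $\Gamma_h(\mathbf{x})$, each curved triangle being the image of the plane reference triangle under the degree-$k$ polynomial map interpolating the corresponding nodes; $\phi_j[\mathbf{x}]$ are the continuous nodal basis functions on $\Gamma_h(\mathbf{x})$ whose pullbacks to the reference triangle are polynomials of degree $k$, with $\phi_j[\mathbf{x}](x_i)=\delta_{ij}$.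 Tangential gradients on $\Gamma_h$ are piecewise. Matrices: $\mathbf{M}(\mathbf{x})_{ij}=\int_{\Gamma_h(\mathbf{x})}\phi_i[\mathbf{x}]\phi_j[\mathbf{x}]$; $\mathbf{A}_0(\mathbf{x})_{ij}=\int_{\Gamma_h(\mathbf{x})}\nabla_{\Gamma_h}\phi_i[\mathbf{x}]\cdot\nabla_{\Gamma_h}\phi_j[\mathbf{x}]$; $\mathbf{K}(\mathbf{x})=I_3\otimes(\mathbf{M}(\mathbf{x})+\alpha\mathbf{A}_0(\mathbf{x}))$; $\mathbf{A}(\mathbf{x})=\beta I_3\otimes\mathbf{A}_0(\mathbf{x})$; $\mathbf{M}^{[3]}(\mathbf{x})=I_3\otimes\mathbf{M}(\mathbf{x})$ (Kronecker products act on each of the three spatial components); $\mathbf{g}(\mathbf{x},t)_{3(j-1)+\ell}=\int_{\Gamma_h(\mathbf{x})}g(\cdot,t)(\nu_{\Gamma_h(\mathbf{x})})_\ell\,\phi_j[\mathbf{x}]$ for $j=1,\dots,N$, $\ell=1,2,3$. Semidiscretization: $\mathbf{K}(\mathbf{x})\mathbf{v}+\mathbf{A}(\mathbf{x})\mathbf{x}=\mathbf{g}(\mathbf{x},t)$, $\dot{\mathbf{x}}=\mathbf{v}$, $x_j(0)=x_j^0$. Exact nodal values: $x_j^*(t)=X(p_j,t)$, $v_j^*(t)=\dot x_j^*(t)$. The defect $\mathbf{d}_{\mathbf{v}}(t)\in\mathbb{R}^{3N}$ is defined by $\mathbf{K}(\mathbf{x}^* )\mathbf{v}^*+\mathbf{A}(\mathbf{x}^*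 )\mathbf{x}^*=\mathbf{g}(\mathbf{x}^*,t)+\mathbf{M}^{[3]}(\mathbf{x}^* )\mathbf{d}_{\mathbf{v}}$. Norms: $\|\mathbf{w}\|_{\mathbf{K}}^2=\mathbf{w}^T\mathbf{K}\mathbf{w}$ and $\|\mathbf{d}_{\mathbf{v}}\|_{\star,\mathbf{x}^*}^2=\mathbf{d}_{\mathbf{v}}^T\mathbf{M}^{[3]}(\mathbf{x}^* )\mathbf{K}(\mathbf{x}^* )^{-1}\mathbf{M}^{[3]}(\mathbf{x}^* )\mathbf{d}_{\mathbf{v}}$. *)

(* Defs.v *)
From HB Require Import structures.
From mathcomp Require Import all_boot all_order all_algebra all_fingroup.
From mathcomp Require Import all_classical all_reals all_analysis.

Set Implicit Arguments.
Unset Strict Implicit.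
Unset Printing Implicit Defensive.

Import Order.TTheory GRing.Theory Num.Theory.
Import numFieldNormedType.Exports.

Local Open Scope classical_set_scope.
Local Open Scope ring_scope.

(* The library norm on ['rV[R]_n] is the maximum norm, so the Euclidean norm
   is defined here; both induce the same topology and derivatives. *)
Definition dot (R : realType) (n : nat) (u v : 'rV[R]_n) : R :=
  \sum_(i < n) u 0 i * v 0 i.

Definition enorm (R : realType) (n : nat) (u : 'rV[R]_n) : R :=
  Num.sqrt (dot u u).

Definition cross (R : realType) (u v : 'rV[R]_3) : 'rV[R]_3 :=
  \row_(i < 3) (u 0 (i + 1) * v 0 (i + 2) - u 0 (i + 2) * v 0 (i + 1)).

(* [f] is of class C^m on the open set [U] of a finite-dimensional space: all
   iterated directional derivatives up to order [m] exist and are continuous. *)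
Fixpoint class_C (R : realType) (V W : normedModType R) (m : nat) (U : set V)
    (f : V -> W) : Prop :=
  (forall x, U x -> {for x, continuous f}) /\
  if m is m'.+1 then
    forall v : V, (forall x, U x -> derivable f x v) /\
                  class_C m' U (fun x => 'D_v f x)
  else True.

(* Derivative at a time [t] of [0,T], one-sided at the end points. *)
Definition tquot (R : realType) (V : normedModType R) (f : R -> V) (t s : R)
  : V := (s - t)^-1 *: (f s - f t).

Definition has_tderiv (R : realType) (V : normedModType R) (T : R)
    (f : R -> V) (t : R) (l : V) : Prop :=
  tquot f t s @[s --> within `[0, T] t^'] --> l.

Definition tderiv (R : realType) (V : normedModType R) (T : R)
    (f : R -> V) (t : R) : V :=
  lim (tquot f t s @[s --> within `[0, T] t^']).

(* A compact embedded two-dimensional C^oo submanifold without boundary. *)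
Definition smooth_closed_surface (R : realType) (S : set 'rV[R]_3) : Prop :=
  compact S /\
  forall p, S p -> exists (U : set 'rV[R]_3) (phi : 'rV[R]_3 -> R),
    [/\ open U, U p, forall m, class_C m U phi,
        forall y, U y -> (S y <-> phi y = 0) &
        forall y, U y -> S y -> exists v, 'D_v phi y != 0].

Definition tangent_curve (R : realType) (S : set 'rV[R]_3)
    (p tau : 'rV[R]_3) (gam : R -> 'rV[R]_3) : Prop :=
  [/\ \forall s \near (0 : R), S (gam s), gam 0 = p & is_derive (0 : R) 1 gam tau].

Definition tangent (R : realType) (S : set 'rV[R]_3) (p tau : 'rV[R]_3) : Prop :=
  exists gam, tangent_curve S p tau gam.

(* [S] bounds a bounded open set [Om], and [nu] points out of [Om]. *)
Definition outer_unit_normal (R : realType) (S : set 'rV[R]_3)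
    (nu : 'rV[R]_3 -> 'rV[R]_3) : Prop :=
  exists Om : set 'rV[R]_3,
    [/\ open Om, bounded_set Om, closure Om `\` Om = S &
        forall p, S p ->
          [/\ enorm (nu p) = 1,
              forall tau, tangent S p tau -> dot (nu p) tau = 0 &
              \forall e \near (0 : R)^'+,
                Om (p - e *: nu p) /\ ~ Om (p + e *: nu p)]].

Definition grad (R : realType) (F : 'rV[R]_3 -> R) (x : 'rV[R]_3) : 'rV[R]_3 :=
  \row_(i < 3) 'D_(delta_mx 0 i) F x.

(* [w] is the tangential gradient at [x] of the function [f] on [S]: the
   tangential part of the gradient of an extension of [f].  The values of [f]
   outside [S] are irrelevant, and [w] does not depend on the extension. *)
Definition is_tgrad (R : realType) (S : set 'rV[R]_3)
    (nu : 'rV[R]_3 -> 'rV[R]_3) (f : 'rV[R]_3 -> R) (x w : 'rV[R]_3) : Prop :=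
  exists F : 'rV[R]_3 -> R,
    [/\ differentiable F x, \forall y \near x, S y -> F y = f y &
        w = grad F x - dot (grad F x) (nu x) *: nu x].

(* Laplace-Beltrami: the tangential divergence of the tangential gradient. *)
Definition is_laplace (R : realType) (S : set 'rV[R]_3)
    (nu : 'rV[R]_3 -> 'rV[R]_3) (f : 'rV[R]_3 -> R) (x : 'rV[R]_3) (L : R)
    : Prop :=
  exists (G : 'rV[R]_3 -> 'rV[R]_3) (D : 'M[R]_3),
    [/\ \forall y \near x, S y -> is_tgrad S nu f y (G y),
        forall i, is_tgrad S nu (fun y => G y 0 i) x (row i D) & L = \tr D].

Definition is_laplace_vec (R : realType) (S : set 'rV[R]_3)
    (nu f : 'rV[R]_3 -> 'rV[R]_3) (x L : 'rV[R]_3) : Prop :=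
  forall l, is_laplace S nu (fun y => f y 0 l) x (L 0 l).

Definition moved (R : realType) (Gamma0 : set 'rV[R]_3)
    (X : 'rV[R]_3 -> R -> 'rV[R]_3) (t : R) : set 'rV[R]_3 :=
  [set X p t | p in Gamma0].

(* [X] is the restriction to [Gamma0 x [0,T]] of a C^m map. *)
Definition regular_map (R : realType) (m : nat) (Gamma0 : set 'rV[R]_3) (T : R)
    (X : 'rV[R]_3 -> R -> 'rV[R]_3) : Prop :=
  exists (U : set ('rV[R]_3 * R)%type) (F : ('rV[R]_3 * R)%type -> 'rV[R]_3),
    [/\ open U, class_C m U F &
        forall p t, Gamma0 p -> 0 <= t <= T -> U (p, t) /\ F (p, t) = X p t].

(* Injective immersions, the differential being tested on curves in [Gamma0], so
   that [X] need not be extended off [Gamma0]. *)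
Definition nondegenerate (R : realType) (Gamma0 : set 'rV[R]_3) (T : R)
    (X : 'rV[R]_3 -> R -> 'rV[R]_3) : Prop :=
  forall t, 0 <= t <= T ->
    (forall p q, Gamma0 p -> Gamma0 q -> X p t = X q t -> p = q) /\
    (forall p tau gam w, Gamma0 p -> tangent_curve Gamma0 p tau gam ->
       is_derive (0 : R) 1 (fun s => X (gam s) t) w -> tau != 0 -> w != 0).

Definition velocity_law (R : realType) (alpha beta : R)
    (g : ('rV[R]_3 * R)%type -> R) (Gamma0 : set 'rV[R]_3) (T : R)
    (X v : 'rV[R]_3 -> R -> 'rV[R]_3) : Prop :=
  forall t, 0 <= t <= T ->
    exists nu, outer_unit_normal (moved Gamma0 X t) nu /\
    forall x, moved Gamma0 X t x ->
      exists Lv LX : 'rV[R]_3,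
        [/\ is_laplace_vec (moved Gamma0 X t) nu (v^~ t) x Lv,
            is_laplace_vec (moved Gamma0 X t) nu id x LX &
            v x t - alpha *: Lv - beta *: LX = g (x, t) *: nu x].

Definition regular_solution (R : realType) (m : nat) (alpha beta : R)
    (g : ('rV[R]_3 * R)%type -> R) (Gamma0 : set 'rV[R]_3) (T : R)
    (X : 'rV[R]_3 -> R -> 'rV[R]_3) : Prop :=
  [/\ regular_map m Gamma0 T X, nondegenerate Gamma0 T X,
      forall p, Gamma0 p -> X p 0 = p &
      exists v : 'rV[R]_3 -> R -> 'rV[R]_3,
        (forall p t, Gamma0 p -> 0 <= t <= T ->
           has_tderiv T (X p) t (v (X p t) t)) /\
        velocity_law alpha beta g Gamma0 T X v].

Definition unique_regular_solution (R : realType) (m : nat) (alpha beta : R)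
    (g : ('rV[R]_3 * R)%type -> R) (Gamma0 : set 'rV[R]_3) (T : R)
    (X : 'rV[R]_3 -> R -> 'rV[R]_3) : Prop :=
  regular_solution m alpha beta g Gamma0 T X /\
  forall Y, regular_solution m alpha beta g Gamma0 T Y ->
    forall p t, Gamma0 p -> 0 <= t <= T -> Y p t = X p t.

Definition ref_triangle {R : realType} : set (R * R)%type :=
  [set xi | [/\ 0 <= xi.1, 0 <= xi.2 & xi.1 + xi.2 <= 1]].

Definition bary (R : realType) (xi : (R * R)%type) (i : 'I_3) : R :=
  nth 0 [:: 1 - xi.1 - xi.2; xi.1; xi.2] i.

(* The degree-k nodes of the reference triangle: [a] stands for the point with
   barycentric coordinates [a i / k]. *)
Definition lattice (k : nat) :=
  {a : {ffun 'I_3 -> 'I_k.+1} | (\sum_(i < 3) a i == k)%N}.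

Definition lattice_pt (R : realType) (k : nat) (a : lattice k) : (R * R)%type :=
  ((val a 1 : nat)%:R / k%:R, (val a (2 : 'I_3) : nat)%:R / k%:R).

(* The nodal basis polynomial of degree k of the node [a], in Silvester's
   product form; see [lagrange_lattice]. *)
Definition lagrange (R : realType) (k : nat) (a : lattice k) (xi : (R * R)%type) : R :=
  \prod_(i < 3) \prod_(0 <= m < val a i)
    ((k%:R * bary xi i - m%:R) / ((val a i : nat)%:R - m%:R)).

Lemma lagrange_lattice (R : realType) (k : nat) (a b : lattice k) :
  (0 < k)%N -> lagrange a (lattice_pt R b) = (a == b)%:R.
Proof.
move=> k0.
have kN0 : (k%:R : R) != 0 by rewrite pnatr_eq0 -lt0n.
have baryE i : k%:R * bary (lattice_pt R b) i = (val b i : nat)%:R.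
  have sb : (val b (0 : 'I_3)%R + val b (1 : 'I_3)%R + val b (2 : 'I_3)%R)%N = k.
    have /eqP := valP b; rewrite !big_ord_recl big_ord0 /= addn0 addnA => bk.
    rewrite -[RHS]bk; congr (_ + _ + _)%N; congr (nat_of_ord (_ _));
      exact/val_inj.
  have bE (j : 'I_3) : j = i -> (val b j : nat)%:R = (val b i : nat)%:R :> R.
    by move->.
  case: i bE => -[|[|[|//]]] hi bE; rewrite /bary /lattice_pt /=.
  - rewrite -(bE 0) ?mulrBr ?mulr1; last exact/val_inj.
    rewrite !(mulrC k%:R (_ / _)) !divfK // -[X in X%:R - _]sb !natrD.
    by rewrite addrAC addrK addrK.
  - by rewrite mulrC divfK // (bE 1) //; exact/val_inj.
  - by rewrite mulrC divfK // (bE 2) //; exact/val_inj.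
have [->|ab] := eqVneq a b.
  rewrite /lagrange big1 // => i _; rewrite big_nat big1 // => m /= mb.
  by rewrite baryE divff // subr_eq0 eqr_nat gtn_eqF.
have [i ba] : exists i, (val b i < val a i)%N.
  apply/existsP; apply: contraR ab; rewrite negb_exists => /forallP le_ab.
  have {}le_ab i : (val a i <= val b i)%N by rewrite leqNgt le_ab.
  have := leqif_sum (fun i (_ : true) => leqif_eq (le_ab i)).
  have /eqP -> := valP a; have /eqP -> := valP b.
  case=> _; rewrite eqxx => /esym/forallP eq_ab.
  by apply/eqP/val_inj/ffunP => i; apply/val_inj/eqP; exact: eq_ab.
rewrite /lagrange (bigD1 i) //= (bigD1_seq (val b i : nat)) /=; last 2 first.
- by rewrite mem_index_iota.
- exact: iota_uniq.
by rewrite baryE subrr !mul0r.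
Qed.

Record triangulation (R : realType) (k : nat) := Triangulation {
  nb_nodes : nat;
  nb_elts : nat;
  local_node : 'I_nb_elts -> lattice k -> 'I_nb_nodes;
  init_node : 'M[R]_(nb_nodes, 3)
}.

(* A nodal vector (x_j) of R^{3N} is the N x 3 matrix with rows x_j, so that
   I_3 (x) B acts on nodal vectors as the product [B *m _]. *)
Definition nodal (R : realType) (k : nat) (tr : triangulation R k) :=
  'M[R]_(nb_nodes tr, 3).

Section DiscreteSurface.
Context (R : realType) (k : nat) (tr : triangulation R k).
Implicit Types (x w : nodal tr) (e : 'I_(nb_elts tr)) (xi : (R * R)%type).
Implicit Types (i j : 'I_(nb_nodes tr)).

Definition elt_map x e xi : 'rV[R]_3 :=
  \sum_(a : lattice k) lagrange a xi *: row (local_node e a) x.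

Definition discrete_surface x : set 'rV[R]_3 :=
  [set y | exists e xi, ref_triangle xi /\ elt_map x e xi = y].

(* The pull-back of the nodal basis function phi_j to the element [e]. *)
Definition basis_fun j e xi : R :=
  \sum_(a : lattice k | local_node e a == j) lagrange a xi.

Definition ref_grad (W : normedModType R) (f : (R * R)%type -> W) xi (a : 'I_2) : W :=
  'D_(if a == 0 then (1, 0) else (0, 1)) f xi.

Definition jac x e xi : 'M[R]_(2, 3) :=
  \matrix_(a < 2, l < 3) ref_grad (elt_map x e) xi a 0 l.

Definition gram x e xi : 'M[R]_2 := jac x e xi *m (jac x e xi)^T.

Definition area_elt x e xi : R := Num.sqrt (\det (gram x e xi)).

Definition elt_cross x e xi : 'rV[R]_3 :=
  cross (row 0 (jac x e xi)) (row 1 (jac x e xi)).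

Definition discrete_normal x e xi : 'rV[R]_3 :=
  (enorm (elt_cross x e xi))^-1 *: elt_cross x e xi.

(* Tangential gradient on an element of the function with pull-back [f]: the
   combination of the rows of [jac] whose products with them are the partial
   derivatives of [f]. *)
Definition discrete_tgrad x e (f : (R * R)%type -> R) xi : 'rV[R]_3 :=
  (\row_(a < 2) ref_grad f xi a) *m invmx (gram x e xi) *m jac x e xi.

Definition surface_integral x (f : 'I_(nb_elts tr) -> (R * R)%type -> R) : R :=
  \sum_(e < nb_elts tr)
    \int[(@lebesgue_measure R \x @lebesgue_measure R)%E]_(xi in ref_triangle)
      (f e xi * area_elt x e xi).

Definition mass x : 'M[R]_(nb_nodes tr) :=
  \matrix_(i, j) surface_integral x
    (fun e xi => basis_fun i e xi * basis_fun j e xi).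

Definition stiffness x : 'M[R]_(nb_nodes tr) :=
  \matrix_(i, j) surface_integral x
    (fun e xi => dot (discrete_tgrad x e (basis_fun i e) xi)
                     (discrete_tgrad x e (basis_fun j e) xi)).

Definition Kmx (alpha : R) x := mass x + alpha *: stiffness x.

Definition Amx (beta : R) x := beta *: stiffness x.

Definition load (g : ('rV[R]_3 * R)%type -> R) x (t : R) : nodal tr :=
  \matrix_(j, l) surface_integral x
    (fun e xi => g (elt_map x e xi, t) * discrete_normal x e xi 0 l
                 * basis_fun j e xi).

Definition semidiscrete_solution (alpha beta : R) (g : ('rV[R]_3 * R)%type -> R)
    (T : R) (x v : R -> nodal tr) : Prop :=
  x 0 = init_node tr /\
  forall t, 0 <= t <= T ->
    has_tderiv T x t (v t) /\
    Kmx alpha (x t) *m v t + Amx beta (x t) *m x t = load g (x t) t.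

Definition exact_nodes (X : 'rV[R]_3 -> R -> 'rV[R]_3) (t : R) : nodal tr :=
  \matrix_(j, l) X (row j (init_node tr)) t 0 l.

Definition exact_velocities (T : R) (X : 'rV[R]_3 -> R -> 'rV[R]_3) (t : R)
  : nodal tr := tderiv T (exact_nodes X) t.

Definition is_defect (alpha beta : R) (g : ('rV[R]_3 * R)%type -> R) (T : R)
    (X : 'rV[R]_3 -> R -> 'rV[R]_3) (t : R) (d : nodal tr) : Prop :=
  let xs := exact_nodes X t in
  Kmx alpha xs *m exact_velocities T X t + Amx beta xs *m xs
  = load g xs t + mass xs *m d.

Definition norm_K (alpha : R) x w : R :=
  Num.sqrt (\tr (w^T *m Kmx alpha x *m w)).

Definition norm_star (alpha : R) x w : R :=
  Num.sqrt (\tr (w^T *m mass x *m invmx (Kmx alpha x) *m mass x *m w)).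

Definition elt_diam e : R :=
  sup [set enorm (elt_map (init_node tr) e xi - elt_map (init_node tr) e xi')
      | xi in ref_triangle & xi' in ref_triangle].

Definition mesh_size : R := \big[Num.max/0]_(e < nb_elts tr) elt_diam e.

(* Elements are embedded, and two distinct elements meet exactly in a common
   face, spanned by the vertices in [f] of [e] which [s] maps to vertices of
   [e'] (no vertex, one vertex or one edge), on which their nodes agree. *)
Definition conforming : Prop :=
  (forall e xi xi', ref_triangle xi -> ref_triangle xi' ->
     elt_map (init_node tr) e xi = elt_map (init_node tr) e xi' -> xi = xi') /\
  (forall e e', e != e' -> exists (f : {set 'I_3}) (s : {perm 'I_3}),
     [/\ f != [set: 'I_3]%SET,
         forall a a' : lattice k, (forall l : 'I_3, val a l != 0%N :> nat -> l \in f) ->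
           (forall l, val a' (s l) = val a l) ->
           local_node e a = local_node e' a' &
         forall xi xi', ref_triangle xi -> ref_triangle xi' ->
           elt_map (init_node tr) e xi = elt_map (init_node tr) e' xi' ->
           (forall l, bary xi l != 0 -> l \in f) /\
           (forall l, bary xi' (s l) = bary xi l)]).

Definition closest_point (S : set 'rV[R]_3) (y q : 'rV[R]_3) : Prop :=
  S q /\ forall q', S q' -> enorm (y - q) <= enorm (y - q').

(* [Gamma0] is triangulated: the nodes lie on [Gamma0] and the closest point
   projection maps the interpolating discrete surface bijectively to [Gamma0];
   the vertices of each element are numbered so that the cross product of the
   partial derivatives of its map points to the same side as the outer normal. *)
Definition triangulates (Gamma0 : set 'rV[R]_3) : Prop :=
  [/\ forall j, Gamma0 (row j (init_node tr)),
      forall j, exists e a, local_node e a = j,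
      conforming,
      (forall y, discrete_surface (init_node tr) y ->
         exists! q, closest_point Gamma0 y q) /\
      (forall q, Gamma0 q ->
         exists! y, discrete_surface (init_node tr) y /\ closest_point Gamma0 y q) &
      exists nu, outer_unit_normal Gamma0 nu /\
        forall e xi q, ref_triangle xi ->
          closest_point Gamma0 (elt_map (init_node tr) e xi) q ->
          0 < dot (nu q) (elt_cross (init_node tr) e xi)].

End DiscreteSurface.

(* Shape regularity of curved elements: up to the factor [elt_diam e], the
   derivatives of the element maps are bounded above and below uniformly. *)
Definition shape_regular (R : realType) (k : nat) (I : Type)
    (tri : I -> triangulation R k) : Prop :=
  exists2 c : R, 0 < c & forall i (e : 'I_(nb_elts (tri i))) xi (w : 'rV[R]_2),
    ref_triangle xi ->
    c * elt_diam e * enorm w <= enorm (w *m jac (init_node (tri i)) e xi)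
      <= c^-1 * elt_diam e * enorm w.

Definition quasi_uniform (R : realType) (k : nat) (I : Type)
    (tri : I -> triangulation R k) : Prop :=
  exists2 c : R, 0 < c & forall i (e : 'I_(nb_elts (tri i))),
    c * mesh_size (tri i) <= elt_diam e.

Definition admissible_family (R : realType) (k : nat) (Gamma0 : set 'rV[R]_3)
    (I : Type) (tri : I -> triangulation R k) : Prop :=
  [/\ forall i, triangulates (tri i) Gamma0, shape_regular tri &
      quasi_uniform tri].

(* Main.v *)
Require Import Defs.
From mathcomp Require Import all_boot all_order all_algebra all_fingroup.
From mathcomp Require Import all_classical all_reals all_analysis.
From mathcomp Require Import measurable_realfun.
From mathcomp Require Import ring lra.

Set Implicit Arguments.
Unset Strict Implicit.
Unset Printing Implicit Defensive.

Import Order.TTheory GRing.Theory Num.Theory.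
Import numFieldNormedType.Exports.

Local Open Scope classical_set_scope.
Local Open Scope ring_scope.

(** The error equation is tested with the velocity error, as in a parabolic
    stability proof, and the geometry is handled on the reference triangle.

    Write [xs] for the exact nodes, [e_x], [e_v] for the errors and measure
    nodal vectors by the discrete energy [energy h w], the integral over the
    reference triangle of [h_e^2 |w_h|^2 + |grad w_h|^2] summed over elements.
    As long as the Jacobians of the exact elements are of size [h_e] from above
    and below ([regular_mesh]), this is the square of the [K(xs)]-norm up to
    constants independent of the mesh ([Kmx_form_equiv]).  On [Gamma(t)] such
    bounds hold for all small [h]: a second order Taylor expansion shows that
    the exact Jacobian is the differential of the flow applied to the initial
    Jacobian up to [O(h_e^2)] ([jac_expansion]), the initial Jacobian is tangent
    to [Gamma0] up to the same order ([nearly_tangent]), and by compactness the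
    flow is an immersion uniformly in space and time
    ([uniform_nondegenerate]); the outcome is [exact_mesh_bounds].

    Subtracting the equations for [xs] and for [x] gives
    [K(xs) e_v = (differences of forms at xs and at x) - M d_v].  All
    differences are pointwise Lipschitz in the Jacobian with the right powers of
    [h_e] ([residual_density_le]), provided that [|grad e_x| <= delta h_e] on
    every element, so Young's inequality absorbs [e_v] and leaves
    [|e_v|_K^2 <= K (energy e_x + |d_v|_star^2)] ([stability_estimate]).  Since
    [d/dt e_x = e_v], the function [y(t) = energy (e_x(t))] satisfies
    [y' <= C (y + |d_v|_star^2)], and Gronwall gives the estimate for [e_x], then
    the one for [e_v].

    The smallness of [grad e_x] is a consequence of the estimate itself: by the
    inverse inequality ([mesh_inverse_estimate]) and quasi-uniformity it holds
    while [y <= B] with [B] of order [h^2], whereas Gronwall bounds [y] by a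
    multiple of [h^(2 kappa)], which is smaller than [B] for small [h] because
    [kappa > 1].  Hence [y] never reaches [B] ([bootstrap]).  Gronwall's
    inequality is used with the fundamental theorem of calculus, which requires
    the continuity in time of [|d_v|_star^2] ([continuous_residual_sqr]); it
    follows from the uniform continuity of the integrands on the compact
    reference triangle ([continuous_Itri]).

    Two continuous derivatives of the flow map are used, whence [m = 2]. *)

Local Notation lagrange := Defs.lagrange.

(** * Integration over the reference triangle *)

Section ReferenceTriangle.
Context {R : realType}.
Implicit Types (f g : (R * R)%type -> R) (xi : (R * R)%type).
Local Notation T := (@ref_triangle R).
Local Notation mu2 := (@lebesgue_measure R \x @lebesgue_measure R)%E.

(** An open set is a union of boxes with rational centres and sizes, and there
    are countably many of them. *)
Lemma open_measurable_plane (U : set (R * R)%type) : open U -> measurable U.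
Proof.
move=> oU.
pose box (q : rat * rat * rat) : set (R * R)%type :=
  ball (ratr q.1.1 : R) (ratr q.2) `*` ball (ratr q.1.2 : R) (ratr q.2).
have -> : U = \bigcup_q (if `[< box q `<=` U >] then box q else set0).
  apply/seteqP; split=> [[x y] Uxy|z [q _]]; last by case: asboolP => // qU /qU.
  have [e /= e0 eU] : \forall e \near 0^'+, ball (x, y) e `<=` U.
    have /nbhs_ballP[e /= e0 eU] := open_nbhs_nbhs (conj oU Uxy).
    near=> d => z xz; apply: eU; apply: le_ball xz; near: d; exact: nbhs_right_le.
  have [d d0 dU] : exists2 d : R, 0 < d & ball (x, y) d `<=` U.
    exists (e / 2); first by rewrite divr_gt0.
    by apply: eU; rewrite /ball/= ?sub0r ?normrN ?gtr0_norm ?divr_gt0// ltr_pdivrMr// ltr_pMr// ltr1n.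
  have [r /andP[r0 rd]] : exists r : rat, 0 < (ratr r : R) < d / 2.
    have [|r] := @rat_in_itvoo R 0 (d / 2); first by rewrite divr_gt0.
    by rewrite in_itv/=; exists r.
  have [p pP] : exists p : rat, `|x - ratr p| < ratr r.
    have [|p] := @rat_in_itvoo R (x - ratr r) (x + ratr r); first by rewrite ltrD2l gtrN.
    rewrite in_itv/= => /andP[p1 p2]; exists p; rewrite ltr_norml; lra.
  have [q qP] : exists q : rat, `|y - ratr q| < ratr r.
    have [|q] := @rat_in_itvoo R (y - ratr r) (y + ratr r); first by rewrite ltrD2l gtrN.
    rewrite in_itv/= => /andP[p1 p2]; exists q; rewrite ltr_norml; lra.
  exists (p, q, r) => //; case: asboolP => [_|]; last first.
    case=> -[a b] [/= Ba Bb]; apply: dU; split => /=.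
      rewrite /ball/= in Ba *; have := ler_distD (ratr p) x a; lra.
    rewrite /ball/= in Bb *; have := ler_distD (ratr q) y b; lra.
  by split => /=; rewrite /ball/= distrC.
apply: countable_bigcupT_measurable => [|q]; first exact: countableP.
by case: asboolP => // _; apply: measurableX; exact: measurable_ball.
Unshelve. all: end_near. Qed.

Lemma continuous_measurable_plane f : continuous f -> measurable_fun setT f.
Proof.
move=> /continuousP cf; apply: (measurability _ (RGenOpens.measurableE R)).
move=> _ [_ [a [b ->] <-]]; rewrite setTI; apply: open_measurable_plane.
exact/cf/interval_open.
Qed.

Lemma closed_ref_triangle : closed T.
Proof.
have -> : T = (fst @^-1` [set` `[0, +oo[]) `&` (snd @^-1` [set` `[0, +oo[]) `&`
    ((fun xi : (R * R)%type => xi.1 + xi.2) @^-1` [set` `]-oo, 1]]).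
  apply/seteqP; split=> -[x y] /=; rewrite ?in_itv/= ?andbT.
    by case.
  by case=> -[].
apply: closedI; first apply: closedI.
- by apply: preimage_closed; [move=> xi _; exact: cvg_fst|exact: rray_closed].
- by apply: preimage_closed; [move=> xi _; exact: cvg_snd|exact: rray_closed].
- apply: preimage_closed; last exact: lray_closed.
  by move=> xi _; apply: cvgD; [exact: cvg_fst|exact: cvg_snd].
Qed.

Lemma sub_ref_triangle : T `<=` [set` `[0, 1]] `*` [set` `[0, 1]].
Proof.
move=> [x y] /= [/= x0 y0 xy]; rewrite !in_itv/=.
by split; apply/andP; split => //; lra.
Qed.

Lemma compact_ref_triangle : compact T.
Proof.
apply: subclosed_compact closed_ref_triangle _ sub_ref_triangle.
by apply: compact_setX; exact: segment_compact.
Qed.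

Lemma measurable_ref_triangle : measurable T.
Proof.
rewrite -[T]setCK; apply: measurableC; apply: open_measurable_plane.
exact/closed_openC/closed_ref_triangle.
Qed.

Lemma ref_triangle_finite : (mu2 T < +oo)%E.
Proof.
apply: (@le_lt_trans _ _ (mu2 ([set` `[0, 1]] `*` [set` `[0, 1]]))).
  apply: le_measure; rewrite ?inE; [exact: measurable_ref_triangle| |exact: sub_ref_triangle].
  exact: measurableX.
by rewrite product_measure1E//= lebesgue_measure_itv/= lte_fin ltr01 oppr0 adde0 mule1 ltry.
Qed.

(** These functions form an algebra on which the integral is linear and
    monotone; the integrands met below are all of this kind. *)
Definition bddmeas f :=
  measurable_fun T f /\ exists M, forall xi, T xi -> `|f xi| <= M.

Lemma bddmeas_continuous f : continuous f -> bddmeas f.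
Proof.
move=> cf; split.
  apply: (measurable_funS measurableT) (continuous_measurable_plane cf) => //.
have /compact_bounded[M [_ HM]] : compact (f @` T).
  by apply: continuous_compact compact_ref_triangle; exact: continuous_subspaceT.
exists (M + 1) => xi Txi; apply: HM; first by rewrite ltrDl.
by exists xi.
Qed.

Lemma bddmeas_integrable f : bddmeas f -> mu2.-integrable T (EFin \o f).
Proof.
move=> [mf [M HM]]; apply: measurable_bounded_integrable => //.
- exact: measurable_ref_triangle.
- exact: ref_triangle_finite.
- by exists M; split; [exact: num_real|move=> x /ltW Mx y Ty; apply: le_trans Mx; exact: HM].
Qed.

Lemma bddmeas_cst c : bddmeas (fun=> c).
Proof. by apply: bddmeas_continuous => ?; exact: cvg_cst. Qed.

Lemma bddmeasD f g : bddmeas f -> bddmeas g -> bddmeas (fun xi => f xi + g xi).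
Proof.
move=> [mf [M HM]] [mg [N HN]]; split; first exact: measurable_funD.
by exists (M + N) => xi Txi; rewrite (le_trans (ler_normD _ _))// lerD ?HM ?HN.
Qed.

Lemma bddmeasM f g : bddmeas f -> bddmeas g -> bddmeas (fun xi => f xi * g xi).
Proof.
move=> [mf [M HM]] [mg [N HN]]; split; first exact: measurable_funM.
by exists (M * N) => xi Txi; rewrite normrM ler_pM ?HM ?HN.
Qed.

Lemma bddmeasN f : bddmeas f -> bddmeas (fun xi => - f xi).
Proof.
move=> gf; have := bddmeasM (bddmeas_cst (-1)) gf.
by under eq_fun do rewrite mulN1r.
Qed.

Lemma bddmeasB f g : bddmeas f -> bddmeas g -> bddmeas (fun xi => f xi - g xi).
Proof. by move=> gf gg; apply: bddmeasD => //; exact: bddmeasN. Qed.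

Lemma bddmeas_sum (I : Type) (r : seq I) (P : pred I) (F : I -> (R * R)%type -> R) :
  (forall i, P i -> bddmeas (F i)) -> bddmeas (fun xi => \sum_(i <- r | P i) F i xi).
Proof.
move=> gF; elim: r => [|i r IH].
  by under eq_fun do rewrite big_nil; exact: bddmeas_cst.
under eq_fun do rewrite big_cons; case Pi : (P i) => //.
by apply: bddmeasD => //; exact: gF.
Qed.

Lemma bddmeas_inv f m : 0 < m -> (forall xi, T xi -> m <= f xi) -> bddmeas f ->
  bddmeas (fun xi => (f xi)^-1).
Proof.
move=> m0 fm [mf _]; split; last first.
  exists m^-1 => xi Txi; have fxi := fm _ Txi; have f0 : 0 < f xi by exact: lt_le_trans fxi.
  by rewrite gtr0_norm ?invr_gt0// lef_pV2.
apply: (@eq_measurable_fun _ _ _ _ T ((fun y => (Num.max m y)^-1) \o f)).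
  by move=> xi; rewrite inE => Txi /=; rewrite max_r// fm.
apply: measurableT_comp mf; apply: continuous_measurable_fun => y.
apply: cvgV; first by rewrite gt_eqF// lt_max m0.
by apply: continuous_max; [exact: cvg_cst|exact: cvg_id].
Qed.

Definition Itri f : R := \int[mu2]_(xi in T) f xi.

Lemma eq_Itri f g : (forall xi, T xi -> f xi = g xi) -> Itri f = Itri g.
Proof. by move=> fg; apply: eq_Rintegral => xi; rewrite inE; exact: fg. Qed.

Lemma ItriD f g : bddmeas f -> bddmeas g -> Itri (fun xi => f xi + g xi) = Itri f + Itri g.
Proof.
by move=> gf gg; apply: RintegralD; [exact: measurable_ref_triangle|exact: bddmeas_integrable..].
Qed.

Lemma ItriZ c f : bddmeas f -> Itri (fun xi => c * f xi) = c * Itri f.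
Proof.
by move=> gf; apply: RintegralZl; [exact: measurable_ref_triangle|exact: bddmeas_integrable].
Qed.

Lemma ItriB f g : bddmeas f -> bddmeas g -> Itri (fun xi => f xi - g xi) = Itri f - Itri g.
Proof.
by move=> gf gg; apply: RintegralB; [exact: measurable_ref_triangle|exact: bddmeas_integrable..].
Qed.

Lemma le_Itri f g : bddmeas f -> bddmeas g -> (forall xi, T xi -> f xi <= g xi) ->
  Itri f <= Itri g.
Proof.
by move=> gf gg fg; rewrite /Itri; apply: le_Rintegral => //; [exact: measurable_ref_triangle|exact: bddmeas_integrable..].
Qed.

Lemma Itri_ge0 f : (forall xi, T xi -> 0 <= f xi) -> 0 <= Itri f.
Proof. by move=> f0; rewrite /Itri; apply: Rintegral_ge0. Qed.

Lemma Itri0 : Itri (fun=> 0) = 0.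
Proof. by have := ItriZ 0 (bddmeas_cst 0); under eq_fun do rewrite mul0r; rewrite mul0r. Qed.

Lemma Itri_sum (I : Type) (r : seq I) (P : pred I) (F : I -> (R * R)%type -> R) :
  (forall i, P i -> bddmeas (F i)) ->
  Itri (fun xi => \sum_(i <- r | P i) F i xi) = \sum_(i <- r | P i) Itri (F i).
Proof.
move=> gF; elim: r => [|i r IH].
  by rewrite big_nil; under eq_fun do rewrite big_nil; exact: Itri0.
rewrite big_cons; under eq_fun do rewrite big_cons.
case Pi : (P i) => //; rewrite ItriD ?IH//; first exact: gF.
exact: bddmeas_sum.
Qed.

End ReferenceTriangle.

(** * Inverse estimate for a finite family of functions *)

Section InverseEstimate.
Context {R : realType}.
Implicit Types (f g : (R * R)%type -> R) (xi : (R * R)%type).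
Local Notation T := (@ref_triangle R).
Local Notation mu2 := (@lebesgue_measure R \x @lebesgue_measure R)%E.

(** Shrinking towards the barycentre moves any point of the triangle, also on
    the boundary, to the centre of a box inside the triangle. *)
Lemma Itri_box_gt0 xi (r : R) : T xi -> 0 < r ->
  exists B, [/\ measurable B, B `<=` T, B `<=` ball xi r & (0 < fine (mu2 B))].
Proof.
case: xi => x y [/= x0 y0 xy1] r0.
(* The factor by which the point is moved towards [(1/3, 1/3)]; the box has
   half-width [s / 6]. *)
pose s := Num.min (1 / 2) (r / 2).
have s0 : 0 < s by rewrite /s lt_min !divr_gt0.
have s1 : s <= 1 / 2 by rewrite /s ge_min lexx.
have sr : s <= r / 2 by rewrite /s ge_min lexx orbT.
clearbody s; pose a := x + s * (1 / 3 - x); pose b := y + s * (1 / 3 - y).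
pose B : set (R * R)%type := [set` `[a - s / 6, a + s / 6]] `*` [set` `[b - s / 6, b + s / 6]].
exists B; split.
- exact: measurableX.
- move=> [u v] /= [] /andP[u1 u2] /andP[v1 v2]; rewrite !bnd_simp/= in u1 u2 v1 v2.
  have sx : 0 <= (1 - s) * x by apply: mulr_ge0 => //; lra.
  have sy : 0 <= (1 - s) * y by apply: mulr_ge0 => //; lra.
  have sxy : 0 <= (1 - s) * (1 - x - y) by apply: mulr_ge0 => //; lra.
  rewrite /a /b in u1 u2 v1 v2; split => /=; lra.
- move=> [u v] /= [] /andP[u1 u2] /andP[v1 v2]; rewrite !bnd_simp/= in u1 u2 v1 v2.
  have sx : s * x <= s by apply: ler_piMr; lra.
  have sy : s * y <= s by apply: ler_piMr; lra.
  have sx' : 0 <= s * x by apply: mulr_ge0 => //; exact: ltW.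
  have sy' : 0 <= s * y by apply: mulr_ge0 => //; exact: ltW.
  rewrite /a /b in u1 u2 v1 v2; split; rewrite /ball/= ltr_norml; apply/andP; split; nra.
have -> : mu2 B = ((s / 3)%:E * (s / 3)%:E)%E.
  rewrite product_measure1E; [|exact: measurable_itv|exact: measurable_itv].
  have E c : lebesgue_measure [set` `[c - s / 6, c + s / 6]] = (s / 3)%:E.
    rewrite lebesgue_measure_itv/= lte_fin ifT; last by lra.
    by rewrite -EFinD; congr EFin; lra.
  by rewrite -{1}(E a) -(E b).
by rewrite -EFinM/=; apply: mulr_gt0; lra.
Qed.

Lemma Itri_eq0 f : continuous f -> (forall xi, T xi -> 0 <= f xi) ->
  Itri f = 0 -> forall xi, T xi -> f xi = 0.
Proof.
move=> cf f0 If0 xi Txi; apply/eqP; rewrite eq_le f0// andbT leNgt; apply/negP => fxi.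
have [r /= r0 fr] : exists2 r : R, 0 < r & forall z, ball xi r z -> f xi / 2 <= f z.
  have : \forall z \near xi, f xi / 2 < f z.
    by apply: (cvgr_gt _ (cf xi)); rewrite ltr_pdivrMr// ltr_pMr// ltr1n.
  by move=> /nbhs_ballP[r /= r0 fr]; exists r => // z /fr/ltW.
have [B [mB BT Br Bgt0]] := Itri_box_gt0 Txi r0.
have gB : bddmeas (\1_B : _ -> R).
  split; first exact: measurable_indic.
  by exists 1 => z _; rewrite indicE; case: (z \in B); rewrite ?normr1 ?normr0.
suff : f xi / 2 * fine (mu2 B) <= Itri f.
  by rewrite If0; apply/negP; rewrite -ltNge mulr_gt0 ?divr_gt0.
have -> : fine (mu2 B) = Itri \1_B.
  by rewrite /Itri /Rintegral integral_indic ?(setIidl BT)//; exact: measurable_ref_triangle.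
rewrite -ItriZ//; apply: le_Itri.
- by apply: bddmeasM => //; exact: bddmeas_cst.
- exact: bddmeas_continuous.
move=> z Tz; rewrite indicE; have [|_] := boolP (z \in B); last by rewrite mulr0 f0.
by rewrite inE mulr1 => Bz; apply: fr; exact: Br.
Qed.

Lemma continuous_sumr (V : topologicalType) (I : Type) (r : seq I) (P : pred I) (F : I -> V -> R) :
  (forall i, P i -> continuous (F i)) -> continuous (fun v => \sum_(i <- r | P i) F i v).
Proof.
move=> cF; elim: r => [|i r IH].
  by under eq_fun do rewrite big_nil; move=> ?; exact: cvg_cst.
under eq_fun do rewrite big_cons; case Pi : (P i) => //.
by move=> v; apply: cvgD; [exact: cF|exact: IH].
Qed.

(** The integral of a product is a semi-inner product on the span of the [f i],
    with Gram matrix [G].  The evaluation at [xi] vanishes on the kernel of [G],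
    so it is represented by the coefficients [u xi = phi xi *m pinvmx G], which
    are continuous in [xi]; Cauchy-Schwarz then bounds the evaluation, and its
    norm is bounded on the compact triangle. *)
Lemma inverse_estimate_ord n (f : 'I_n -> (R * R)%type -> R) :
  (forall i, continuous (f i)) ->
  exists2 C : R, 0 < C & forall (c : 'I_n -> R) xi, T xi ->
    (\sum_i c i * f i xi) ^+ 2 <= C * Itri (fun z => (\sum_i c i * f i z) ^+ 2).
Proof.
move=> cf.
have cp (c : 'I_n -> R) : continuous (fun z => \sum_i c i * f i z).
  by apply: continuous_sumr => i _ z; apply: cvgM; [exact: cvg_cst|exact: cf].
have gM i j : bddmeas (fun z => f i z * f j z) by apply: bddmeasM; exact: bddmeas_continuous.
pose G := \matrix_(i < n, j < n) Itri (fun z => f i z * f j z).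
pose b (c d : 'I_n -> R) := Itri (fun z => (\sum_i c i * f i z) * (\sum_i d i * f i z)).
have bE c d : b c d = ((\row_i c i) *m G *m (\col_i d i)) 0 0.
  rewrite mxE; under eq_bigr do rewrite !mxE mulr_suml.
  rewrite /b exchange_big/=; under eq_fun do rewrite mulr_suml.
  rewrite Itri_sum => [|i _]; last first.
    under eq_fun do rewrite mulr_sumr; apply: bddmeas_sum => j _.
    under eq_fun do rewrite mulrACA; apply: bddmeasM => //; exact: bddmeas_cst.
  apply: eq_bigr => i _; under eq_fun do rewrite mulr_sumr.
  rewrite Itri_sum => [|j _]; last first.
    under eq_fun do rewrite mulrACA; apply: bddmeasM => //; exact: bddmeas_cst.
  apply: eq_bigr => j _; under eq_fun do rewrite mulrACA.
  by rewrite ItriZ// !mxE; ring.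
have cpp c d : continuous (fun z => (\sum_i c i * f i z) * (\sum_i d i * f i z)).
  by move=> z; apply: cvgM; exact: cp.
have ker c : b c c = 0 -> forall z, T z -> \sum_i c i * f i z = 0.
  move=> bc0 z Tz; apply/eqP; rewrite -[_ == 0]orbb -mulf_eq0; apply/eqP.
  by apply: (Itri_eq0 (cpp c c)) Tz => // w _; rewrite -expr2 sqr_ge0.
have bge0 c : 0 <= b c c by apply: Itri_ge0 => z _; rewrite -expr2 sqr_ge0.
have CS c d : (b c d) ^+ 2 <= b c c * b d d.
  have [d0|d0] := eqVneq (b d d) 0.
    suff -> : b c d = 0 by rewrite d0 mulr0 expr0n.
    rewrite /b (eq_Itri (g := fun=> 0)) ?Itri0// => z Tz.
    by rewrite (ker d)// mulr0.
  have dgt0 : 0 < b d d by rewrite lt_neqAle eq_sym d0 bge0.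
  pose s := b c d / b d d.
  have := bge0 (fun i => c i - s * d i).
  have -> : b (fun i => c i - s * d i) (fun i => c i - s * d i)
      = b c c - 2 * s * b c d + s ^+ 2 * b d d.
    rewrite -!ItriZ; try exact/bddmeas_continuous/cpp.
    rewrite -ItriB; [|exact/bddmeas_continuous/cpp|by apply: bddmeasM; [exact: bddmeas_cst|exact/bddmeas_continuous/cpp]].
    rewrite -ItriD; last 2 first.
    - by apply: bddmeasB; [|apply: bddmeasM; [exact: bddmeas_cst|]]; exact/bddmeas_continuous/cpp.
    - by apply: bddmeasM; [exact: bddmeas_cst|exact/bddmeas_continuous/cpp].
    congr Itri; apply/funext => z.
    have -> : \sum_i (c i - s * d i) * f i z = \sum_i c i * f i z - s * \sum_i d i * f i z.
      by rewrite mulr_sumr -sumrB; apply: eq_bigr => i _; ring.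
    by ring.
  rewrite -(pmulr_lge0 _ dgt0).
  suff -> : (b c c - 2 * s * b c d + s ^+ 2 * b d d) * b d d = b c c * b d d - b c d ^+ 2 by rewrite subr_ge0.
  by rewrite /s; field.
have Gsym : G^T = G.
  by apply/matrixP => i j; rewrite !mxE; congr Itri; apply/funext => z; rewrite mulrC.
pose phi z := \row_i f i z.
(* A coefficient vector in the kernel of [G] gives the zero function, so the
   row of values [phi z] is orthogonal to that kernel. *)
have phiG z : T z -> (phi z <= G)%MS.
  move=> Tz; rewrite submxE; apply/eqP/rowP => j; rewrite [RHS]mxE.
  pose c i := cokermx G i j.
  have cE : \col_i c i = col j (cokermx G) by apply/colP => i; rewrite !mxE.
  have bc : b c c = 0.
    by rewrite bE cE colE (mulmxA _ (cokermx G)) -(mulmxA _ G) mulmx_coker mulmx0 mul0mx mxE.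
  rewrite mxE -[RHS](ker c bc z Tz); apply: eq_bigr => i _.
  by rewrite mxE mulrC.
pose u z i := (phi z *m pinvmx G) 0 i.
have uE z : \row_i u z i = phi z *m pinvmx G by apply/rowP => i; rewrite mxE.
have pE z c : T z -> \sum_i c i * f i z = b (u z) c.
  move=> Tz; rewrite bE uE (mulmxKpV (phiG _ Tz)) mxE.
  by apply: eq_bigr => i _; rewrite !mxE mulrC.
have cu i : continuous (u ^~ i).
  rewrite /u; under eq_fun do rewrite mxE; apply: continuous_sumr => j _.
  under eq_fun do rewrite mxE.
  by move=> z; apply: cvgM; [exact: cf|exact: cvg_cst].
have [_ [M HM]] : bddmeas (fun z => \sum_i u z i * f i z).
  by apply: bddmeas_continuous; apply: continuous_sumr => i _ z; apply: cvgM; [exact: cu|exact: cf].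
exists (`|M| + 1) => [|c z Tz]; first by rewrite ltr_wpDl.
rewrite pE//; apply: le_trans (CS _ _) _.
rewrite -[Itri _]/(b c c) ler_wpM2r//.
rewrite -pE// (le_trans (ler_norm _))// (le_trans (HM _ Tz))//.
by rewrite (le_trans (ler_norm M))// lerDl.
Qed.

Lemma inverse_estimate (A : finType) (f : A -> (R * R)%type -> R) :
  (forall i, continuous (f i)) ->
  exists2 C : R, 0 < C & forall (c : A -> R) xi, T xi ->
    (\sum_i c i * f i xi) ^+ 2 <= C * Itri (fun z => (\sum_i c i * f i z) ^+ 2).
Proof.
move=> cf; have [|C C0 HC] := @inverse_estimate_ord #|A| (fun i => f (enum_val i)).
  by move=> i; exact: cf.
exists C => // c xi Txi; have := HC (fun i => c (enum_val i)) xi Txi.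
have E z : \sum_(i < #|A|) c (enum_val i) * f (enum_val i) z = \sum_i c i * f i z.
  by rewrite [RHS](reindex (@enum_val A predT))//=; exact/onW_bij/enum_val_bij.
rewrite E; congr (_ <= _ * Itri _); apply/funext => z; by rewrite E.
Qed.

End InverseEstimate.

(** * Polynomials on the reference triangle and element maps *)

Section DerivativeRules.
Context {R : realType} {V : normedModType R}.
Implicit Types (f g : V -> R) (x v : V).

Lemma is_derive_affine f x v l :
  (forall h, f (h *: v + x) = f x + h * l) -> is_derive x v f l.
Proof.
move=> H; have : (fun h : R => h^-1 *: ((f \o shift x) (h *: v) - f x)) @ 0^' --> l.
  apply: cvg_near_cst; near=> h; rewrite /= H addrAC subrr add0r /GRing.scale/= mulKf//.
  near: h; exact: nbhs_dnbhs_neq.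
by move=> cl; split; [apply/cvg_ex; exists l|exact/cvg_lim].
Unshelve. all: end_near. Qed.

Lemma is_derive_bigsum (I : Type) (r : seq I) (P : pred I) (F : I -> V -> R) (dF : I -> R) x v :
  (forall i, P i -> is_derive x v (F i) (dF i)) ->
  is_derive x v (fun z => \sum_(i <- r | P i) F i z) (\sum_(i <- r | P i) dF i).
Proof.
move=> dFi; elim: r => [|i r IH].
  by rewrite big_nil; under eq_fun do rewrite big_nil; exact: is_derive_cst.
rewrite big_cons; under eq_fun do rewrite big_cons; case Pi : (P i) => //.
by have dFPi := dFi i Pi; exact: is_deriveD.
Qed.

Lemma is_derive_mx m n (M : V -> 'M[R]_(m, n)) (dM : 'M[R]_(m, n)) x v :
  (forall i j, is_derive x v (fun z => M z i j) (dM i j)) -> is_derive x v M dM.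
Proof.
move=> H; have dM' : derivable M x v by apply/derivable_mxP => i j; case: (H i j).
split => //; rewrite derive_mx//; apply/matrixP => i j; rewrite mxE.
exact: derive_val.
Qed.

End DerivativeRules.

Section PlanarPolynomials.
Context {R : realType}.
Implicit Types (f g : (R * R)%type -> R) (xi v : (R * R)%type).

(** Polynomial functions of two variables, generated so that regularity follows
    by induction on the construction. *)
Inductive planar_poly : ((R * R)%type -> R) -> Prop :=
| planar_cst c : planar_poly (fun=> c)
| planar_fst : planar_poly fst
| planar_snd : planar_poly snd
| planarD f g : planar_poly f -> planar_poly g -> planar_poly (fun xi => f xi + g xi)
| planarM f g : planar_poly f -> planar_poly g -> planar_poly (fun xi => f xi * g xi).

Lemma planar_continuous f : planar_poly f -> continuous f.
Proof.
elim=> [c|||{}f g _ cf _ cg|{}f g _ cf _ cg] xi.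
- exact: cvg_cst.
- exact: cvg_fst.
- exact: cvg_snd.
- by apply: cvgD; [exact: cf|exact: cg].
- by apply: cvgM; [exact: cf|exact: cg].
Qed.

Lemma planar_derive f : planar_poly f -> forall v,
  exists2 df, planar_poly df & forall xi, is_derive xi v f (df xi).
Proof.
elim=> [c|||{}f g pf Hf pg Hg|{}f g pf Hf pg Hg] v.
- by exists (fun=> 0) => [|xi]; [exact: planar_cst|exact: is_derive_cst].
- by exists (fun=> v.1) => [|xi]; [exact: planar_cst|apply: is_derive_affine => h /=; rewrite addrC].
- by exists (fun=> v.2) => [|xi]; [exact: planar_cst|apply: is_derive_affine => h /=; rewrite addrC].
- have [df pdf df'] := Hf v; have [dg pdg dg'] := Hg v.
  by exists (fun xi => df xi + dg xi) => [|xi]; [exact: planarD|exact: is_deriveD].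
- have [df pdf df'] := Hf v; have [dg pdg dg'] := Hg v.
  exists (fun xi => f xi * dg xi + g xi * df xi) => [|xi]; last exact: is_deriveM.
  by apply: planarD; exact: planarM.
Qed.

Lemma planar_prod (I : Type) (r : seq I) (F : I -> (R * R)%type -> R) :
  (forall i, planar_poly (F i)) -> planar_poly (fun xi => \prod_(i <- r) F i xi).
Proof.
move=> pF; elim: r => [|i r IH].
  by under eq_fun do rewrite big_nil; exact: planar_cst.
by under eq_fun do rewrite big_cons; exact: planarM.
Qed.

Lemma planar_lagrange k (a : lattice k) : planar_poly (lagrange a : _ -> R).
Proof.
apply: planar_prod => i; apply: planar_prod => m.
apply: (@planarM (fun xi => k%:R * bary xi i - m%:R)); last exact: planar_cst.
apply: planarD; last exact: planar_cst.
apply: planarM; first exact: planar_cst.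
have N (f : (R * R)%type -> R) : planar_poly f -> planar_poly (fun xi => - f xi).
  by move=> pf; under eq_fun do rewrite -mulN1r; apply: planarM => //; exact: planar_cst.
case: i => -[|[|[|//]]] hi; rewrite /bary /=.
- apply: (@planarD (fun xi => 1 - xi.1)); last by apply: N; exact: planar_snd.
  by apply: planarD; [exact: planar_cst|apply: N; exact: planar_fst].
- exact: planar_fst.
- exact: planar_snd.
Qed.

Lemma is_derive_lagrange k (a : lattice k) xi v :
  is_derive xi v (lagrange a) ('D_v (lagrange a : _ -> R) xi).
Proof.
have [df _ dL] := planar_derive (planar_lagrange a) v.
by have := dL xi => dLxi; exact/derivableP.
Qed.

Lemma continuous_ref_grad k (a : lattice k) (r : 'I_2) :
  continuous (fun xi => ref_grad (lagrange a : _ -> R) xi r).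
Proof.
rewrite /ref_grad; set v := (if _ then _ else _).
have [df pdf dL] := planar_derive (planar_lagrange a) v.
suff -> : (fun xi => 'D_v (lagrange a : _ -> R) xi) = df by exact: planar_continuous.
by apply/funext => xi; exact: derive_val.
Qed.

End PlanarPolynomials.

Section ElementMaps.
Context {R : realType} (k : nat) (tr : triangulation R k).
Implicit Types (x w : nodal tr) (e : 'I_(nb_elts tr)) (xi : (R * R)%type).

Lemma elt_mapE x e xi l :
  elt_map x e xi 0 l = \sum_a lagrange a xi * x (local_node e a) l.
Proof. by rewrite summxE; apply: eq_bigr => a _; rewrite !mxE. Qed.

Lemma jacE x e xi r l :
  jac x e xi r l = \sum_a x (local_node e a) l * ref_grad (lagrange a) xi r.
Proof.
rewrite mxE /ref_grad; set v := (if _ then _ else _).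
have H : is_derive xi v (elt_map x e)
    (\row_l \sum_a x (local_node e a) l * 'D_v (lagrange a : _ -> R) xi).
  apply: is_derive_mx => i j; rewrite ord1.
  under eq_fun do rewrite elt_mapE.
  rewrite mxE; apply: is_derive_bigsum => a _.
  have dL := is_derive_lagrange a xi v.
  have := is_deriveM dL (is_derive_cst (x (local_node e a) j) xi v).
  by rewrite scaler0 add0r.
by rewrite (@derive_val _ _ _ _ _ _ _ H) mxE.
Qed.

Lemma ref_grad_basis j e xi r :
  ref_grad (basis_fun j e) xi r =
  \sum_(a | local_node e a == j) ref_grad (lagrange a : _ -> R) xi r.
Proof.
rewrite /ref_grad; set v := (if _ then _ else _).
apply: derive_val; apply: is_derive_bigsum => a _; exact: is_derive_lagrange.
Qed.

Lemma elt_mapD x w e xi : elt_map (x + w) e xi = elt_map x e xi + elt_map w e xi.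
Proof.
apply/rowP => l; rewrite mxE !elt_mapE -big_split/=.
by apply: eq_bigr => a _; rewrite mxE mulrDr.
Qed.

Lemma jacD x w e xi : jac (x + w) e xi = jac x e xi + jac w e xi.
Proof.
apply/matrixP => r l; rewrite [RHS]mxE !jacE -big_split/=.
by apply: eq_bigr => a _; rewrite mxE mulrDl.
Qed.

Lemma elt_mapN w e xi : elt_map (- w) e xi = - elt_map w e xi.
Proof.
apply/rowP => l; rewrite mxE !elt_mapE -sumrN.
by apply: eq_bigr => a _; rewrite mxE mulrN.
Qed.

Lemma jacN w e xi : jac (- w) e xi = - jac w e xi.
Proof.
apply/matrixP => r l; rewrite [RHS]mxE !jacE -sumrN.
by apply: eq_bigr => a _; rewrite mxE mulNr.
Qed.

Lemma continuous_elt_map x e l : continuous (fun xi => elt_map x e xi 0 l).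
Proof.
under eq_fun do rewrite elt_mapE; apply: continuous_sumr => a _ xi.
by apply: cvgM; [exact/planar_continuous/planar_lagrange|exact: cvg_cst].
Qed.

Lemma continuous_jac x e r l : continuous (fun xi => jac x e xi r l).
Proof.
under eq_fun do rewrite jacE; apply: continuous_sumr => a _ xi.
by apply: cvgM; [exact: cvg_cst|exact: continuous_ref_grad].
Qed.

Lemma sum_basis w e xi l :
  \sum_j w j l * basis_fun j e xi = elt_map w e xi 0 l.
Proof.
rewrite elt_mapE (partition_big (local_node e) predT)//=.
apply: eq_bigr => j _; rewrite mulr_sumr; apply: eq_bigr => a /eqP ->.
by rewrite mulrC.
Qed.

Lemma sum_ref_grad_basis w e xi r l :
  \sum_j w j l * ref_grad (basis_fun j e) xi r = jac w e xi r l.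
Proof.
rewrite jacE (partition_big (local_node e) predT)//=.
apply: eq_bigr => j _; rewrite ref_grad_basis mulr_sumr.
by apply: eq_bigr => a /eqP ->.
Qed.

End ElementMaps.

(** * Pointwise algebra of Jacobians *)

Section OneNorm.
Context {R : realType}.

Lemma sum_ord2 (V : nmodType) (F : 'I_2 -> V) : \sum_i F i = F 0 + F 1.
Proof. by rewrite !big_ord_recl big_ord0 addr0; congr (_ + F _); apply/val_inj. Qed.

Lemma sum_ord3 (V : nmodType) (F : 'I_3 -> V) : \sum_i F i = F 0 + F 1 + F 2.
Proof.
by rewrite !big_ord_recl big_ord0 addr0 addrA; congr (_ + F _ + F _); apply/val_inj.
Qed.

Lemma sqr_sum_le (I : finType) (a : I -> R) :
  (\sum_i a i) ^+ 2 <= #|I|%:R * \sum_i a i ^+ 2.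
Proof.
rewrite expr2 big_distrlr/=.
have -> : #|I|%:R * \sum_i a i ^+ 2 = \sum_i \sum_j (a i ^+ 2 + a j ^+ 2) / 2.
  pose S := \sum_i a i ^+ 2.
  have -> : \sum_i \sum_j (a i ^+ 2 + a j ^+ 2) / 2 =
      \sum_(i : I) (a i ^+ 2 * #|I|%:R / 2 + S / 2).
    apply: eq_bigr => i _; rewrite -mulr_suml big_split/= sumr_const.
    by rewrite mulrDl mulr_natr.
  by rewrite big_split/= sumr_const -!mulr_suml -mulr_natl -/S; field.
apply: ler_sum => i _; apply: ler_sum => j _.
by rewrite ler_pdivlMr// -subr_ge0; have := sqr_ge0 (a i - a j); congr (_ <= _); ring.
Qed.

(** Sums and products of entries are estimated without square roots in this
    norm. *)
Definition nrm1 m n (A : 'M[R]_(m, n)) : R := \sum_i \sum_j `|A i j|.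

Lemma nrm1_ge0 m n (A : 'M[R]_(m, n)) : 0 <= nrm1 A.
Proof. by apply: sumr_ge0 => i _; apply: sumr_ge0. Qed.

Lemma entry_le_nrm1 m n (A : 'M[R]_(m, n)) i j : `|A i j| <= nrm1 A.
Proof.
rewrite /nrm1 (bigD1 i)//= (bigD1 j)//= -addrA lerDl.
by apply: addr_ge0; [exact: sumr_ge0|apply: sumr_ge0 => ? _; exact: sumr_ge0].
Qed.

Lemma entry_dist m n (A B : 'M[R]_(m, n)) i j : `|A i j - B i j| <= nrm1 (A - B).
Proof. by apply: le_trans (entry_le_nrm1 _ i j); rewrite !mxE. Qed.

Lemma nrm1D m n (A B : 'M[R]_(m, n)) : nrm1 (A + B) <= nrm1 A + nrm1 B.
Proof.
rewrite /nrm1 -big_split/=; apply: ler_sum => i _; rewrite -big_split/=.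
by apply: ler_sum => j _; rewrite mxE ler_normD.
Qed.

Lemma nrm1N m n (A : 'M[R]_(m, n)) : nrm1 (- A) = nrm1 A.
Proof. by apply: eq_bigr => i _; apply: eq_bigr => j _; rewrite mxE normrN. Qed.

Definition frob2 m n (A : 'M[R]_(m, n)) : R := \sum_i \sum_j A i j ^+ 2.

Lemma frob2_ge0 m n (A : 'M[R]_(m, n)) : 0 <= frob2 A.
Proof. by apply: sumr_ge0 => i _; apply: sumr_ge0 => j _; exact: sqr_ge0. Qed.

Lemma nrm1_sqr_le m n (A : 'M[R]_(m, n)) : nrm1 A ^+ 2 <= (m * n)%:R * frob2 A.
Proof.
rewrite /nrm1 /frob2 !pair_bigA/=; apply: le_trans (sqr_sum_le _) _.
rewrite card_prod !card_ord le_eqVlt; apply/orP; left; apply/eqP; congr (_ * _).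
by apply: eq_bigr => p _; rewrite real_normK// num_real.
Qed.

Lemma frob2_le_nrm1 m n (A : 'M[R]_(m, n)) : frob2 A <= nrm1 A ^+ 2.
Proof.
rewrite expr2 {1}/nrm1 mulr_suml; apply: ler_sum => i _; rewrite mulr_suml.
apply: ler_sum => j _; rewrite -[A i j ^+ 2]real_normK ?num_real// expr2.
by rewrite ler_wpM2l// entry_le_nrm1.
Qed.

Lemma dot_frob2 n (u : 'rV[R]_n) : dot u u = frob2 u.
Proof. by rewrite /frob2 big_ord1; apply: eq_bigr => i _; rewrite expr2. Qed.

Lemma norm_dot_le n (u v : 'rV[R]_n) : `|dot u v| <= nrm1 u * nrm1 v.
Proof.
apply: le_trans (ler_norm_sum _ _ _) _.
rewrite {1}/nrm1 big_ord1 mulr_suml; apply: ler_sum => i _.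
by rewrite normrM ler_wpM2l// entry_le_nrm1.
Qed.

Lemma dotZl n a (u v : 'rV[R]_n) : dot (a *: u) v = a * dot u v.
Proof. by rewrite /dot mulr_sumr; apply: eq_bigr => i _; rewrite mxE mulrA. Qed.

End OneNorm.

Section AreaElement.
Context {R : realType}.
Implicit Types (J P Q : 'M[R]_(2, 3)) (u v : 'rV[R]_3).

Definition crossJ J : 'rV[R]_3 := cross (row 0 J) (row 1 J).

Definition areaJ J : R := Num.sqrt (\det (J *m J^T)).

Let o12 : ((1 : 'I_3) + 1 = 2) * ((1 : 'I_3) + 2 = 0) * ((2 : 'I_3) + 1 = 0) * ((2 : 'I_3) + 2 = 1).
Proof. by do !split; apply/val_inj. Qed.

Lemma crossJE J :
  ((crossJ J 0 0 = J 0 1 * J 1 2 - J 0 2 * J 1 1) *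
   (crossJ J 0 1 = J 0 2 * J 1 0 - J 0 0 * J 1 2) *
   (crossJ J 0 2 = J 0 0 * J 1 1 - J 0 1 * J 1 0))%type.
Proof. by rewrite /crossJ /cross !mxE !add0r !o12. Qed.

Lemma gramE J r s : (J *m J^T) r s = J r 0 * J s 0 + J r 1 * J s 1 + J r 2 * J s 2.
Proof. by rewrite mxE sum_ord3 !mxE. Qed.

Lemma det2E (G : 'M[R]_2) : \det G = G 0 0 * G 1 1 - G 0 1 * G 1 0.
Proof.
rewrite (expand_det_row _ 0) sum_ord2 /cofactor !det_mx11 !mxE /= expr0 mul1r expr1.
have -> : lift (1 : 'I_2) 0 = 0 by apply/val_inj.
have -> : lift (0 : 'I_2) 0 = 1 by apply/val_inj.
by rewrite mulN1r mulrN.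
Qed.

(** Lagrange's identity: the area element is the length of the cross product of
    the partial derivatives. *)
Lemma det_gram J : \det (J *m J^T) = frob2 (crossJ J).
Proof. by rewrite det2E !gramE /frob2 big_ord1 sum_ord3 !crossJE; ring. Qed.

Lemma areaJ_ge0 J : 0 <= areaJ J. Proof. exact: sqrtr_ge0. Qed.

Lemma areaJ_sqr J : areaJ J ^+ 2 = frob2 (crossJ J).
Proof. by rewrite sqr_sqrtr det_gram// frob2_ge0. Qed.

Lemma areaJ_le J : areaJ J <= nrm1 (crossJ J).
Proof.
rewrite -(ler_pXn2r (n := 2))// ?nnegrE ?areaJ_ge0 ?nrm1_ge0//.
by rewrite areaJ_sqr frob2_le_nrm1.
Qed.

Lemma cross_le_area J l : `|crossJ J 0 l| <= areaJ J.
Proof.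
rewrite -(ler_pXn2r (n := 2))// ?nnegrE ?areaJ_ge0//.
rewrite areaJ_sqr real_normK ?num_real// /frob2 big_ord1 (bigD1 l)//= lerDl.
by apply: sumr_ge0 => ? _; exact: sqr_ge0.
Qed.

(** The area element is the Euclidean length of the cross product, to which the
    triangle inequality applies. *)
Lemma areaJ_dist J J' : `|areaJ J - areaJ J'| <= nrm1 (crossJ J - crossJ J').
Proof.
have [A0 A'0] := (areaJ_ge0 J, areaJ_ge0 J').
have [AA'0|AA'0] := leP (areaJ J + areaJ J') 0.
  have -> : areaJ J - areaJ J' = 0 by lra.
  by rewrite normr0 nrm1_ge0.
rewrite -(ler_pM2r AA'0) -[X in _ * X <= _](gtr0_norm AA'0) -normrM.
have -> : (areaJ J - areaJ J') * (areaJ J + areaJ J') = dot (crossJ J - crossJ J') (crossJ J + crossJ J').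
  rewrite -subr_sqr !areaJ_sqr -!dot_frob2 /dot -sumrB; apply: eq_bigr => l _.
  by rewrite !mxE; ring.
apply: le_trans (ler_norm_sum _ _ _) _; rewrite /nrm1 big_ord1 mulr_suml.
apply: ler_sum => l _; rewrite normrM ler_wpM2l// mxE.
by apply: le_trans (ler_normD _ _) _; rewrite lerD// cross_le_area.
Qed.

Lemma ler_mul_dist (a b a' b' B e : R) : `|a| <= B -> `|b'| <= B ->
  `|a - a'| <= e -> `|b - b'| <= e -> `|a * b - a' * b'| <= 2 * B * e.
Proof.
move=> aB bB ae be; have -> : a * b - a' * b' = a * (b - b') + (a - a') * b' by ring.
apply: le_trans (ler_normD _ _) _; rewrite !normrM.
have -> : 2 * B * e = B * e + e * B by ring.
by apply: lerD; apply: ler_pM.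
Qed.

Lemma nrm1_row3 (u : 'rV[R]_3) : nrm1 u = `|u 0 0| + `|u 0 1| + `|u 0 2|.
Proof. by rewrite /nrm1 big_ord1 sum_ord3. Qed.

Lemma crossJ_le J B : nrm1 J <= B -> nrm1 (crossJ J) <= 6 * B ^+ 2.
Proof.
move=> JB; have H r l : `|J r l| <= B by exact: le_trans (entry_le_nrm1 _ _ _) JB.
have H2 (a b c d : R) : `|a| <= B -> `|b| <= B -> `|c| <= B -> `|d| <= B -> `|a * b - c * d| <= 2 * B ^+ 2.
  move=> aB bB cB dB; apply: le_trans (ler_normB _ _) _; rewrite !normrM.
  by rewrite mulr_natl mulr2n expr2; apply: lerD; apply: ler_pM.
rewrite nrm1_row3 !crossJE; have -> : 6 * B ^+ 2 = 2 * B ^+ 2 + 2 * B ^+ 2 + 2 * B ^+ 2 by ring.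
by rewrite !lerD// H2.
Qed.

Lemma crossJ_dist J J' B : nrm1 J <= B -> nrm1 J' <= B ->
  nrm1 (crossJ J - crossJ J') <= 12 * B * nrm1 (J - J').
Proof.
move=> JB J'B; set e := nrm1 (J - J').
have H r l : `|J r l| <= B by exact: le_trans (entry_le_nrm1 _ _ _) JB.
have H' r l : `|J' r l| <= B by exact: le_trans (entry_le_nrm1 _ _ _) J'B.
have D r l : `|J r l - J' r l| <= e by exact: entry_dist.
have K r s l m : `|J r l * J s m - J' r l * J' s m| <= 2 * B * e by exact: ler_mul_dist.
have K2 r s l m r' s' l' m' : `|J r l * J s m - J r' l' * J s' m' - (J' r l * J' s m - J' r' l' * J' s' m')| <= 4 * B * e.
  have -> : 4 * B * e = 2 * B * e + 2 * B * e by ring.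
  have -> : J r l * J s m - J r' l' * J s' m' - (J' r l * J' s m - J' r' l' * J' s' m') =
     (J r l * J s m - J' r l * J' s m) - (J r' l' * J s' m' - J' r' l' * J' s' m') by ring.
  by apply: le_trans (ler_normB _ _) _; rewrite lerD.
rewrite nrm1_row3; have mB (l : 'I_3) : (crossJ J - crossJ J') 0 l = crossJ J 0 l - crossJ J' 0 l by rewrite !mxE.
have -> : 12 * B * e = 4 * B * e + 4 * B * e + 4 * B * e by ring.
by rewrite !mB !crossJE; rewrite !lerD.
Qed.

(** The form [tr (P^T adj(J J^T) Q)]: divided by the area element it is the
    product of tangential gradients times the area element, since the inverse of
    [J J^T] is its adjugate over the square of the area element. *)
Definition adj_form J P Q : R :=
  \sum_l ((J *m J^T) 1 1 * (P 0 l * Q 0 l)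
          - (J *m J^T) 0 1 * (P 0 l * Q 1 l + P 1 l * Q 0 l)
          + (J *m J^T) 0 0 * (P 1 l * Q 1 l)).

Lemma adj_formDl J P P' Q : adj_form J (P + P') Q = adj_form J P Q + adj_form J P' Q.
Proof.
have E r m : (P + P') r m = P r m + P' r m by rewrite mxE.
by rewrite -big_split; apply: eq_bigr => l _; rewrite !E /=; ring.
Qed.

Lemma sum_prod_le P Q :
  \sum_l (`|P 0 l| + `|P 1 l|) * (`|Q 0 l| + `|Q 1 l|) <= nrm1 P * nrm1 Q.
Proof.
have E (A : 'M[R]_(2, 3)) : nrm1 A = \sum_l (`|A 0 l| + `|A 1 l|).
  by rewrite /nrm1 sum_ord2 big_split.
rewrite [X in _ <= X * _]E mulr_suml; apply: ler_sum => l _.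
rewrite ler_wpM2l ?addr_ge0// E (bigD1 l)//= lerDl.
by apply: sumr_ge0 => i _; exact: addr_ge0.
Qed.

Lemma gram_le J B r s : nrm1 J <= B -> `|(J *m J^T) r s| <= 3 * B ^+ 2.
Proof.
move=> JB; have H i l : `|J i l| <= B by exact: le_trans (entry_le_nrm1 _ _ _) JB.
have K i j l : `|J i l * J j l| <= B ^+ 2 by rewrite normrM expr2 ler_pM.
rewrite gramE; have -> : 3 * B ^+ 2 = B ^+ 2 + B ^+ 2 + B ^+ 2 by ring.
do 2 (apply: le_trans (ler_normD _ _) _; apply: lerD => //).
Qed.

Lemma gram_dist J J' B r s : nrm1 J <= B -> nrm1 J' <= B ->
  `|(J *m J^T) r s - (J' *m J'^T) r s| <= 6 * B * nrm1 (J - J').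
Proof.
move=> JB J'B; set e := nrm1 (J - J').
have H i l : `|J i l| <= B by exact: le_trans (entry_le_nrm1 _ _ _) JB.
have H' i l : `|J' i l| <= B by exact: le_trans (entry_le_nrm1 _ _ _) J'B.
have D i l : `|J i l - J' i l| <= e by exact: entry_dist.
have K i j l : `|J i l * J j l - J' i l * J' j l| <= 2 * B * e by exact: ler_mul_dist.
rewrite !gramE; have -> : 6 * B * e = 2 * B * e + 2 * B * e + 2 * B * e by ring.
have -> : J r 0 * J s 0 + J r 1 * J s 1 + J r 2 * J s 2 -
  (J' r 0 * J' s 0 + J' r 1 * J' s 1 + J' r 2 * J' s 2) =
  (J r 0 * J s 0 - J' r 0 * J' s 0) + (J r 1 * J s 1 - J' r 1 * J' s 1)
   + (J r 2 * J s 2 - J' r 2 * J' s 2) by ring.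
do 2 (apply: le_trans (ler_normD _ _) _; apply: lerD => //).
Qed.

Let quad_le (a b c e p0 p1 q0 q1 : R) : `|a| <= e -> `|b| <= e -> `|c| <= e ->
  `|a * (p0 * q0) - b * (p0 * q1 + p1 * q0) + c * (p1 * q1)|
  <= e * ((`|p0| + `|p1|) * (`|q0| + `|q1|)).
Proof.
move=> ae be ce.
have e0 : 0 <= e by exact: le_trans ae.
have -> : e * ((`|p0| + `|p1|) * (`|q0| + `|q1|)) = e * (`|p0| * `|q0|)
   + e * (`|p0| * `|q1| + `|p1| * `|q0|) + e * (`|p1| * `|q1|) by ring.
apply: le_trans (ler_normD _ _) _; apply: lerD; last by rewrite !normrM ler_wpM2r// mulr_ge0.
apply: le_trans (ler_normB _ _) _; apply: lerD; first by rewrite !normrM ler_wpM2r// mulr_ge0.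
rewrite normrM; apply: ler_pM => //; apply: le_trans (ler_normD _ _) _.
by rewrite !normrM.
Qed.

Lemma adj_form_le J P Q B : nrm1 J <= B ->
  `|adj_form J P Q| <= 3 * B ^+ 2 * (nrm1 P * nrm1 Q).
Proof.
move=> JB; apply: le_trans (ler_norm_sum _ _ _) _.
apply: (@le_trans _ _ (3 * B ^+ 2 * \sum_l (`|P 0 l| + `|P 1 l|) * (`|Q 0 l| + `|Q 1 l|))).
  by rewrite mulr_sumr; apply: ler_sum => l _; apply: quad_le; exact: gram_le.
by rewrite ler_wpM2l ?sum_prod_le// mulr_ge0// sqr_ge0.
Qed.

Lemma adj_form_dist J J' P Q B : nrm1 J <= B -> nrm1 J' <= B ->
  `|adj_form J P Q - adj_form J' P Q| <= 6 * B * nrm1 (J - J') * (nrm1 P * nrm1 Q).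
Proof.
move=> JB J'B; rewrite /adj_form -sumrB; apply: le_trans (ler_norm_sum _ _ _) _.
apply: (@le_trans _ _ (6 * B * nrm1 (J - J') * \sum_l (`|P 0 l| + `|P 1 l|) * (`|Q 0 l| + `|Q 1 l|))).
  rewrite mulr_sumr; apply: ler_sum => l _.
  have D r s := gram_dist r s JB J'B.
  apply: le_trans (quad_le (P 0 l) (P 1 l) (Q 0 l) (Q 1 l) (D 1 1) (D 0 1) (D 0 0)).
  by rewrite le_eqVlt; apply/orP; left; apply/eqP; congr (`| _ |); ring.
rewrite ler_wpM2l ?sum_prod_le// !mulr_ge0// ?nrm1_ge0//.
exact: le_trans (nrm1_ge0 _) JB.
Qed.

(** The eigenvalues of [J J^T] are at least [m], stated without spectral
    theory. *)
Definition immersive m J := forall w : 'rV[R]_2, m * frob2 w <= frob2 (w *m J).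

Lemma frob2_row2 (w : 'rV[R]_2) : frob2 w = w 0 0 ^+ 2 + w 0 1 ^+ 2.
Proof. by rewrite /frob2 big_ord1 sum_ord2. Qed.

Let immersiveE m J a b : immersive m J ->
  m * (a ^+ 2 + b ^+ 2) <= \sum_l (a * J 0 l + b * J 1 l) ^+ 2.
Proof.
move=> /(_ (\row_i (if i == 0 then a else b))); rewrite frob2_row2 !mxE/=.
rewrite /frob2 big_ord1; under [X in _ <= X]eq_bigr do rewrite mxE sum_ord2 !mxE/=.
by [].
Qed.

(** The determinant of [J J^T] is the product of two eigenvalues that are at
    least [m].  The proof tests with [(- q, p)], where [(p, q)] is the first row
    of [J J^T]. *)
Lemma area_ge m J : 0 < m -> immersive m J -> m <= areaJ J.
Proof.
move=> m0 iJ; rewrite -(ler_pXn2r (n := 2))// ?nnegrE ?areaJ_ge0 ?(ltW m0)//.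
rewrite areaJ_sqr -det_gram det2E.
set p := (J *m J^T) 0 0; set r := (J *m J^T) 1 1; set q := (J *m J^T) 0 1.
have -> : (J *m J^T) 1 0 = q by rewrite /q !gramE; ring.
have E a b : m * (a ^+ 2 + b ^+ 2) <= a ^+ 2 * p + 2 * a * b * q + b ^+ 2 * r.
  have := immersiveE a b iJ; congr (_ <= _).
  by rewrite /p /q /r !gramE sum_ord3; ring.
have p0 : m <= p by have := E 1 0; rewrite expr0n expr1n/=; lra.
have r0 : m <= r by have := E 0 1; rewrite expr0n expr1n/=; lra.
have Eqp := E (- q) p.
have pp : 0 < p by lra.
rewrite -(ler_pM2l pp).
have h1 : 0 <= m * q ^+ 2 by rewrite mulr_ge0 ?sqr_ge0 ?(ltW m0).
have h2 : 0 <= m * p * (p - m) by rewrite !mulr_ge0 ?subr_ge0 ?(ltW m0) ?(ltW pp).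
by apply: le_trans (_ : m * (q ^+ 2 + p ^+ 2) <= _); [lra|apply: le_trans (_ : q ^+ 2 * p - 2 * q * p * q + p ^+ 2 * r <= _); lra].
Qed.

(** A 2 x 2 matrix and its adjugate have the same eigenvalues; on vectors, the
    adjugate of the Gram matrix is the Gram matrix after a quarter turn. *)
Lemma adj_form_ge m J P : immersive m J -> m * frob2 P <= adj_form J P P.
Proof.
move=> iJ; rewrite /frob2 sum_ord2 -big_split/= mulr_sumr; apply: ler_sum => l _.
have := immersiveE (P 1 l) (- (P 0 l)) iJ; rewrite sqrrN addrC.
by congr (_ <= _); rewrite !gramE sum_ord3; ring.
Qed.

End AreaElement.

(** * The matrices of the method as quadratic forms *)

Section Forms.
Context {R : realType} (k : nat) (tr : triangulation R k).
Implicit Types (x y w z : nodal tr) (e : 'I_(nb_elts tr)) (xi : (R * R)%type).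
Local Notation T := (@ref_triangle R).

Lemma cvg_dist_le (U : Type) (F : set_system U) (FF : Filter F) (f b : U -> R) (l : R) :
  (\forall u \near F, `|l - f u| <= b u) -> b @ F --> 0 -> f @ F --> l.
Proof.
move=> fb b0; apply/cvgrPdist_le => eps eps0.
move/cvgrPdist_le : b0 => /(_ _ eps0) b0; near=> u.
have bu : `|l - f u| <= b u by near: u.
apply: le_trans bu _; have : `|0 - b u| <= eps by near: u.
by rewrite sub0r normrN; exact/le_trans/ler_norm.
Unshelve. all: end_near. Qed.

Lemma continuous_cross x e l : continuous (fun xi => crossJ (jac x e xi) 0 l).
Proof.
have H (r s : 'I_2) (i j m n : 'I_3) : continuous (fun xi =>
    jac x e xi r i * jac x e xi s j - jac x e xi r m * jac x e xi s n).
  by move=> xi; apply: cvgB; apply: cvgM; exact: continuous_jac.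
have : l \in [:: 0; 1; 2] by case: l => -[|[|[|//]]] h; rewrite !inE.
rewrite !inE => /or3P[] /eqP ->; under eq_fun do rewrite crossJE; exact: H.
Qed.

Lemma continuous_area x e : continuous (fun xi => areaJ (jac x e xi)).
Proof.
have -> : (fun xi => areaJ (jac x e xi)) =
    Num.sqrt \o (fun xi => \sum_l crossJ (jac x e xi) 0 l * crossJ (jac x e xi) 0 l).
  by apply/funext => xi; rewrite /areaJ/= det_gram -dot_frob2.
move=> xi; apply: continuous_comp; last exact: sqrt_continuous.
by apply: continuous_sumr => l _ z; apply: cvgM; exact: continuous_cross.
Qed.

Lemma continuous_gram x e r s : continuous (fun xi => (jac x e xi *m (jac x e xi)^T) r s).
Proof.
have -> : (fun xi => (jac x e xi *m (jac x e xi)^T) r s) =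
    (fun xi => \sum_l jac x e xi r l * jac x e xi s l).
  by apply/funext => xi; rewrite mxE; apply: eq_bigr => l _; rewrite [_^T _ _]mxE.
by apply: continuous_sumr => l _ xi; apply: cvgM; exact: continuous_jac.
Qed.

Lemma discrete_normal_area x e xi : 0 < areaJ (jac x e xi) ->
  area_elt x e xi *: discrete_normal x e xi = crossJ (jac x e xi).
Proof.
move=> a0; rewrite /discrete_normal.
have -> : enorm (elt_cross x e xi) = areaJ (jac x e xi).
  by rewrite /enorm dot_frob2 /areaJ det_gram.
by rewrite scalerA -[area_elt _ _ _]/(areaJ (jac x e xi)) divff ?scale1r ?gt_eqF.
Qed.

Lemma adjugate2E (G : 'M[R]_2) : (\adj G 0 0 = G 1 1) * (\adj G 0 1 = - G 0 1) *
  (\adj G 1 0 = - G 1 0) * (\adj G 1 1 = G 0 0).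
Proof.
have l10 : lift (1 : 'I_2) 0 = 0 by apply/val_inj.
have l01 : lift (0 : 'I_2) 0 = 1 by apply/val_inj.
by do !split; rewrite !mxE /cofactor det_mx11 !mxE ?l10 ?l01 /= ?expr0 ?expr1 ?mul1r ?mulN1r// sqrrN expr1n mul1r.
Qed.

Lemma dot_mulmx n (u v : 'rV[R]_n) : dot u v = (u *m v^T) 0 0.
Proof. by rewrite mxE; apply: eq_bigr => i _; rewrite mxE. Qed.

(** The inverse of the Gram matrix contributes the inverse square of the area
    element, of which one factor cancels. *)
Lemma dot_discrete_tgrad x e f g xi : 0 < areaJ (jac x e xi) ->
  let G := jac x e xi *m (jac x e xi)^T in
  let p := ref_grad f xi in let q := ref_grad g xi in
  dot (discrete_tgrad x e f xi) (discrete_tgrad x e g xi) * area_elt x e xi =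
  (G 1 1 * (p 0 * q 0) - G 0 1 * (p 0 * q 1 + p 1 * q 0) + G 0 0 * (p 1 * q 1)) / areaJ (jac x e xi).
Proof.
move=> a0 G p q; have detG : \det G = areaJ (jac x e xi) ^+ 2 by rewrite areaJ_sqr det_gram.
have uG : G \in unitmx by rewrite unitmxE detG unitfE expf_neq0 ?gt_eqF.
have sG : G^T = G by rewrite /G trmx_mul trmxK.
rewrite dot_mulmx /discrete_tgrad -/(gram x e xi) -[gram x e xi]/G.
rewrite !trmx_mul trmx_inv sG !mulmxA -(mulmxA _ (jac x e xi)) -/G.
rewrite -(mulmxA _ (invmx G) G) mulVmx// mulmx1 /invmx uG -scalemxAr -scalemxAl.
rewrite mxE detG -[area_elt _ _ _]/(areaJ (jac x e xi)).
set A := areaJ _ in a0 *.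
have G10 : G 1 0 = G 0 1 by rewrite -[in LHS]sG mxE.
clearbody G; rewrite mxE sum_ord2 !mxE !sum_ord2 !adjugate2E !mxE -/p -/q.
by rewrite G10; field; rewrite gt_eqF.
Qed.

Lemma trace_form (F : 'I_(nb_nodes tr) -> 'I_(nb_nodes tr) -> 'I_(nb_elts tr) -> (R * R)%type -> R) w z :
  (forall i j e, bddmeas (F i j e)) ->
  \tr (w^T *m (\matrix_(i, j) \sum_e Itri (F i j e)) *m z) =
  \sum_e Itri (fun xi => \sum_l \sum_i \sum_j w i l * z j l * F i j e xi).
Proof.
move=> gF; have gF' c i j e : bddmeas (fun xi => c * F i j e xi).
  by apply: bddmeasM => //; exact: bddmeas_cst.
under [RHS]eq_bigr => e _.
  rewrite Itri_sum => [|l _]; last by apply: bddmeas_sum => i _; exact: bddmeas_sum.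
  under eq_bigr => l _.
    rewrite Itri_sum => [|i _]; last exact: bddmeas_sum.
    under eq_bigr => i _.
      rewrite Itri_sum => [|j _]; last exact: gF'.
      under eq_bigr do rewrite ItriZ//.
      over.
    over.
  over.
rewrite [RHS]exchange_big/=; apply: eq_bigr => l _.
rewrite [RHS]exchange_big/= mxE.
under [LHS]eq_bigr => j _ do rewrite mxE mulr_suml.
rewrite exchange_big/=; apply: eq_bigr => i _.
rewrite exchange_big/=; apply: eq_bigr => j _.
by rewrite !mxE -mulr_sumr; ring.
Qed.

End Forms.

Section MatrixForms.
Context {R : realType} (k : nat) (tr : triangulation R k).
Implicit Types (x y w z : nodal tr) (e : 'I_(nb_elts tr)) (xi : (R * R)%type).
Local Notation T := (@ref_triangle R).

Lemma bddmeas_elt_map x e l : bddmeas (fun xi => elt_map x e xi 0 l).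
Proof. exact/bddmeas_continuous/continuous_elt_map. Qed.

Lemma bddmeas_jac x e r l : bddmeas (fun xi => jac x e xi r l).
Proof. exact/bddmeas_continuous/continuous_jac. Qed.

Lemma bddmeas_gram x e r s : bddmeas (fun xi => (jac x e xi *m (jac x e xi)^T) r s).
Proof. exact/bddmeas_continuous/continuous_gram. Qed.

Lemma bddmeas_area x e : bddmeas (fun xi => areaJ (jac x e xi)).
Proof. exact/bddmeas_continuous/continuous_area. Qed.

Lemma bddmeas_basis j e : bddmeas (basis_fun j e : _ -> R).
Proof.
by apply: bddmeas_sum => a _; exact/bddmeas_continuous/planar_continuous/planar_lagrange.
Qed.

Lemma bddmeas_ref_grad_basis j e r : bddmeas (fun xi => ref_grad (basis_fun j e) xi r : R).
Proof.
under eq_fun do rewrite ref_grad_basis.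
by apply: bddmeas_sum => a _; exact/bddmeas_continuous/continuous_ref_grad.
Qed.

Lemma bddmeas_dot_elt_map w z e : bddmeas (fun xi => dot (elt_map w e xi) (elt_map z e xi)).
Proof. by apply: bddmeas_sum => l _; apply: bddmeasM; exact: bddmeas_elt_map. Qed.

Lemma bddmeas_dot_cross x w e : bddmeas (fun xi => dot (crossJ (jac x e xi)) (elt_map w e xi)).
Proof.
apply: bddmeas_sum => l _; apply: bddmeasM; last exact: bddmeas_elt_map.
exact/bddmeas_continuous/continuous_cross.
Qed.

Lemma bddmeas_frob2_jac w e : bddmeas (fun xi => frob2 (jac w e xi)).
Proof.
by apply: bddmeas_sum => r _; apply: bddmeas_sum => l _; under eq_fun do rewrite expr2;
   apply: bddmeasM; exact: bddmeas_jac.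
Qed.

Lemma bddmeas_adj_form x w z e : bddmeas (fun xi => adj_form (jac x e xi) (jac w e xi) (jac z e xi)).
Proof.
apply: bddmeas_sum => l _; apply: bddmeasD; [apply: bddmeasB|];
  (apply: bddmeasM; first exact: bddmeas_gram); [|apply: bddmeasD|];
  by apply: bddmeasM; exact: bddmeas_jac.
Qed.

(** A lower bound for the area element, without which the integrands of the
    stiffness matrix need not be bounded. *)
Definition nondegenerate_mesh (a : 'I_(nb_elts tr) -> R) x :=
  forall e xi, T xi -> a e <= areaJ (jac x e xi).

Lemma bddmeas_area_inv a x e : (forall e, 0 < a e) -> nondegenerate_mesh a x ->
  bddmeas (fun xi => (areaJ (jac x e xi))^-1).
Proof. by move=> a0 ax; apply: bddmeas_inv (a0 e) _ (bddmeas_area x e); exact: ax. Qed.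

Let sum_distr (n : nat) (a b p q : 'I_n -> R) :
  \sum_i \sum_j a i * b j * (p i * q j) = (\sum_i a i * p i) * (\sum_j b j * q j).
Proof.
by rewrite big_distrlr/=; apply: eq_bigr => i _; apply: eq_bigr => j _; ring.
Qed.

Lemma mass_form x w z : \tr (w^T *m mass x *m z) =
  \sum_e Itri (fun xi => areaJ (jac x e xi) * dot (elt_map w e xi) (elt_map z e xi)).
Proof.
rewrite (trace_form (F := fun i j e xi => basis_fun i e xi * basis_fun j e xi * areaJ (jac x e xi))); last first.
  by move=> i j e; apply: bddmeasM (bddmeas_area x e); apply: bddmeasM; exact: bddmeas_basis.
apply: eq_bigr => e _; congr Itri; apply/funext => xi.
rewrite /dot mulr_sumr; apply: eq_bigr => l _.
rewrite -!sum_basis -sum_distr mulr_sumr; apply: eq_bigr => i _.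
by rewrite mulr_sumr; apply: eq_bigr => j _; ring.
Qed.

Lemma stiff_form a x w z : (forall e, 0 < a e) -> nondegenerate_mesh a x ->
  \tr (w^T *m stiffness x *m z) =
  \sum_e Itri (fun xi => adj_form (jac x e xi) (jac w e xi) (jac z e xi) / areaJ (jac x e xi)).
Proof.
move=> a0 ax.
pose G e xi := jac x e xi *m (jac x e xi)^T.
pose p i e xi r : R := ref_grad (basis_fun i e) xi r.
pose F i j e xi := (G e xi 1 1 * (p i e xi 0 * p j e xi 0)
  - G e xi 0 1 * (p i e xi 0 * p j e xi 1 + p i e xi 1 * p j e xi 0)
  + G e xi 0 0 * (p i e xi 1 * p j e xi 1)) / areaJ (jac x e xi).
have gF i j e : bddmeas (F i j e).
  apply: bddmeasM; last exact: bddmeas_area_inv a0 ax.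
  apply: bddmeasD; [apply: bddmeasB|];
    (apply: bddmeasM; first exact: bddmeas_gram); [|apply: bddmeasD|];
    by apply: bddmeasM; exact: bddmeas_ref_grad_basis.
have -> : stiffness x = \matrix_(i, j) \sum_e Itri (F i j e).
  apply/matrixP => i j; rewrite !mxE; apply: eq_bigr => e _.
  apply: eq_Itri => xi Txi; rewrite dot_discrete_tgrad//.
  exact: lt_le_trans (a0 e) (ax _ _ Txi).
rewrite (trace_form _ _ gF); apply: eq_bigr => e _; congr Itri; apply/funext => xi.
rewrite /adj_form mulr_suml; apply: eq_bigr => l _.
have E r s : jac w e xi r l * jac z e xi s l =
    \sum_i \sum_j w i l * z j l * (p i e xi r * p j e xi s).
  by rewrite sum_distr; congr (_ * _); rewrite sum_ref_grad_basis.
rewrite !E.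
set A := areaJ _; rewrite -/(G e xi).
rewrite -big_split/= !mulr_sumr -sumrB -big_split/= mulr_suml; apply: eq_bigr => i _.
rewrite -big_split/= !mulr_sumr -sumrB -big_split/= mulr_suml; apply: eq_bigr => j _.
by rewrite /F -/A; move: (p i e xi) (p j e xi) (G e xi) A^-1 => pi pj g a'; ring.
Qed.

(** Normal times area element is the cross product of the partial derivatives,
    so the area element drops out of the load vector. *)
Lemma load_form a g x t w : (forall e, 0 < a e) -> nondegenerate_mesh a x ->
  (forall e, bddmeas (fun xi => g (elt_map x e xi, t))) ->
  \tr (w^T *m load g x t) =
  \sum_e Itri (fun xi => g (elt_map x e xi, t) * dot (crossJ (jac x e xi)) (elt_map w e xi)).
Proof.
move=> a0 ax gg.
have gF j l e : bddmeas (fun xi => g (elt_map x e xi, t) * crossJ (jac x e xi) 0 l * basis_fun j e xi).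
  apply: bddmeasM (bddmeas_basis j e); apply: bddmeasM => //.
  exact/bddmeas_continuous/continuous_cross.
have -> : load g x t = \matrix_(j, l) \sum_e
   Itri (fun xi => g (elt_map x e xi, t) * crossJ (jac x e xi) 0 l * basis_fun j e xi).
  apply/matrixP => j l; rewrite !mxE; apply: eq_bigr => e _.
  apply: eq_Itri => xi Txi; rewrite -discrete_normal_area ?mxE; last exact: lt_le_trans (a0 e) (ax _ _ Txi).
  by rewrite mulrAC; congr (_ * _); rewrite mulrAC -mulrA.
under [RHS]eq_bigr => e _.
  under eq_fun => xi.
    rewrite /dot mulr_sumr; under eq_bigr => l _.
      rewrite -sum_basis mulrA mulr_sumr; under eq_bigr => j _ do rewrite mulrCA.
      over.
    over.
  rewrite Itri_sum => [|l _]; last first.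
    by apply: bddmeas_sum => j _; apply: bddmeasM => //; exact: bddmeas_cst.
  under eq_bigr => l _.
    rewrite Itri_sum => [|j _]; last by apply: bddmeasM => //; exact: bddmeas_cst.
    under eq_bigr => j _ do rewrite ItriZ//.
    over.
  over.
rewrite [RHS]exchange_big/=; apply: eq_bigr => l _; rewrite mxE [RHS]exchange_big/=.
by apply: eq_bigr => j _; rewrite !mxE mulr_sumr.
Qed.

Definition energy_dens (h : 'I_(nb_elts tr) -> R) w e xi :=
  h e ^+ 2 * frob2 (elt_map w e xi) + frob2 (jac w e xi).

(** Up to constants the square of the H^1 norm on a surface with elements of
    size [h e], but with the geometry of the reference triangle: it stays the
    same when the nodes move. *)
Definition energy h w := \sum_e Itri (energy_dens h w e).

Lemma bddmeas_energy_dens h w e : bddmeas (energy_dens h w e).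
Proof.
apply: bddmeasD; last exact: bddmeas_frob2_jac.
apply: bddmeasM; first exact: bddmeas_cst.
by under eq_fun do rewrite -dot_frob2; exact: bddmeas_dot_elt_map.
Qed.

Lemma energy_ge0 h w : 0 <= energy h w.
Proof.
apply: sumr_ge0 => e _; apply: Itri_ge0 => xi _.
by apply: addr_ge0; [apply: mulr_ge0; [exact: sqr_ge0|]|]; exact: frob2_ge0.
Qed.

Definition energy_mx (h : 'I_(nb_elts tr) -> R) : 'M[R]_(nb_nodes tr) :=
  \matrix_(i, j) \sum_e Itri (fun xi => h e ^+ 2 * (basis_fun i e xi * basis_fun j e xi)
    + \sum_r ref_grad (basis_fun i e) xi r * ref_grad (basis_fun j e) xi r).

Lemma energy_mx_sym h : (energy_mx h)^T = energy_mx h.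
Proof.
apply/matrixP => i j; rewrite !mxE; apply: eq_bigr => e _; congr Itri.
apply/funext => xi; rewrite [X in _ * X]mulrC; congr (_ + _).
by apply: eq_bigr => r _; rewrite mulrC.
Qed.

Lemma energyE h w : energy h w = \tr (w^T *m energy_mx h *m w).
Proof.
rewrite trace_form => [|i j e]; last first.
  apply: bddmeasD.
    apply: bddmeasM; first exact: bddmeas_cst.
    by apply: bddmeasM; exact: bddmeas_basis.
  by apply: bddmeas_sum => r _; apply: bddmeasM; exact: bddmeas_ref_grad_basis.
apply: eq_bigr => e _; congr Itri; apply/funext => xi.
rewrite /energy_dens /frob2 big_ord1 exchange_big/= mulr_sumr -big_split/=; apply: eq_bigr => l _.
have E r : jac w e xi r l * jac w e xi r l =
    \sum_i \sum_j w i l * w j l * (ref_grad (basis_fun i e) xi r * ref_grad (basis_fun j e) xi r).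
  by rewrite sum_distr; congr (_ * _); rewrite sum_ref_grad_basis.
have E0 : elt_map w e xi 0 l * elt_map w e xi 0 l =
    \sum_i \sum_j w i l * w j l * (basis_fun i e xi * basis_fun j e xi).
  by rewrite sum_distr; congr (_ * _); rewrite sum_basis.
rewrite sum_ord2 !(expr2 (jac _ _ _ _ _)) (expr2 (elt_map _ _ _ _ _)) E0 !E.
rewrite -big_split/= mulr_sumr -big_split/=; apply: eq_bigr => i _.
rewrite -big_split/= mulr_sumr -big_split/=; apply: eq_bigr => j _.
rewrite sum_ord2; move: (ref_grad (basis_fun i e) xi) (ref_grad (basis_fun j e) xi) => pi pj.
by ring.
Qed.

End MatrixForms.

(** * Perturbation of the Jacobian *)

Section PointwisePerturbation.
Context {R : realType}.
Implicit Types (J P Q : 'M[R]_(2, 3)) (u v : 'rV[R]_3).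

Lemma dotBl n (u u' v : 'rV[R]_n) : dot (u - u') v = dot u v - dot u' v.
Proof. by rewrite /dot -sumrB; apply: eq_bigr => i _; rewrite !mxE mulrBl. Qed.

(** The product of the tangential gradients of two functions with pulled-back
    gradients [P] and [Q], times the area element. *)
Definition stiffJ J P Q : R := adj_form J P Q / areaJ J.

Lemma stiffJDl J P P' Q : stiffJ J (P + P') Q = stiffJ J P Q + stiffJ J P' Q.
Proof. by rewrite /stiffJ adj_formDl mulrDl. Qed.

Lemma area_dist J J' B : nrm1 J <= B -> nrm1 J' <= B ->
  `|areaJ J - areaJ J'| <= 12 * B * nrm1 (J - J').
Proof. by move=> JB J'B; apply: le_trans (areaJ_dist _ _) _; exact: crossJ_dist. Qed.

Lemma stiffJ_le J P Q B a : nrm1 J <= B -> 0 < a -> a <= areaJ J ->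
  `|stiffJ J P Q| <= 3 * B ^+ 2 / a * (nrm1 P * nrm1 Q).
Proof.
move=> JB a0 aJ; have A0 : 0 < areaJ J by exact: lt_le_trans aJ.
rewrite /stiffJ normrM normfV (gtr0_norm A0) mulrAC.
apply: ler_pM => //; first by rewrite invr_ge0 ltW.
- exact: adj_form_le.
- by rewrite lef_pV2 ?posrE.
Qed.

(** Quotient rule: the numerator is quadratic in the Jacobian and the
    denominator is bounded below by [a]. *)
Lemma stiffJ_dist J J' P Q B a : nrm1 J <= B -> nrm1 J' <= B ->
  0 < a -> a <= areaJ J -> a <= areaJ J' ->
  `|stiffJ J P Q - stiffJ J' P Q| <=
    (6 * B / a + 36 * B ^+ 3 / a ^+ 2) * nrm1 (J - J') * (nrm1 P * nrm1 Q).
Proof.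
move=> JB J'B a0 aJ aJ'.
have A0 : 0 < areaJ J by exact: lt_le_trans aJ.
have A'0 : 0 < areaJ J' by exact: lt_le_trans aJ'.
have B0 : 0 <= B by exact: le_trans (nrm1_ge0 J) JB.
set e := nrm1 (J - J'); set pq := nrm1 P * nrm1 Q.
have e0 : 0 <= e by exact: nrm1_ge0.
have pq0 : 0 <= pq by rewrite mulr_ge0 ?nrm1_ge0.
have -> : stiffJ J P Q - stiffJ J' P Q = (adj_form J P Q - adj_form J' P Q) / areaJ J
    + adj_form J' P Q * (areaJ J' - areaJ J) / (areaJ J * areaJ J').
  by rewrite /stiffJ; field; rewrite !gt_eqF.
have -> : (6 * B / a + 36 * B ^+ 3 / a ^+ 2) * e * pq =
    (6 * B * e * pq) / a + (3 * B ^+ 2 * pq * (12 * B * e)) / (a * a).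
  by field; rewrite gt_eqF.
apply: le_trans (ler_normD _ _) _; apply: lerD.
  rewrite normrM normfV (gtr0_norm A0); apply: ler_pM => //.
  - by rewrite invr_ge0 ltW.
  - exact: adj_form_dist.
  - by rewrite lef_pV2 ?posrE.
rewrite !normrM normfV (gtr0_norm (mulr_gt0 A0 A'0)); apply: ler_pM => //.
- by rewrite invr_ge0 mulr_ge0 ?(ltW A0) ?(ltW A'0).
- apply: ler_pM => //; first exact: adj_form_le.
  by rewrite distrC; exact: area_dist.
- by rewrite lef_pV2 ?posrE ?mulr_gt0// ler_pM ?(ltW a0).
Qed.

(** With Jacobians of size [h] every coefficient scales so that the powers of
    [h] cancel.  The terms bilinear in the position error and in [ev] are of
    first order; the terms with [vs + ev] also have parts quadratic in [ev], and
    there the smallness [delta] of the Jacobian perturbation is kept. *)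
Lemma residual_density_le (C c L alpha beta : R) :
  0 < C -> 0 < c -> 0 <= L -> 0 <= alpha -> 0 <= beta ->
  exists2 K : R, 0 < K & forall (h delta : R) J J' Vs Ev (vs ev ex : 'rV[R]_3) (ga ga' : R),
    0 < h ->
    nrm1 J <= C * h -> nrm1 J' <= C * h ->
    c * h ^+ 2 <= areaJ J -> c * h ^+ 2 <= areaJ J' ->
    nrm1 (J - J') <= delta * h ->
    nrm1 Vs <= C * h -> nrm1 vs <= C -> `|ga'| <= C -> `|ga - ga'| <= L * nrm1 ex ->
    (areaJ J' - areaJ J) * dot (vs + ev) ev
    + alpha * (stiffJ J' (Vs + Ev) Ev - stiffJ J (Vs + Ev) Ev)
    + (ga * dot (crossJ J) ev - ga' * dot (crossJ J') ev)
    + beta * (stiffJ J' J' Ev - stiffJ J J Ev)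
    <= K * ((nrm1 (J - J') + h * nrm1 ex) * (h * nrm1 ev + nrm1 Ev))
       + K * delta * ((h * nrm1 ev) ^+ 2 + nrm1 Ev ^+ 2).
Proof.
move=> C0 c0 L0 al0 be0.
pose K1 := 6 * C / c + 36 * C ^+ 3 / c ^+ 2.
have K10 : 0 <= K1 by rewrite addr_ge0 ?divr_ge0 ?mulr_ge0 ?exprn_ge0 ?(ltW C0) ?(ltW c0).
pose k1 := 12 * C ^+ 2 + 12 * C.
pose k2 := alpha * (K1 * C + K1).
pose k3 := 6 * L * C ^+ 2 + 12 * C ^+ 2.
pose k4 := beta * (K1 * C + 3 * C ^+ 2 / c).
have C20 : 0 < C ^+ 2 by rewrite exprn_gt0.
have k10 : 0 < k1 by rewrite addr_gt0// mulr_gt0.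
have k20 : 0 <= k2 by rewrite mulr_ge0// addr_ge0// mulr_ge0// ltW.
have k30 : 0 <= k3 by rewrite addr_ge0// !mulr_ge0// ltW.
have k40 : 0 <= k4 by rewrite mulr_ge0// addr_ge0// ?divr_ge0 ?mulr_ge0// ltW.
exists (k1 + k2 + k3 + k4); first lra.
move=> h delta J J' Vs Ev vs ev ex ga ga' h0 JC J'C cJ cJ' eps_le Vs_le vs_le ga'_le ga_dist.
set eps := nrm1 (J - J') in eps_le *; set n := nrm1 ev; set y := h * nrm1 ex.
set s := h * n; set t := nrm1 Ev.
have eps0 : 0 <= eps by exact: nrm1_ge0.
have n0 : 0 <= n by exact: nrm1_ge0.
have t0 : 0 <= t by exact: nrm1_ge0.
have y0 : 0 <= y by rewrite mulr_ge0 ?nrm1_ge0// ltW.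
have s0 : 0 <= s by rewrite mulr_ge0// ltW.
have d0 : 0 <= delta by rewrite -(pmulr_lge0 _ h0); exact: le_trans eps_le.
have h20 : 0 < c * h ^+ 2 by rewrite mulr_gt0 ?exprn_gt0.
have hN0 : h != 0 by rewrite gt_eqF.
have cN0 : c != 0 by rewrite gt_eqF.
have epsh : eps / h <= delta by rewrite ler_pdivrMr.
pose U := (eps + y) * (s + t); pose W := delta * (s ^+ 2 + t ^+ 2).
have es : eps * s <= U by rewrite /U; nra.
have et : eps * t <= U by rewrite /U; nra.
have ys : y * s <= U by rewrite /U; nra.
have ds : delta * s ^+ 2 <= W by rewrite /W ler_wpM2l// lerDl sqr_ge0.
have dt : delta * t ^+ 2 <= W by rewrite /W ler_wpM2l// lerDr sqr_ge0.
have U0 : 0 <= U by rewrite mulr_ge0// addr_ge0.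
have W0 : 0 <= W by rewrite mulr_ge0// addr_ge0// sqr_ge0.
have SD P Q : `|stiffJ J P Q - stiffJ J' P Q| <= K1 / h * eps * (nrm1 P * nrm1 Q).
  apply: le_trans (stiffJ_dist P Q JC J'C h20 cJ cJ') _.
  rewrite -/eps le_eqVlt; apply/orP; left; apply/eqP; congr (_ * _ * _).
  by rewrite /K1; field; rewrite hN0 cN0.
clearbody K1.
have T1 : (areaJ J' - areaJ J) * dot (vs + ev) ev <= k1 * (U + W).
  apply: le_trans (ler_norm _) _; rewrite normrM distrC.
  apply: (@le_trans _ _ (12 * (C * h) * eps * ((C + n) * n))).
    apply: ler_pM => //; first exact: area_dist.
    apply: le_trans (norm_dot_le _ _) _; rewrite ler_wpM2r//.
    by apply: le_trans (nrm1D _ _) _; rewrite lerD2r.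
  have -> : 12 * (C * h) * eps * ((C + n) * n) = 12 * C ^+ 2 * (eps * s) + 12 * C * (eps / h * s ^+ 2).
    by rewrite /s; field.
  have e1 : eps / h * s ^+ 2 <= W by apply: le_trans ds; rewrite ler_wpM2r ?sqr_ge0.
  have a1 : 12 * C ^+ 2 * (eps * s) <= 12 * C ^+ 2 * (U + W).
    by rewrite ler_wpM2l ?mulr_ge0 ?(ltW C20)//; lra.
  have a2 : 12 * C * (eps / h * s ^+ 2) <= 12 * C * (U + W).
    by rewrite ler_wpM2l ?mulr_ge0 ?(ltW C0)//; lra.
  by rewrite /k1 mulrDl; lra.
have T2 : alpha * (stiffJ J' (Vs + Ev) Ev - stiffJ J (Vs + Ev) Ev) <= k2 * (U + W).
  rewrite /k2 -mulrA ler_wpM2l//.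
  apply: le_trans (ler_norm _) _; rewrite distrC.
  apply: le_trans (SD _ _) _; rewrite -/t.
  apply: (@le_trans _ _ (K1 / h * eps * ((C * h + t) * t))).
    rewrite ler_wpM2l ?mulr_ge0 ?invr_ge0 ?(ltW h0)//; apply: ler_wpM2r => //.
    by apply: le_trans (nrm1D _ _) _; rewrite lerD2r.
  have -> : K1 / h * eps * ((C * h + t) * t) = K1 * C * (eps * t) + K1 * (eps / h * t ^+ 2).
    by field.
  have e1 : eps / h * t ^+ 2 <= W by apply: le_trans dt; rewrite ler_wpM2r ?sqr_ge0.
  rewrite mulrDl; apply: lerD; rewrite ler_wpM2l ?mulr_ge0 ?(ltW C0)//; lra.
have T3 : ga * dot (crossJ J) ev - ga' * dot (crossJ J') ev <= k3 * (U + W).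
  have -> : ga * dot (crossJ J) ev - ga' * dot (crossJ J') ev =
      (ga - ga') * dot (crossJ J) ev + ga' * dot (crossJ J - crossJ J') ev.
    by rewrite dotBl; ring.
  apply: (@le_trans _ _ (L * nrm1 ex * (6 * (C * h) ^+ 2 * n) + C * (12 * (C * h) * eps * n))).
    apply: lerD; apply: le_trans (ler_norm _) _; rewrite normrM; apply: ler_pM => //;
      apply: le_trans (norm_dot_le _ _) _; rewrite ler_wpM2r//.
      exact: crossJ_le.
    exact: crossJ_dist.
  have -> : L * nrm1 ex * (6 * (C * h) ^+ 2 * n) + C * (12 * (C * h) * eps * n) =
     6 * L * C ^+ 2 * (y * s) + 12 * C ^+ 2 * (eps * s) by rewrite /y /s; ring.
  rewrite /k3 [X in _ <= X]mulrDl; apply: lerD; rewrite ler_wpM2l ?mulr_ge0 ?(ltW C20)//; lra.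
have T4 : beta * (stiffJ J' J' Ev - stiffJ J J Ev) <= k4 * (U + W).
  rewrite /k4 -mulrA ler_wpM2l//.
  have -> : stiffJ J' J' Ev - stiffJ J J Ev = (stiffJ J' J Ev - stiffJ J J Ev) - stiffJ J' (J - J') Ev.
    have := stiffJDl J' (J - J') J' Ev; rewrite subrK; lra.
  apply: le_trans (ler_norm _) _; apply: le_trans (ler_normB _ _) _.
  apply: (@le_trans _ _ (K1 / h * eps * (C * h * t) + 3 * (C * h) ^+ 2 / (c * h ^+ 2) * (eps * t))).
    apply: lerD.
      rewrite distrC; apply: le_trans (SD _ _) _.
      rewrite ler_wpM2l ?mulr_ge0 ?invr_ge0 ?(ltW h0)//; exact: ler_wpM2r.
    exact: stiffJ_le.
  have -> : K1 / h * eps * (C * h * t) + 3 * (C * h) ^+ 2 / (c * h ^+ 2) * (eps * t) =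
      K1 * C * (eps * t) + 3 * C ^+ 2 / c * (eps * t) by field; rewrite hN0 cN0.
  rewrite [X in _ <= X]mulrDl; apply: lerD; rewrite ler_wpM2l ?divr_ge0 ?mulr_ge0 ?(ltW C20) ?(ltW C0) ?(ltW c0)//; lra.
have -> : (k1 + k2 + k3 + k4) * U + (k1 + k2 + k3 + k4) * delta * (s ^+ 2 + t ^+ 2)
   = k1 * (U + W) + k2 * (U + W) + k3 * (U + W) + k4 * (U + W) by rewrite /W; ring.
by rewrite !lerD.
Qed.

End PointwisePerturbation.

(** * Stability of the discrete velocity *)

Ltac nonneg := first [ assumption | (apply: ltW; assumption) | lazymatch goal with
  | |- is_true (0 <= _ / _) => apply: divr_ge0; nonneg
  | |- is_true (0 <= _ * _) => apply: mulr_ge0; nonneg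
  | |- is_true (0 <= _ + _) => apply: addr_ge0; nonneg
  | |- is_true (0 <= _ ^+ 2) => exact: sqr_ge0
  | |- is_true (0 <= _ ^+ _) => apply: exprn_ge0; nonneg
  | |- is_true (0 <= _%:R) => exact: ler0n
  end ].

Section StiffSymmetry.
Context {R : realType}.

Lemma dotC n (u v : 'rV[R]_n) : dot u v = dot v u.
Proof. by apply: eq_bigr => i _; rewrite mulrC. Qed.

Lemma stiffJC (J P Q : 'M[R]_(2, 3)) : stiffJ J P Q = stiffJ J Q P.
Proof. by congr (_ / _); apply: eq_bigr => l _; ring. Qed.

Lemma young (th a b : R) : 0 < th -> a * b <= a ^+ 2 / (2 * th) + th / 2 * b ^+ 2.
Proof.
move=> th0; rewrite -subr_ge0.
have -> : a ^+ 2 / (2 * th) + th / 2 * b ^+ 2 - a * b = (a - th * b) ^+ 2 / (2 * th).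
  by field; rewrite gt_eqF.
by rewrite divr_ge0 ?sqr_ge0// mulr_ge0 ?(ltW th0).
Qed.

Lemma dist_half_le (A A' a : R) : `|A - A'| <= a -> a + a <= A' -> 0 < a ->
  a <= A /\ a <= A'.
Proof. by rewrite ler_norml => /andP[? ?] ? ?; split; lra. Qed.

Lemma residual_dens_sym (J J' V E : 'M[R]_(2, 3)) (u w : 'rV[R]_3) (alpha beta ga ga' : R) :
  (areaJ J' - areaJ J) * dot u w + alpha * (stiffJ J' V E - stiffJ J V E)
  + (ga * dot (crossJ J) w - ga' * dot (crossJ J') w)
  + beta * (stiffJ J' J' E - stiffJ J J E) =
  areaJ J' * dot w u + alpha * stiffJ J' E V - (areaJ J * dot w u + alpha * stiffJ J E V)
  + (ga * dot (crossJ J) w - ga' * dot (crossJ J') w)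
  + beta * (stiffJ J' E J' - stiffJ J E J).
Proof. by rewrite (dotC w u) !(stiffJC _ E); ring. Qed.

Lemma stability_algebra (X r U S E P Q B : R) :
  X = S - r -> S <= 2^-1 * E + P -> E <= X -> 0 <= Q -> 0 <= U + r + 4^-1 * X ->
  0 <= B -> 0 <= U -> X <= 4 * P + 4 * Q + 4 * B + 4 * U.
Proof. by move=> *; lra. Qed.

Lemma residual_algebra (X A B L L' S S' r b D : R) :
  X = A - (L + r - b * S) -> B = L' - b * S' ->
  D = A - B + (L' - L) + b * (S - S') -> X = D - r.
Proof. by move=> -> -> ->; ring. Qed.

Lemma mxtrace_mulmxB m n (A : 'M[R]_(m, n)) (X Y : 'M[R]_(n, m)) :
  \tr (A *m (X - Y)) = \tr (A *m X) - \tr (A *m Y).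
Proof. by rewrite mulmxBr raddfB. Qed.

Lemma mxtrace_mulmxD m n (A : 'M[R]_(m, n)) (X Y : 'M[R]_(n, m)) :
  \tr (A *m (X + Y)) = \tr (A *m X) + \tr (A *m Y).
Proof. by rewrite mulmxDr raddfD. Qed.

(** The terms produced by a Jacobian perturbation, absorbed by Young's
    inequality: only an arbitrarily small multiple of the energy density of
    the velocity error is left. *)
Lemma residual_density_young (C c L alpha beta th : R) :
  0 < C -> 0 < c -> 0 <= L -> 0 <= alpha -> 0 <= beta -> 0 < th ->
  exists delta K : R, 0 < delta /\ 0 <= K /\
  forall (h : R) (J J' Vs Ev : 'M[R]_(2, 3)) (vs ev ex : 'rV[R]_3) (ga ga' : R),
    0 < h ->
    nrm1 J <= C * h -> nrm1 J' <= C * h ->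
    c * h ^+ 2 <= areaJ J -> c * h ^+ 2 <= areaJ J' ->
    nrm1 (J - J') <= delta * h ->
    nrm1 Vs <= C * h -> nrm1 vs <= C -> `|ga'| <= C -> `|ga - ga'| <= L * nrm1 ex ->
    (areaJ J' - areaJ J) * dot (vs + ev) ev
    + alpha * (stiffJ J' (Vs + Ev) Ev - stiffJ J (Vs + Ev) Ev)
    + (ga * dot (crossJ J) ev - ga' * dot (crossJ J') ev)
    + beta * (stiffJ J' J' Ev - stiffJ J J Ev)
    <= th * (h ^+ 2 * frob2 ev + frob2 Ev) + K * (h ^+ 2 * frob2 ex + frob2 (J - J')).
Proof.
move=> C0 c0 L0 al0 be0 th0.
have [K K0 HK] := residual_density_le C0 c0 L0 al0 be0.
exists (th / (12 * K)), (72 * K ^+ 2 / th); split; first by rewrite divr_gt0 ?mulr_gt0.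
split; first by nonneg.
move=> h J J' Vs Ev vs ev ex ga ga' h0 JC J'C cJ cJ' dJ Vsb vsb gab gad.
apply: le_trans (HK h (th / (12 * K)) J J' Vs Ev vs ev ex ga ga' h0 JC J'C cJ cJ' dJ Vsb vsb gab gad) _.
have B (w : 'rV[R]_3) (W : 'M[R]_(2, 3)) :
    (h * nrm1 w) ^+ 2 + nrm1 W ^+ 2 <= 6 * (h ^+ 2 * frob2 w + frob2 W).
  have b1 := nrm1_sqr_le w; have b2 := nrm1_sqr_le W.
  rewrite exprMn mulrDr; apply: lerD => //; rewrite [X in _ <= X]mulrCA ler_wpM2l ?sqr_ge0//.
  by apply: le_trans b1 _; rewrite ler_wpM2r ?frob2_ge0// ler_nat.
have := B ex (J - J'); have := B ev Ev.
move: (h * nrm1 ev) (nrm1 Ev) (h * nrm1 ex) (nrm1 (J - J')) (h ^+ 2 * frob2 ev + frob2 Ev)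
  (h ^+ 2 * frob2 ex + frob2 (J - J')) => s tau y eps qv qx.
clear -K0 th0 => Bv Bx.
have Y := young (K * (eps + y)) (s + tau) (divr_gt0 th0 (ltr0Sn R 11)).
have s1 : (s + tau) ^+ 2 <= 12 * qv by have := sqr_ge0 (s - tau); lra.
have s2 : (eps + y) ^+ 2 <= 12 * qx by have := sqr_ge0 (eps - y); lra.
have s3 : K * (th / (12 * K)) * (s ^+ 2 + tau ^+ 2) <= th / 2 * qv.
  have -> : K * (th / (12 * K)) = th / 12 by field; rewrite gt_eqF.
  have -> : th / 2 * qv = th / 12 * (6 * qv) by field.
  by rewrite ler_wpM2l//; nonneg.
have s4 : (K * (eps + y)) ^+ 2 / (2 * (th / 12)) <= 72 * K ^+ 2 / th * qx.
  have -> : (K * (eps + y)) ^+ 2 / (2 * (th / 12)) = 6 * K ^+ 2 / th * (eps + y) ^+ 2.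
    by field; rewrite gt_eqF.
  have -> : 72 * K ^+ 2 / th * qx = 6 * K ^+ 2 / th * (12 * qx) by field; rewrite gt_eqF.
  by rewrite ler_wpM2l//; nonneg.
have s5 : th / 12 / 2 * (s + tau) ^+ 2 <= th / 2 * qv.
  have -> : th / 2 * qv = th / 12 / 2 * (12 * qv) by field.
  by rewrite ler_wpM2l//; nonneg.
have -> : th * qv = th / 2 * qv + th / 2 * qv by field.
rewrite mulrA; move: Y s3 s4 s5.
move: (K * (th / _) * _) (_ / th * qx) (_ ^+ 2 / (2 * _)) (th / 12 / 2 * _) (_ * (s + tau)) (th / 2 * qv).
by clear => *; lra.
Qed.

End StiffSymmetry.

#[local] Opaque jac elt_map areaJ crossJ adj_form.

Section MeshEstimates.
Context {R : realType} (k : nat).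
Local Notation T := (@ref_triangle R).

(** Both bounds are relative to the element size [h e], which makes all
    constants below independent of the mesh. *)
Definition regular_mesh (C c : R) (tr : triangulation R k) (h : 'I_(nb_elts tr) -> R) (x : nodal tr) :=
  forall e xi, T xi ->
    nrm1 (jac x e xi) <= C * h e /\ immersive (c * h e ^+ 2) (jac x e xi).

Section OneMesh.
Variables (tr : triangulation R k) (h : 'I_(nb_elts tr) -> R).
Hypothesis h0 : forall e, 0 < h e.
Implicit Types (x w z : nodal tr).

Lemma regular_nondegenerate C c x : 0 < c -> regular_mesh C c h x ->
  nondegenerate_mesh (fun e => c * h e ^+ 2) x.
Proof.
move=> c0 rx e xi Txi; have [_ im] := rx e xi Txi.
by apply: area_ge im; rewrite mulr_gt0// exprn_gt0.
Qed.

Lemma bddmeas_stiffJ a x w z e : (forall e, 0 < a e) -> nondegenerate_mesh a x ->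
  bddmeas (fun xi => stiffJ (jac x e xi) (jac w e xi) (jac z e xi)).
Proof. by move=> a0 ax; apply: bddmeasM; [exact: bddmeas_adj_form|exact: bddmeas_area_inv a0 ax]. Qed.

Lemma stiffJ_form a x w z : (forall e, 0 < a e) -> nondegenerate_mesh a x ->
  \tr (w^T *m stiffness x *m z) =
  \sum_e Itri (fun xi => stiffJ (jac x e xi) (jac w e xi) (jac z e xi)).
Proof. exact: stiff_form. Qed.

Lemma Kmx_form alpha a x w z : (forall e, 0 < a e) -> nondegenerate_mesh a x ->
  \tr (w^T *m Kmx alpha x *m z) = \sum_e Itri (fun xi =>
    areaJ (jac x e xi) * dot (elt_map w e xi) (elt_map z e xi)
    + alpha * stiffJ (jac x e xi) (jac w e xi) (jac z e xi)).
Proof.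
move=> a0 ax; rewrite /Kmx mulmxDr mulmxDl raddfD/= -scalemxAr -scalemxAl mxtraceZ.
rewrite mass_form (stiff_form w z a0 ax) mulr_sumr -big_split/=; apply: eq_bigr => e _.
rewrite -ItriZ; last exact: bddmeas_stiffJ a0 ax.
rewrite -ItriD//.
  by apply: bddmeasM; [exact: bddmeas_area|exact: bddmeas_dot_elt_map].
by apply: bddmeasM; [exact: bddmeas_cst|exact: bddmeas_stiffJ a0 ax].
Qed.

Lemma bddmeas_Kmx_dens alpha a x w z e : (forall e, 0 < a e) -> nondegenerate_mesh a x ->
  bddmeas (fun xi => areaJ (jac x e xi) * dot (elt_map w e xi) (elt_map z e xi)
    + alpha * stiffJ (jac x e xi) (jac w e xi) (jac z e xi)).
Proof.
move=> a0 ax; apply: bddmeasD.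
  by apply: bddmeasM; [exact: bddmeas_area|exact: bddmeas_dot_elt_map].
by apply: bddmeasM; [exact: bddmeas_cst|exact: bddmeas_stiffJ a0 ax].
Qed.

(** With Jacobians of size [h e] the area element is of order [h e ^+ 2] and the
    pulled-back stiffness form is of order one, as in the energy density. *)
Lemma Kmx_form_equiv alpha C c x w : 0 < alpha -> 0 < C -> 0 < c ->
  regular_mesh C c h x ->
  Num.min c (alpha * c / (6 * C ^+ 2)) * energy h w <= \tr (w^T *m Kmx alpha x *m w)
    <= (6 * C ^+ 2 + 18 * alpha * C ^+ 2 / c) * energy h w.
Proof.
move=> al0 C0 c0 rx; have nx := regular_nondegenerate c0 rx.
have a0 e : 0 < c * h e ^+ 2 by rewrite mulr_gt0 ?exprn_gt0.
rewrite (Kmx_form alpha w w a0 nx) /energy !mulr_sumr.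
set ka := Num.min _ _.
have ka1 : ka <= c by rewrite /ka ge_min lexx.
have ka2 : ka <= alpha * c / (6 * C ^+ 2) by rewrite /ka ge_min lexx orbT.
have C20 : 0 < C ^+ 2 by rewrite exprn_gt0.
have P e xi : T xi ->
   ka * energy_dens h w e xi <= areaJ (jac x e xi) * dot (elt_map w e xi) (elt_map w e xi)
    + alpha * stiffJ (jac x e xi) (jac w e xi) (jac w e xi)
   <= (6 * C ^+ 2 + 18 * alpha * C ^+ 2 / c) * energy_dens h w e xi.
  move=> Txi; have [JC im] := rx e xi Txi; have Age := nx e xi Txi.
  have he := h0 e; have h2 : 0 < h e ^+ 2 by rewrite exprn_gt0.
  have A0 : 0 < areaJ (jac x e xi) by exact: lt_le_trans Age.
  have Ale : areaJ (jac x e xi) <= 6 * C ^+ 2 * h e ^+ 2.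
    by apply: le_trans (areaJ_le _) _; apply: le_trans (crossJ_le JC) _; rewrite exprMn mulrA.
  rewrite dot_frob2 /energy_dens; set q := frob2 (elt_map w e xi); set p := frob2 (jac w e xi).
  have q0 : 0 <= q by exact: frob2_ge0.
  have p0 : 0 <= p by exact: frob2_ge0.
  have hq0 : 0 <= h e ^+ 2 * q by rewrite mulr_ge0 ?(ltW h2).
  have S1 : c / (6 * C ^+ 2) * p <= stiffJ (jac x e xi) (jac w e xi) (jac w e xi).
    rewrite /stiffJ ler_pdivlMr//.
    apply: le_trans (adj_form_ge (jac w e xi) im).
    apply: (@le_trans _ _ (c / (6 * C ^+ 2) * p * (6 * C ^+ 2 * h e ^+ 2))).
      by rewrite ler_wpM2l//; nonneg.
    by rewrite le_eqVlt; apply/orP; left; apply/eqP; rewrite -/p; field; rewrite gt_eqF.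
  have S2 : stiffJ (jac x e xi) (jac w e xi) (jac w e xi) <= 18 * C ^+ 2 / c * p.
    apply: le_trans (ler_norm _) _; apply: le_trans (stiffJ_le _ _ JC (a0 e) Age) _.
    have -> : 18 * C ^+ 2 / c * p = 3 * (C * h e) ^+ 2 / (c * h e ^+ 2) * (6 * p).
      by field; rewrite !gt_eqF ?h0.
    rewrite ler_wpM2l//; first nonneg.
    by rewrite -expr2; exact: (nrm1_sqr_le (jac w e xi)).
  apply/andP; split.
    rewrite mulrDr; apply: lerD.
      rewrite mulrA ler_wpM2r//; apply: le_trans Age.
      by rewrite ler_wpM2r// ltW.
    apply: (@le_trans _ _ (alpha * (c / (6 * C ^+ 2) * p))); last by rewrite ler_wpM2l// ltW.
    by rewrite [X in _ <= X]mulrA ler_wpM2r// mulrA.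
  have e1 : areaJ (jac x e xi) * q <= 6 * C ^+ 2 * (h e ^+ 2 * q).
    by rewrite mulrA ler_wpM2r.
  have e2 : alpha * stiffJ (jac x e xi) (jac w e xi) (jac w e xi) <= 18 * alpha * C ^+ 2 / c * p.
    have -> : 18 * alpha * C ^+ 2 / c * p = alpha * (18 * C ^+ 2 / c * p) by field; rewrite gt_eqF.
    by rewrite ler_wpM2l// ltW.
  have e3 : 0 <= 6 * C ^+ 2 * p by nonneg.
  have e4 : 0 <= 18 * alpha * C ^+ 2 / c * (h e ^+ 2 * q).
    by nonneg.
  rewrite !(mulrDl (6 * C ^+ 2)) !mulrDr.
  by move: (6 * C ^+ 2 * _) (6 * C ^+ 2 * _) (_ / c * _) (_ / c * _) e1 e2 e3 e4 => *; lra.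
have gK e := bddmeas_Kmx_dens alpha w w e a0 nx.
apply/andP; split; apply: ler_sum => e _; rewrite -ItriZ; try exact: bddmeas_energy_dens.
  apply: le_Itri => //; first by apply: bddmeasM; [exact: bddmeas_cst|exact: bddmeas_energy_dens].
  by move=> xi /(P e) /andP[].
apply: le_Itri => //; first by apply: bddmeasM; [exact: bddmeas_cst|exact: bddmeas_energy_dens].
by move=> xi /(P e) /andP[].
Qed.

Lemma mass_sym x : (mass x)^T = mass x.
Proof.
apply/matrixP => i j; rewrite !mxE; apply: eq_bigr => e _.
by apply: eq_Itri => xi _; rewrite [X in X * _]mulrC.
Qed.

Lemma stiffness_sym x : (stiffness x)^T = stiffness x.
Proof.
apply/matrixP => i j; rewrite !mxE; apply: eq_bigr => e _.
by apply: eq_Itri => xi _; rewrite dotC.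
Qed.

Lemma Kmx_sym alpha x : (Kmx alpha x)^T = Kmx alpha x.
Proof. by rewrite /Kmx linearD/= linearZ/= mass_sym stiffness_sym. Qed.

(** The area element is Lipschitz in the Jacobian with constant [O(h)], so a
    perturbation of size [delta * h e] changes it by less than half of its lower
    bound. *)
Lemma perturbed_jac C c delta x xs : 0 < C -> 0 < c -> delta <= 1 ->
  delta <= c / (24 * (C + 1)) -> regular_mesh C c h xs ->
  (forall e xi, T xi -> nrm1 (jac (x - xs) e xi) <= delta * h e) ->
  forall e xi, T xi ->
    [/\ nrm1 (jac x e xi) <= (C + 1) * h e, nrm1 (jac xs e xi) <= (C + 1) * h e,
        c / 2 * h e ^+ 2 <= areaJ (jac x e xi) & c / 2 * h e ^+ 2 <= areaJ (jac xs e xi)].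
Proof.
move=> C0 c0 d1 d2 rxs exB e xi Txi; have [JC im] := rxs e xi Txi.
have Age := regular_nondegenerate c0 rxs e Txi; have dB := exB e xi Txi; have he := h0 e.
have C10 : 0 < C + 1 by rewrite addr_gt0.
have Jx : jac x e xi - jac xs e xi = jac (x - xs) e xi by rewrite jacD jacN.
have h20 : 0 < c / 2 * h e ^+ 2 by rewrite mulr_gt0 ?divr_gt0 ?exprn_gt0.
have JC1 : nrm1 (jac xs e xi) <= (C + 1) * h e.
  by apply: le_trans JC _; rewrite ler_wpM2r ?ltW// ltrDl.
have JC2 : nrm1 (jac x e xi) <= (C + 1) * h e.
  rewrite -(subrK (jac xs e xi) (jac x e xi)) Jx.
  apply: le_trans (nrm1D _ _) _; rewrite addrC; rewrite mulrDl mul1r; apply: lerD => //.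
  by apply: le_trans dB _; rewrite ler_piMl// ltW.
have AD : `|areaJ (jac x e xi) - areaJ (jac xs e xi)| <= c / 2 * h e ^+ 2.
  apply: le_trans (area_dist JC2 JC1) _; rewrite Jx.
  apply: (@le_trans _ _ (12 * ((C + 1) * h e) * (c / (24 * (C + 1)) * h e))).
    rewrite ler_wpM2l//; first nonneg.
    by apply: le_trans dB _; rewrite ler_wpM2r// ltW.
  by rewrite le_eqVlt; apply/orP; left; apply/eqP; field; rewrite gt_eqF.
have cE : c * h e ^+ 2 = c / 2 * h e ^+ 2 + c / 2 * h e ^+ 2 by field.
rewrite cE in Age; have [A1 A2] := dist_half_le AD Age h20.
exact: And4 JC2 JC1 A1 A2.
Qed.

(** The integrand of the consistency error caused by replacing the exact
    surface by the discrete one, tested with [ev]. *)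
Definition residual_dens (alpha beta : R) (g : ('rV[R]_3 * R)%type -> R) (t : R) x xs v ev e xi :=
  (areaJ (jac xs e xi) - areaJ (jac x e xi)) * dot (elt_map v e xi) (elt_map ev e xi)
  + alpha * (stiffJ (jac xs e xi) (jac v e xi) (jac ev e xi) - stiffJ (jac x e xi) (jac v e xi) (jac ev e xi))
  + (g (elt_map x e xi, t) * dot (crossJ (jac x e xi)) (elt_map ev e xi)
     - g (elt_map xs e xi, t) * dot (crossJ (jac xs e xi)) (elt_map ev e xi))
  + beta * (stiffJ (jac xs e xi) (jac xs e xi) (jac ev e xi) - stiffJ (jac x e xi) (jac x e xi) (jac ev e xi)).

(** Subtract the two equations, test with the velocity error and write
    [K(xs) vs] as [K(xs) v - K(xs) (v - vs)]: then only differences of the forms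
    at [xs] and at [x] are left. *)
Lemma error_equation a alpha beta g t x xs v vs r :
  (forall e, 0 < a e) -> nondegenerate_mesh a x -> nondegenerate_mesh a xs ->
  (forall (y : nodal tr) e, bddmeas (fun xi => g (elt_map y e xi, t))) ->
  Kmx alpha x *m v + Amx beta x *m x = load g x t ->
  Kmx alpha xs *m vs + Amx beta xs *m xs = load g xs t + r ->
  (forall e, bddmeas (residual_dens alpha beta g t x xs v (v - vs) e)) /\
  \tr ((v - vs)^T *m Kmx alpha xs *m (v - vs)) =
    \sum_e Itri (residual_dens alpha beta g t x xs v (v - vs) e) - \tr ((v - vs)^T *m r).
Proof.
move=> a0 nx nxs gg Ex Exs; set ev := v - vs.
have gS1 w z e := bddmeas_stiffJ w z e a0 nxs.
have gS w z e := bddmeas_stiffJ w z e a0 nx.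
have gM y w z e : bddmeas (fun xi => areaJ (jac y e xi) * dot (elt_map w e xi) (elt_map z e xi)).
  by apply: bddmeasM; [exact: bddmeas_area|exact: bddmeas_dot_elt_map].
have gL y e : bddmeas (fun xi => g (elt_map y e xi, t) * dot (crossJ (jac y e xi)) (elt_map ev e xi)).
  by apply: bddmeasM => //; exact: bddmeas_dot_cross.
have gZ b (f : (R * R)%type -> R) : bddmeas f -> bddmeas (fun xi => b * f xi).
  by apply: bddmeasM; exact: bddmeas_cst.
split=> [e|].
  apply: bddmeasD; [apply: bddmeasD; [apply: bddmeasD|]|].
  - apply: bddmeasM; last exact: bddmeas_dot_elt_map.
    by apply: bddmeasB; exact: bddmeas_area.
  - by apply: gZ; apply: bddmeasB.
  - exact: bddmeasB.
  - by apply: gZ; apply: bddmeasB.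
have E1 : \tr (ev^T *m Kmx alpha xs *m ev) = \tr (ev^T *m Kmx alpha xs *m v)
    - \tr (ev^T *m (load g xs t + r - Amx beta xs *m xs)).
  by rewrite -Exs addrK mulmxA -mxtrace_mulmxB.
have E2 : \tr (ev^T *m Kmx alpha x *m v) = \tr (ev^T *m (load g x t - Amx beta x *m x)).
  by rewrite -Ex addrK mulmxA.
have A1 y w : \tr (ev^T *m (Amx beta y *m w)) = beta * \tr (ev^T *m stiffness y *m w).
  by rewrite /Amx mulmxA -scalemxAr -scalemxAl mxtraceZ.
clearbody ev; rewrite mxtrace_mulmxB mxtrace_mulmxD A1 in E1; rewrite mxtrace_mulmxB A1 in E2.
rewrite (stiffJ_form ev xs a0 nxs) (load_form ev a0 nxs (gg xs)) (Kmx_form alpha ev v a0 nxs) in E1.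
rewrite (stiffJ_form ev x a0 nx) (load_form ev a0 nx (gg x)) (Kmx_form alpha ev v a0 nx) in E2.
apply: (residual_algebra E1 E2).
rewrite -!sumrB mulr_sumr -!big_split/=; apply: eq_bigr => e _.
have gK y (w z : nodal tr) : bddmeas (fun xi => stiffJ (jac y e xi) (jac w e xi) (jac z e xi)) ->
   bddmeas (fun xi => areaJ (jac y e xi) * dot (elt_map w e xi) (elt_map z e xi)
     + alpha * stiffJ (jac y e xi) (jac w e xi) (jac z e xi)).
  by move=> gs; apply: bddmeasD => //; exact: gZ.
rewrite -(ItriB (gK _ _ _ (gS1 _ _ _)) (gK _ _ _ (gS _ _ _))) -(ItriB (gL _ _) (gL _ _)).
rewrite -(ItriB (gS1 _ _ _) (gS _ _ _)) -(ItriZ beta (bddmeasB (gS1 _ _ _) (gS _ _ _))).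
rewrite -(ItriD (bddmeasB (gK _ _ _ (gS1 _ _ _)) (gK _ _ _ (gS _ _ _))) (bddmeasB (gL _ _) (gL _ _))).
rewrite -(ItriD (bddmeasD (bddmeasB (gK _ _ _ (gS1 _ _ _)) (gK _ _ _ (gS _ _ _))) (bddmeasB (gL _ _) (gL _ _)))
  (gZ beta _ (bddmeasB (gS1 _ _ _) (gS _ _ _)))).
apply: eq_Itri => xi _; rewrite /residual_dens.
exact: residual_dens_sym.
Qed.

End OneMesh.

(** The consistency terms cost at most half of the energy of the velocity
    error, which coercivity of [K(xs)] absorbs.  The defect term is estimated in
    the [K(xs)]-inner product after writing [r] as [K(xs) u]. *)
Lemma stability_estimate (alpha beta C c L : R) :
  0 < alpha -> 0 < beta -> 0 < C -> 0 < c -> 0 <= L ->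
  exists delta K : R, 0 < delta /\ 0 < K /\
  forall (tr : triangulation R k) (h : 'I_(nb_elts tr) -> R) (x xs v vs r : nodal tr)
     (g : ('rV[R]_3 * R)%type -> R) (t : R),
    (forall e, 0 < h e) ->
    regular_mesh C c h xs -> Kmx alpha xs \in unitmx ->
    (forall e xi, T xi -> nrm1 (jac vs e xi) <= C * h e /\ nrm1 (elt_map vs e xi) <= C) ->
    (forall e xi, T xi -> `|g (elt_map xs e xi, t)| <= C) ->
    (forall (y : nodal tr) e, bddmeas (fun xi => g (elt_map y e xi, t))) ->
    (forall u u', `|g (u, t) - g (u', t)| <= L * nrm1 (u - u')) ->
    (forall e xi, T xi -> nrm1 (jac (x - xs) e xi) <= delta * h e) ->
    Kmx alpha x *m v + Amx beta x *m x = load g x t ->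
    Kmx alpha xs *m vs + Amx beta xs *m xs = load g xs t + r ->
    \tr ((v - vs)^T *m Kmx alpha xs *m (v - vs)) <=
      K * (energy h (x - xs) + \tr (r^T *m invmx (Kmx alpha xs) *m r)).
Proof.
move=> al0 be0 C0 c0 L0.
have C10 : 0 < C + 1 by rewrite addr_gt0.
have c20 : 0 < c / 2 by rewrite divr_gt0.
pose ka := Num.min c (alpha * c / (6 * C ^+ 2)).
have ka0 : 0 < ka by rewrite /ka lt_min c0 divr_gt0// ?mulr_gt0// exprn_gt0.
have [d' [K [d'0 [K0 HK]]]] := residual_density_young C10 c20 L0 (ltW al0) (ltW be0) (divr_gt0 ka0 (ltr0Sn R 1)).
(* Small enough for [perturbed_jac] and for absorbing half of the coercivity
   constant. *)
pose delta := Num.min 1 (Num.min (c / (24 * (C + 1))) d').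
have d0 : 0 < delta by rewrite /delta !lt_min ltr01 d'0 !divr_gt0// mulr_gt0.
have d1 : delta <= 1 by rewrite /delta ge_min lexx.
have d2 : delta <= c / (24 * (C + 1)) by rewrite /delta !ge_min lexx orbT.
have d3 : delta <= d' by rewrite /delta !ge_min lexx !orbT.
clearbody delta.
exists delta, (4 * K + 4); split => //; split; first by rewrite ltr_wpDl// mulr_ge0.
move=> tr h x xs v vs r g t h0 rxs Ku vsB gB gg gL exB Ex Exs.
have PJ := perturbed_jac h0 C0 c0 d1 d2 rxs exB.
have a0 e : 0 < c / 2 * h e ^+ 2 by rewrite mulr_gt0 ?exprn_gt0.
have nx : nondegenerate_mesh (fun e => c / 2 * h e ^+ 2) x.
  by move=> e xi Txi; have [_ _ p _] := PJ e xi Txi; exact: p.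
have nxs : nondegenerate_mesh (fun e => c / 2 * h e ^+ 2) xs.
  by move=> e xi Txi; have [_ _ _ p] := PJ e xi Txi; exact: p.
have [gD DE] := error_equation a0 nx nxs gg Ex Exs.
set ev := v - vs in gD DE *; set ex := x - xs in exB *.
have Dle e xi : T xi -> residual_dens alpha beta g t x xs v ev e xi <=
    ka / 2 * energy_dens h ev e xi + K * energy_dens h ex e xi.
  move=> Txi; have [vs1 vs2] := vsB e xi Txi; have [p1 p2 p3 p4] := PJ e xi Txi.
  have vE : elt_map v e xi = elt_map vs e xi + elt_map ev e xi by rewrite -elt_mapD /ev addrC subrK.
  have VE : jac v e xi = jac vs e xi + jac ev e xi by rewrite -jacD /ev addrC subrK.
  have exE : elt_map x e xi - elt_map xs e xi = elt_map ex e xi by rewrite -elt_mapN -elt_mapD.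
  have Jx : jac x e xi - jac xs e xi = jac ex e xi by rewrite /ex jacD jacN.
  have hexp : nrm1 (jac x e xi - jac xs e xi) <= d' * h e.
    by rewrite Jx; apply: le_trans (exB e xi Txi) _; rewrite ler_wpM2r// ltW.
  have Vs' : nrm1 (jac vs e xi) <= (C + 1) * h e.
    by apply: le_trans vs1 _; rewrite ler_wpM2r ?(ltW (h0 e))// lerDl.
  have vs' : nrm1 (elt_map vs e xi) <= C + 1 by apply: le_trans vs2 _; rewrite lerDl.
  have g' : `|g (elt_map xs e xi, t)| <= C + 1 by apply: le_trans (gB e xi Txi) _; rewrite lerDl.
  have gL' : `|g (elt_map x e xi, t) - g (elt_map xs e xi, t)| <= L * nrm1 (elt_map ex e xi).
    by rewrite -exE.
  rewrite /residual_dens /energy_dens vE VE -Jx.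
  exact: (HK _ _ _ _ (jac ev e xi) _ (elt_map ev e xi) _ _ _ (h0 e) p1 p2 p3 p4 hexp Vs' vs' g' gL').
have KE := Kmx_form_equiv h0 ev al0 C0 c0 rxs; rewrite -/ka in KE.
have SD : \sum_e Itri (residual_dens alpha beta g t x xs v ev e) <= ka / 2 * energy h ev + K * energy h ex.
  rewrite /energy !mulr_sumr -big_split/=; apply: ler_sum => e _.
  have gE w := bddmeas_energy_dens h w e.
  have gZ b (f : (R * R)%type -> R) : bddmeas f -> bddmeas (fun xi => b * f xi).
    by apply: bddmeasM; exact: bddmeas_cst.
  rewrite -(ItriZ _ (gE ev)) -(ItriZ _ (gE ex)) -(ItriD (gZ _ _ (gE ev)) (gZ _ _ (gE ex))).
  by apply: le_Itri => //; [apply: bddmeasD; exact: gZ|exact: Dle].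
pose u := invmx (Kmx alpha xs) *m r.
have rE : r = Kmx alpha xs *m u by rewrite /u mulKVmx.
have Er : \tr (r^T *m invmx (Kmx alpha xs) *m r) = \tr (u^T *m Kmx alpha xs *m u).
  by rewrite {1}rE trmx_mul Kmx_sym -!mulmxA -/u.
clearbody u ev.
have ge0 (w : nodal tr) : 0 <= \tr (w^T *m Kmx alpha xs *m w).
  have /andP[+ _] := Kmx_form_equiv h0 w al0 C0 c0 rxs.
  by apply: le_trans; rewrite mulr_ge0 ?energy_ge0// ltW.
have Cross : \tr (u^T *m Kmx alpha xs *m ev) = \tr (ev^T *m r).
  by rewrite -mxtrace_tr !trmx_mul trmxK Kmx_sym -rE.
(* Young's inequality in the [K(xs)]-inner product, as the nonnegativity of the
   form at [u + ev / 2]. *)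
have PosE : 0 <= \tr (u^T *m Kmx alpha xs *m u) + \tr (ev^T *m r) + 4^-1 * \tr (ev^T *m Kmx alpha xs *m ev).
  apply: le_trans (ge0 (u + 2^-1 *: ev)) _; rewrite le_eqVlt; apply/orP; left; apply/eqP.
  have Cross' : \tr (ev^T *m Kmx alpha xs *m u) = \tr (ev^T *m r) by rewrite -mulmxA -rE.
  have TT : (u + 2^-1 *: ev)^T = u^T + 2^-1 *: ev^T by rewrite linearD/= linearZ.
  rewrite TT mxtrace_mulmxD !mulmxDl -!scalemxAl -!scalemxAr !mxtraceD !mxtraceZ.
  by rewrite Cross Cross'; field.
have {}KE : ka * energy h ev <= \tr (ev^T *m Kmx alpha xs *m ev) by case/andP: KE.
rewrite Er.
have E0 : 0 <= energy h ex by exact: energy_ge0.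
have U0 := ge0 u.
have E1 : 0 <= K * \tr (u^T *m Kmx alpha xs *m u) by rewrite mulr_ge0.
have -> : (4 * K + 4) * (energy h ex + \tr (u^T *m Kmx alpha xs *m u)) =
  4 * (K * energy h ex) + 4 * (K * \tr (u^T *m Kmx alpha xs *m u)) + 4 * energy h ex
   + 4 * \tr (u^T *m Kmx alpha xs *m u) by ring.
have kaE : ka / 2 * energy h ev = 2^-1 * (ka * energy h ev) by ring.
rewrite kaE in SD.
exact: stability_algebra DE SD KE E1 PosE E0 U0.
Qed.

End MeshEstimates.

#[local] Transparent jac elt_map areaJ crossJ adj_form.

(** * Partition of unity by the nodal basis *)

Section PartitionOfUnity.
Context {R : realType}.

(** The generalized binomial coefficient of a real upper argument, in the
    product form of the nodal basis. *)
Definition binomr (x : R) (n : nat) : R :=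
  \prod_(0 <= m < n) ((x - m%:R) / (n%:R - m%:R)).

Lemma binomr_fact x n : binomr x n * n`!%:R = \prod_(0 <= m < n) (x - m%:R).
Proof.
rewrite /binomr big_split/= -mulrA -[RHS]mulr1; congr (_ * _).
have -> : n`!%:R = \prod_(0 <= m < n) (n%:R - m%:R : R).
  elim: n => [|n IH]; first by rewrite big_geq.
  rewrite big_nat_recl//= subr0 factS natrM IH; congr (_ * _).
  by apply: eq_bigr => m _; rewrite -!natr1; ring.
rewrite -big_split/= big_nat big1// => m /= mn.
by rewrite mulVf// subr_eq0 eqr_nat gtn_eqF.
Qed.

Lemma binomrS x n : n.+1%:R * binomr x n.+1 = (x - n%:R) * binomr x n.
Proof.
have nf : (n`!%:R : R) != 0 by rewrite pnatr_eq0 -lt0n fact_gt0.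
apply: (mulIf nf); rewrite mulrAC -natrM -factS mulrC binomr_fact.
by rewrite -mulrA binomr_fact big_nat_recr//= mulrC.
Qed.

Lemma binomr0 x : binomr x 0 = 1.
Proof. by rewrite /binomr big_geq. Qed.

Lemma binomr_diag n : binomr n%:R n = 1.
Proof.
rewrite /binomr big_nat big1// => m /= mn.
by rewrite divff// subr_eq0 eqr_nat gtn_eqF.
Qed.

Lemma vandermonde x y n :
  \sum_(j < n.+1) binomr x j * binomr y (n - j) = binomr (x + y) n.
Proof.
elim: n => [|n IH]; first by rewrite big_ord1 !binomr0 mulr1.
have nN0 : (n.+1%:R : R) != 0 by rewrite pnatr_eq0.
apply: (mulfI nN0); rewrite binomrS -IH mulr_sumr.
have -> : \sum_(j < n.+2) n.+1%:R * (binomr x j * binomr y (n.+1 - j)) =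
    \sum_(j < n.+2) j%:R * binomr x j * binomr y (n.+1 - j)
    + \sum_(j < n.+2) binomr x j * ((n.+1 - j)%:R * binomr y (n.+1 - j)).
  rewrite -big_split; apply: eq_bigr => j _ /=.
  by rewrite natrB -1?ltnS//; ring.
rewrite big_ord_recl [X in _ + X]big_ord_recr/= subnn !mul0r mulr0 add0r addr0.
rewrite -big_split/= mulr_sumr; apply: eq_bigr => j _.
have jn : (j <= n)%N by rewrite -ltnS.
rewrite ?subSS subSn// !binomrS natrB//.
by ring.
Qed.

(** The nodal basis polynomials are products of the generalized binomial
    coefficients of [k] times the barycentric coordinates, so by Vandermonde's
    convolution their sum is the binomial coefficient of [k] over [k]. *)
Lemma sum_lagrange k (xi : (R * R)%type) : \sum_(a : lattice k) lagrange a xi = 1.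
Proof.
pose x i : R := k%:R * bary xi i.
(* The generating polynomial of the binomial coefficients, cut off at degree
   [k]; the coefficient of degree [k] of the product is not affected. *)
pose G i : {poly R} := \sum_(j < k.+1) binomr (x i) j *: 'X^j.
have coefG i n : (n <= k)%N -> (G i)`_n = binomr (x i) n.
  move=> nk; rewrite coef_sum (bigD1 (Ordinal (nk : (n < k.+1)%N)))//= coefZ coefXn eqxx mulr1.
  rewrite big1 ?addr0// => j jn; rewrite coefZ coefXn; case: eqP => [nj|_]; last by rewrite mulr0.
  by case/eqP: jn; apply/val_inj.
have step (P : {poly R}) x' n i : (n <= k)%N -> (forall m, (m <= k)%N -> P`_m = binomr x' m) ->
    (P * G i)`_n = binomr (x' + x i) n.
  move=> nk HP; rewrite coefM -vandermonde; apply: eq_bigr => j _.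
  by rewrite HP ?coefG//; [exact: leq_trans (leq_subr _ _) nk|rewrite (leq_trans _ nk)// -ltnS].
have : (\prod_i G i)`_k = 1.
  have -> : \prod_i G i = G 0 * G 1 * G 2.
    rewrite !big_ord_recl big_ord0 mulr1 mulrA.
    by congr (_ * G _ * G _); apply/val_inj.
  rewrite (step _ (x 0 + x 1))// => [|m mk]; last by apply: step => // j jk; exact: coefG.
  have -> : x 0 + x 1 + x 2 = k%:R by rewrite /x /bary/=; ring.
  exact: binomr_diag.
move=> <-; rewrite bigA_distr_bigA/= coef_sum.
rewrite (eq_bigr (fun f : {ffun 'I_3 -> 'I_k.+1} =>
   (\prod_i binomr (x i) (f i)) * (k == \sum_(i < 3) f i)%N%:R)); last first.
  move=> f _; rewrite scaler_prod.
  have -> : \prod_(i < 3) 'X^(f i) = 'X^(\sum_(i < 3) f i) :> {poly R}.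
    by rewrite -expr_sum.
  by rewrite coefZ coefXn.
rewrite (bigID (fun f : {ffun 'I_3 -> 'I_k.+1} => \sum_(i < 3) f i == k)%N)/=.
rewrite [X in _ + X]big1 ?addr0 => [|f /negbTE fk]; last by rewrite eq_sym fk mulr0.
rewrite [RHS](eq_bigr (fun f : {ffun 'I_3 -> 'I_k.+1} => \prod_i binomr (x i) (f i))); last first.
  by move=> f /eqP ->; rewrite eqxx mulr1.
by rewrite [RHS]big_sub.
Qed.
End PartitionOfUnity.

(** * Inverse estimates on a mesh *)

Section MeshInverse.
Context {R : realType} (k : nat).
Local Notation T := (@ref_triangle R).

Lemma uniform_bound (A : finType) (F : A -> (R * R)%type -> R) :
  (forall a, continuous (F a)) ->
  exists2 C : R, 0 < C & forall a xi, T xi -> `|F a xi| <= C.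
Proof.
move=> cF; have /choice[M HM] : forall a, exists M, forall xi, T xi -> `|F a xi| <= M.
  by move=> a; have [] := bddmeas_continuous (cF a).
exists (\sum_a `|M a| + 1) => [|a xi Txi]; first by rewrite ltr_wpDl// sumr_ge0.
apply: le_trans (HM a xi Txi) _; apply: le_trans (ler_norm _) _.
by rewrite (bigD1 a)//= -addrA lerDl addr_ge0// sumr_ge0.
Qed.

Lemma lagrange_bounds : exists2 C : R, 0 < C & forall (a : lattice k) (xi : (R * R)%type), T xi ->
  `|lagrange a xi| <= C /\ forall r, `|ref_grad (lagrange a : _ -> R) xi r| <= C.
Proof.
have [C1 C10 H1] := @uniform_bound (lattice k) (fun a => lagrange a) (fun a => planar_continuous (planar_lagrange a)).
have [C2 C20 H2] := @uniform_bound (lattice k * 'I_2)%type (fun ar xi => ref_grad (lagrange ar.1 : _ -> R) xi ar.2) (fun ar => @continuous_ref_grad _ _ ar.1 ar.2).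
exists (C1 + C2) => [|a xi Txi]; first by rewrite addr_gt0.
split => [|r]; first by apply: le_trans (H1 a xi Txi) _; rewrite lerDl ltW.
by apply: le_trans (H2 (a, r) xi Txi) _; rewrite lerDr ltW.
Qed.

Lemma energy_dens_le_energy (tr : triangulation R k) h (w : nodal tr) e :
  Itri (energy_dens h w e) <= energy h w.
Proof.
rewrite /energy (bigD1 e)//= lerDl; apply: sumr_ge0 => i _; apply: Itri_ge0 => xi _.
by apply: addr_ge0; [apply: mulr_ge0; [exact: sqr_ge0|]|]; exact: frob2_ge0.
Qed.

(** The element maps range over a fixed finite-dimensional space, so a single
    application of [inverse_estimate] on the reference triangle serves all
    meshes. *)
Lemma mesh_inverse_estimate : exists2 C : R, 0 < C &
  forall (tr : triangulation R k) h (w : nodal tr) e xi, T xi ->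
    nrm1 (jac w e xi) ^+ 2 <= C * energy h w /\
    (h e * nrm1 (elt_map w e xi)) ^+ 2 <= C * energy h w.
Proof.
have [C0 C00 H0] := inverse_estimate (fun a : lattice k => planar_continuous (planar_lagrange a) : continuous (lagrange a : _ -> R)).
have HS (r : 'I_2) : exists2 C : R, 0 < C & forall (c : lattice k -> R) xi, T xi ->
    (\sum_i c i * ref_grad (lagrange i) xi r) ^+ 2 <=
    C * Itri (fun z => (\sum_i c i * ref_grad (lagrange i) z r) ^+ 2).
  by apply: inverse_estimate => a; exact: continuous_ref_grad.
have [C1 C10 H1] := HS 0; have [C2 C20 H2] := HS 1.
exists (36 * (C0 + C1 + C2)) => [|tr h w e xi Txi]; first by rewrite mulr_gt0// !addr_gt0.
have E0 := energy_ge0 h w.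
have ED := energy_dens_le_energy h w e.
split.
  apply: le_trans (nrm1_sqr_le _) _.
  have J r l : jac w e xi r l ^+ 2 <= (C1 + C2) * energy h w.
    have Cr : exists2 C, 0 <= C <= C1 + C2 & jac w e xi r l ^+ 2 <= C * Itri (fun z => jac w e z r l ^+ 2).
      have : r \in [:: 0; 1] by case: r => -[|[|//]] hr; rewrite !inE.
      rewrite !inE => /orP[] /eqP ->.
        exists C1; first by rewrite (ltW C10) lerDl ltW.
        have := H1 (fun a => w (local_node e a) l) xi Txi.
        rewrite -jacE => H; apply: le_trans H _; rewrite le_eqVlt; apply/orP; left; apply/eqP.
        by congr (_ * _); apply: eq_Itri => z _; rewrite jacE.
      exists C2; first by rewrite (ltW C20) lerDr ltW.
      have := H2 (fun a => w (local_node e a) l) xi Txi.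
        rewrite -jacE => H; apply: le_trans H _; rewrite le_eqVlt; apply/orP; left; apply/eqP.
        by congr (_ * _); apply: eq_Itri => z _; rewrite jacE.
    have [C /andP[C'0 CC] HC] := Cr; apply: le_trans HC _; apply: ler_pM => //.
      by apply: Itri_ge0 => z _; exact: sqr_ge0.
    apply: le_trans ED; apply: le_Itri => [||z _].
    - by under eq_fun do rewrite expr2; apply: bddmeasM; exact: bddmeas_jac.
    - exact: bddmeas_energy_dens.
    rewrite /energy_dens -[leLHS]add0r; apply: lerD.
      by apply: mulr_ge0; [exact: sqr_ge0|exact: frob2_ge0].
    rewrite /frob2 (bigD1 r)//= (bigD1 l)//= -addrA lerDl.
    by apply: addr_ge0; apply: sumr_ge0 => ? _; [|apply: sumr_ge0 => ? _]; exact: sqr_ge0.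
  have -> : 36 * (C0 + C1 + C2) * energy h w =
    6 * (6 * ((C1 + C2) * energy h w)) + 36 * (C0 * energy h w) by ring.
  have F : frob2 (jac w e xi) <= 6 * ((C1 + C2) * energy h w).
    rewrite /frob2 sum_ord2 !sum_ord3.
    have -> : 6 * ((C1 + C2) * energy h w) = (C1 + C2) * energy h w + (C1 + C2) * energy h w + (C1 + C2) * energy h w
      + ((C1 + C2) * energy h w + (C1 + C2) * energy h w + (C1 + C2) * energy h w) by ring.
    by rewrite !lerD.
  rewrite -[leLHS]addr0; apply: lerD; last by rewrite !mulr_ge0// ltW.
  by rewrite ler_wpM2l.
rewrite exprMn.
have M l : h e ^+ 2 * elt_map w e xi 0 l ^+ 2 <= C0 * energy h w.
  apply: (@le_trans _ _ (h e ^+ 2 * (C0 * Itri (fun z => elt_map w e z 0 l ^+ 2)))).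
    rewrite ler_wpM2l ?sqr_ge0// elt_mapE; under eq_bigr do rewrite mulrC.
    apply: le_trans (H0 _ _ Txi) _; rewrite le_eqVlt; apply/orP; left; apply/eqP.
    congr (_ * Itri _); apply/funext => z; rewrite elt_mapE; congr (_ ^+ 2).
    by apply: eq_bigr => a _; rewrite mulrC.
  rewrite mulrCA ler_wpM2l ?(ltW C00)//.
  have gm : bddmeas (fun z => elt_map w e z 0 l ^+ 2).
    by under eq_fun do rewrite expr2; apply: bddmeasM; exact: bddmeas_elt_map.
  rewrite -ItriZ//; apply: le_trans ED; apply: le_Itri => [||z _].
  - by apply: bddmeasM => //; exact: bddmeas_cst.
  - exact: bddmeas_energy_dens.
  rewrite /energy_dens -[leLHS]addr0; apply: lerD; last exact: frob2_ge0.
  rewrite ler_wpM2l ?sqr_ge0// /frob2 big_ord1 (bigD1 l)//= lerDl.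
  by apply: sumr_ge0 => ? _; exact: sqr_ge0.
apply: (@le_trans _ _ (h e ^+ 2 * (3 * frob2 (elt_map w e xi)))).
  by rewrite ler_wpM2l ?sqr_ge0//; exact: (nrm1_sqr_le (elt_map w e xi)).
have F : h e ^+ 2 * frob2 (elt_map w e xi) <= 3 * (C0 * energy h w).
  rewrite /frob2 big_ord1 sum_ord3 !mulrDr.
  have -> : 3 * (C0 * energy h w) = C0 * energy h w + C0 * energy h w + C0 * energy h w by ring.
  by rewrite !lerD.
have p0 : 0 <= C0 * energy h w by rewrite mulr_ge0// ltW.
have p1 : 0 <= C1 * energy h w by rewrite mulr_ge0// ltW.
have p2 : 0 <= C2 * energy h w by rewrite mulr_ge0// ltW.
have -> : 36 * (C0 + C1 + C2) * energy h w =
  36 * (C0 * energy h w) + 36 * (C1 * energy h w) + 36 * (C2 * energy h w) by ring.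
rewrite mulrCA; move: F p0 p1 p2; clear; move: (h e ^+ 2 * _) (C0 * _) (C1 * _) (C2 * _) => *.
lra.
Qed.

Lemma sum_ref_grad_lagrange (xi : (R * R)%type) r :
  \sum_(a : lattice k) ref_grad (lagrange a : _ -> R) xi r = 0.
Proof.
rewrite /ref_grad; set v := (if _ then _ else _).
have H1 : is_derive xi v (fun z => \sum_(a : lattice k) lagrange a z)
    (\sum_(a : lattice k) 'D_v (lagrange a : _ -> R) xi).
  by apply: is_derive_bigsum => a _; exact: is_derive_lagrange.
have H2 : is_derive xi v (fun z : (R * R)%type => \sum_(a : lattice k) lagrange a z) 0.
  by under eq_fun do rewrite sum_lagrange; exact: is_derive_cst.
by rewrite -(@derive_val _ _ _ _ _ _ _ H1) (@derive_val _ _ _ _ _ _ _ H2).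
Qed.

(** As the derivatives of the nodal basis sum to zero, the Jacobian depends on
    differences of nodes only, and hence is of the order of the diameter. *)
Lemma jac_nodes (tr : triangulation R k) (x : nodal tr) e xi (p : 'rV[R]_3) r l :
  jac x e xi r l = \sum_a (row (local_node e a) x - p) 0 l * ref_grad (lagrange a) xi r.
Proof.
under eq_bigr do rewrite !mxE mulrBl.
by rewrite sumrB -mulr_sumr sum_ref_grad_lagrange mulr0 subr0 jacE.
Qed.

Lemma lattice_pt_ref_triangle (k0 : (0 < k)%N) (a : lattice k) : T (lattice_pt R a).
Proof.
have k0' : 0 < k%:R :> R by rewrite ltr0n.
split => /=; try by rewrite divr_ge0.
rewrite -mulrDl ler_pdivrMr// mul1r -natrD ler_nat.
have /eqP ak := valP a; apply: (@leq_trans (\sum_(i < 3) val a i)%N); last by rewrite ak.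
rewrite !big_ord_recl big_ord0 addn0 /=.
have -> : lift ord0 (ord0 : 'I_2) = 1 :> 'I_3 by apply/val_inj.
have -> : lift ord0 (lift ord0 (ord0 : 'I_1)) = 2 :> 'I_3 by apply/val_inj.
by rewrite leq_addl.
Qed.

Lemma elt_map_lattice_pt (k0 : (0 < k)%N) (tr : triangulation R k) (x : nodal tr) e a :
  elt_map x e (lattice_pt R a) = row (local_node e a) x.
Proof.
rewrite /elt_map (bigD1 a)//= lagrange_lattice// eqxx scale1r big1 ?addr0// => b ba.
by rewrite lagrange_lattice// (negbTE ba) scale0r.
Qed.

(** The inverse estimate at the lattice points recovers all nodal values. *)
Lemma energy_eq0 (k0 : (0 < k)%N) (tr : triangulation R k) h (w : nodal tr) :
  (forall e, 0 < h e) -> (forall j, exists e a, @local_node _ _ tr e a = j) ->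
  energy h w <= 0 -> w = 0.
Proof.
move=> h0 cover Ew; have [C C0 HC] := mesh_inverse_estimate.
apply/row_matrixP => j; have [e [a <-]] := cover j.
have [_] := HC tr h w e _ (lattice_pt_ref_triangle k0 a).
rewrite elt_map_lattice_pt// => H.
have N0 : nrm1 (row (local_node e a) w) = 0.
  have : (h e * nrm1 (row (local_node e a) w)) ^+ 2 <= 0.
    by apply: le_trans H _; rewrite pmulr_rle0.
  move=> H2; have /eqP : (h e * nrm1 (row (local_node e a) w)) ^+ 2 == 0.
    by rewrite eq_le H2 sqr_ge0.
  by move/eqP; rewrite expf_eq0/= mulf_eq0 gt_eqF//= => /eqP.
apply/rowP => l; rewrite row0 [RHS]mxE; apply/eqP; rewrite -normr_le0 -N0.
exact: entry_le_nrm1.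
Qed.

(** A kernel vector has zero [K]-norm, hence zero energy. *)
Lemma Kmx_unit (k0 : (0 < k)%N) (tr : triangulation R k) h alpha C c (x : nodal tr) :
  (forall e, 0 < h e) -> (forall j, exists e a, @local_node _ _ tr e a = j) ->
  0 < alpha -> 0 < C -> 0 < c -> regular_mesh C c h x -> Kmx alpha x \in unitmx.
Proof.
move=> h0 cover al0 C0 c0 rx; rewrite -row_free_unit -kermx_eq0; apply/eqP/row_matrixP => i.
set u := row i _; rewrite row0.
have uK : u *m Kmx alpha x = 0 by rewrite /u -row_mul mulmx_ker row0.
pose w : nodal tr := u^T *m const_mx 1.
have wK : w^T *m Kmx alpha x *m w = 0 by rewrite /w trmx_mul trmxK -(mulmxA _ u) uK mulmx0 mul0mx.
have /andP[+ _] := Kmx_form_equiv h0 w al0 C0 c0 rx.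
rewrite wK mxtrace0 pmulr_rle0; last by rewrite lt_min c0 divr_gt0 ?mulr_gt0// exprn_gt0.
move=> /(energy_eq0 k0 h0 cover) w0; apply/rowP => j.
have /matrixP/(_ j 0) := w0; rewrite !mxE big_ord1 !mxE mulr1.
by [].
Qed.

End MeshInverse.

Section ElementDiameter.
Context {R : realType} (k : nat) (tr : triangulation R k).
Local Notation T := (@ref_triangle R).
Local Notation x0 := (init_node tr).

Lemma enorm_ge_entry n (u : 'rV[R]_n) i : `|u 0 i| <= enorm u.
Proof.
rewrite -sqrtr_sqr ler_wsqrtr// dot_frob2 /frob2 big_ord1 (bigD1 i)//= lerDl.
by apply: sumr_ge0 => ? _; exact: sqr_ge0.
Qed.

Lemma nrm1_le_enorm n (u : 'rV[R]_n) : nrm1 u <= n%:R * enorm u.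
Proof.
have -> : n%:R * enorm u = \sum_(i < n) enorm u by rewrite sumr_const card_ord mulr_natl.
by rewrite /nrm1 big_ord1; apply: ler_sum => i _; exact: enorm_ge_entry.
Qed.

Lemma enorm_le_nrm1 n (u : 'rV[R]_n) : enorm u <= nrm1 u.
Proof.
rewrite -(ger0_norm (nrm1_ge0 u)) -sqrtr_sqr ler_wsqrtr// dot_frob2.
exact: frob2_le_nrm1.
Qed.

Lemma elt_map_bounded (x : nodal tr) e : exists M, forall xi, T xi -> nrm1 (elt_map x e xi) <= M.
Proof.
have [l|C C0 HC] := @uniform_bound R 'I_3 (fun l xi => elt_map x e xi 0 l).
  exact: continuous_elt_map.
exists (C + C + C) => xi Txi; rewrite nrm1_row3.
by rewrite !lerD// HC.
Qed.

Lemma enorm_le_diam e xi xi' : T xi -> T xi' ->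
  enorm (elt_map x0 e xi - elt_map x0 e xi') <= elt_diam e.
Proof.
move=> Txi Txi'; apply: sup_upper_bound; last by exists xi => //; exists xi'.
split; first by eexists; exists xi => //; exists xi'.
have [M HM] := elt_map_bounded x0 e.
exists (M + M) => _ [z Tz [z' Tz' <-]].
apply: le_trans (enorm_le_nrm1 _) _; apply: le_trans (nrm1D _ _) _.
by rewrite nrm1N lerD// HM.
Qed.

Lemma nodes_le_diam (k0 : (0 < k)%N) e a b :
  nrm1 (row (local_node e a) x0 - row (local_node e b) x0) <= 3 * elt_diam e.
Proof.
apply: le_trans (nrm1_le_enorm _) _; rewrite ler_wpM2l//.
rewrite -!(elt_map_lattice_pt k0); apply: enorm_le_diam; exact: lattice_pt_ref_triangle.
Qed.

Lemma elt_diam_gt0 (ctr : conforming tr) (e : 'I_(nb_elts tr)) : 0 < elt_diam e.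
Proof.
have [inj _] := ctr.
have T0 : T (0, 0) by split => //=; rewrite addr0.
have T1 : T (1, 0) by split => //=; rewrite addr0.
apply: lt_le_trans (enorm_le_diam e T0 T1).
rewrite lt_neqAle sqrtr_ge0 andbT eq_sym; apply/eqP => E.
have EE : elt_map x0 e (0, 0) = elt_map x0 e (1, 0).
  apply/eqP; rewrite -subr_eq0; apply/eqP/rowP => l; rewrite [RHS]mxE.
  by have := enorm_ge_entry (elt_map x0 e (0, 0) - elt_map x0 e (1, 0)) l; rewrite E normr_le0 => /eqP.
have [/eqP] := inj e _ _ T0 T1 EE.
by rewrite eq_sym oner_eq0.
Qed.

Lemma elt_diam_le_mesh (e : 'I_(nb_elts tr)) : elt_diam e <= mesh_size tr.
Proof. exact: (le_bigmax _ (fun e => elt_diam e)). Qed.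

End ElementDiameter.

(** * Maps of class C^1 and C^2 *)

Section SmoothMaps.
Context {R : realType} {V : normedModType R}.
Implicit Types (f : V -> R) (p q u v x : V) (U : set V).

Lemma is_derive_line f p v (s : R) : derivable f (p + s *: v) v ->
  is_derive s 1 (fun s => f (p + s *: v)) ('D_v f (p + s *: v)).
Proof.
move=> df; have E : (fun h : R => h^-1 *: (((fun s => f (p + s *: v)) \o shift s) (h *: 1) - f (p + s *: v)))
   = (fun h : R => h^-1 *: ((f \o shift (p + s *: v)) (h *: v) - f (p + s *: v))).
  apply/funext => h /=; congr (_ *: (f _ - _)).
  by rewrite -[h *: 1]/(h * 1) mulr1 scalerDl addrCA.
by split; rewrite /derivable /derive E.
Qed.

Lemma mean_value f p v : (forall s : R, 0 <= s <= 1 -> derivable f (p + s *: v) v) ->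
  exists2 s : R, 0 < s < 1 & f (p + v) - f p = 'D_v f (p + s *: v).
Proof.
move=> df; have [||x x01 H] := @MVT _ (fun s => f (p + s *: v)) (fun s => 'D_v f (p + s *: v)) 0 1 ltr01.
- by move=> x; rewrite in_itv/= => /andP[x0 x1]; apply: is_derive_line; apply: df; rewrite !ltW.
- apply: derivable_within_continuous => x; rewrite in_itv/= => x01.
  by have [] := is_derive_line (df x x01).
exists x => //.
by rewrite scale1r scale0r addr0 subr0 mulr1 in H.
Qed.

Lemma segment_ball p q x (r s : R) : `|p - x| < r -> `|q - x| < r -> 0 <= s <= 1 ->
  `|p + s *: (q - p) - x| < r.
Proof.
move=> pr qr /andP[s0 s1].
have -> : p + s *: (q - p) - x = (1 - s) *: (p - x) + s *: (q - x).
  rewrite scalerBl scale1r addrAC -[RHS]addrA; congr (_ + _).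
  by rewrite [RHS]addrC -scalerBr opprB addrA subrK.
apply: le_lt_trans (ler_normD _ _) _; rewrite !normrZ !ger0_norm ?subr_ge0//.
have [->|sN0] := eqVneq s 0; first by rewrite mul0r addr0 subr0 mul1r.
have sgt0 : 0 < s by rewrite lt_neqAle eq_sym sN0.
have a1 : (1 - s) * `|p - x| <= (1 - s) * r by rewrite ler_wpM2l ?subr_ge0// ltW.
have a2 : s * `|q - x| < s * r by rewrite ltr_pM2l.
have -> : r = (1 - s) * r + s * r by ring.
by rewrite ler_ltD.
Qed.

Lemma is_deriveZv f x v (a : R) : derivable f x v -> is_derive x (a *: v) f (a * 'D_v f x).
Proof.
move=> df; have [->|aN0] := eqVneq a 0.
  by rewrite scale0r mul0r; exact: is_derive0.
have cl : h^-1 *: ((f \o shift x) (h *: (a *: v)) - f x) @[h --> 0^'] --> a * 'D_v f x.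
  have dv : h^-1 *: ((f \o shift x) (h *: v) - f x) @[h --> 0^'] --> 'D_v f x by [].
  apply/cvgrPdist_le => e e0.
  have e0' : 0 < e / `|a| by rewrite divr_gt0// normr_gt0.
  move/cvgrPdist_le : dv => /(_ _ e0') [/= d d0 Hd].
  have da0 : 0 < d / `|a| by rewrite divr_gt0// normr_gt0.
  exists (d / `|a|) => //= h; rewrite /= sub0r normrN => hd hN0.
  have := Hd (h * a); rewrite /= sub0r normrN normrM.
  rewrite -ltr_pdivlMr ?normr_gt0// mulf_neq0// => /(_ hd isT) H.
  have -> : h^-1 *: (f (h *: (a *: v) + x) - f x) = a * ((h * a)^-1 *: (f ((h * a) *: v + x) - f x)).
    by rewrite scalerA /GRing.scale/= mulrA; congr (_ * _); field; rewrite hN0 aN0.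
  by rewrite -mulrBr normrM mulrC -ler_pdivlMr// normr_gt0.
by split; [apply/cvg_ex; exists (a * 'D_v f x)|exact/cvg_lim].
Qed.

(** Directional derivatives suffice, since a Taylor expansion uses only finitely
    many fixed directions. *)
Definition C1_on (W : normedModType R) U (f : V -> W) :=
  forall v, (forall x, U x -> derivable f x v) /\
    (forall x, U x -> {for x, continuous (fun x => 'D_v f x)}).

Lemma class_C1 (W : normedModType R) m U (f : V -> W) : class_C m.+1 U f -> C1_on U f.
Proof.
move=> [_ H] v; have [H1 H2] := H v; split => //.
by case: m H2 {H} => [[]|m []].
Qed.

Lemma open_ball_norm U x : open U -> U x -> exists2 r : R, 0 < r & forall y, `|y - x| < r -> U y.
Proof.
move=> oU Ux; have /nbhs_ballP[r /= r0 H] := open_nbhs_nbhs (conj oU Ux).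
by exists r => // y yx; apply: H; rewrite -ball_normE/= distrC.
Qed.

(** Go from [x] first along [h u], then along [h v]; on the second leg the mean
    value theorem produces a derivative in the direction [v] at a nearby point,
    and this derivative is continuous. *)
Lemma is_deriveDv U f x u v : open U -> U x -> C1_on U f ->
  is_derive x (u + v) f ('D_u f x + 'D_v f x).
Proof.
move=> oU Ux C1; have [du _] := C1 u; have [dv cv] := C1 v.
have [r r0 rU] := open_ball_norm oU Ux.
suff cl : h^-1 *: ((f \o shift x) (h *: (u + v)) - f x) @[h --> 0^'] --> 'D_u f x + 'D_v f x.
  by split; [apply/cvg_ex; exists ('D_u f x + 'D_v f x)|exact/cvg_lim].
have E : (fun h : R => h^-1 *: ((f \o shift x) (h *: (u + v)) - f x)) =
  (fun h => h^-1 *: ((f \o shift x) (h *: u) - f x)) \+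
  (fun h => h^-1 *: (f (h *: (u + v) + x) - f (h *: u + x))).
  by apply/funext => h /=; rewrite -scalerDr [in RHS]addrC subrKA.
rewrite E; apply: cvgD; first exact: (du x Ux).
apply/cvgrPdist_le => e e0.
have /cvgrPdist_le/(_ _ e0)/nbhs_ballP[d /= d0 Hd] := cv x Ux.
pose m := Num.min r d; have m0 : 0 < m by rewrite lt_min r0 d0.
pose N := `|u| + `|v| + 1; have N0 : 0 < N by rewrite ltr_wpDl// addr_ge0.
exists (m / N) => /=; first by rewrite divr_gt0.
move=> h; rewrite /= sub0r normrN ltr_pdivlMr// => hm hN0.
have near_x (s : R) : 0 <= s <= 1 -> `|(h *: u + x + s *: (h *: v)) - x| < m.
  move=> /andP[s0 s1]; rewrite addrAC addrK; apply: le_lt_trans (ler_normD _ _) _.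
  apply: le_lt_trans hm; rewrite !normrZ (ger0_norm s0) /N !mulrDr mulr1 -addrA lerD2l.
  apply: (@le_trans _ _ (`|h| * `|v|)); last by rewrite lerDl.
  by rewrite ler_piMl// mulr_ge0.
have [s s01 Hs] : exists2 s : R, 0 < s < 1 & f (h *: u + x + h *: v) - f (h *: u + x)
     = 'D_(h *: v) f (h *: u + x + s *: (h *: v)).
  apply: mean_value => s s01; have z := near_x s s01.
  have Uz : U (h *: u + x + s *: (h *: v)) by apply: rU; apply: lt_le_trans z _; rewrite ge_min lexx.
  by have [] := is_deriveZv h (dv _ Uz).
have z : `|(h *: u + x + s *: (h *: v)) - x| < m by apply: near_x; case/andP: s01 => *; rewrite !ltW.
have Uz : U (h *: u + x + s *: (h *: v)) by apply: rU; apply: lt_le_trans z _; rewrite ge_min lexx.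
rewrite (scalerDr h u v) [X in f X - _]addrAC Hs.
rewrite (@derive_val _ _ _ _ _ _ _ (is_deriveZv h (dv _ Uz))) /GRing.scale/= mulKf//.
apply: Hd; rewrite -ball_normE/= distrC; apply: lt_le_trans z _.
by rewrite ge_min lexx orbT.
Qed.

Lemma derive_sumv U f x n (b : 'I_n -> V) (c : 'I_n -> R) : open U -> U x -> C1_on U f ->
  is_derive x (\sum_i c i *: b i) f (\sum_i c i * 'D_(b i) f x).
Proof.
move=> oU Ux C1; elim: n b c => [|n IH] b c.
  by rewrite !big_ord0; exact: is_derive0.
rewrite !big_ord_recl; set w := \sum_(i < n) _ *: _.
have H1 := is_deriveZv (c ord0) ((C1 (b ord0)).1 x Ux).
have H2 : is_derive x w f _ := IH (fun i => b (lift ord0 i)) (fun i => c (lift ord0 i)).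
have := is_deriveDv (c ord0 *: b ord0) w oU Ux C1.
by rewrite (@derive_val _ _ _ _ _ _ _ H1) (@derive_val _ _ _ _ _ _ _ H2).
Qed.

Lemma locally_bounded_derivatives U f x n (b : 'I_n -> V) : open U -> U x -> C1_on U f ->
  exists r C : R, [/\ 0 < r, 0 <= C & forall y, `|y - x| < r -> U y /\ forall i, `|'D_(b i) f y| <= C].
Proof.
move=> oU Ux C1; have [r r0 rU] := open_ball_norm oU Ux.
have /choice[d Hd] : forall i, exists d : R, 0 < d /\ forall y, `|y - x| < d -> `|'D_(b i) f y| <= `|'D_(b i) f x| + 1.
  move=> i; have /cvgrPdist_le/(_ _ ltr01)/nbhs_ballP[d /= d0 Hd] := (C1 (b i)).2 x Ux.
  exists d; split => // y yx; have /Hd H : ball x d y by rewrite -ball_normE/= distrC.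
  rewrite -[X in `|X|](subrK ('D_(b i) f x)); apply: le_trans (ler_normD _ _) _.
  by rewrite addrC lerD2l distrC.
exists (\big[Num.min/r]_i d i), (\sum_i (`|'D_(b i) f x| + 1)); split.
- by elim/big_ind : _ => // [a a' ? ?|i _]; [rewrite lt_min; apply/andP|case: (Hd i)].
- by apply: sumr_ge0 => i _; rewrite addr_ge0.
move=> y yx; split; first by apply: rU; apply: lt_le_trans yx _; exact: bigmin_le_id.
move=> i; have [_ H] := Hd i; apply: le_trans (H y _) _.
  by apply: lt_le_trans yx _; exact: bigmin_le_cond.
by rewrite [leRHS](bigD1 i)//= lerDl sumr_ge0// => j _; rewrite addr_ge0.
Qed.

Lemma locally_lipschitz U f x n (b : 'I_n -> V) : open U -> U x -> C1_on U f ->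
  exists r C : R, [/\ 0 < r, 0 <= C & forall p q (c : 'I_n -> R), `|p - x| < r -> `|q - x| < r ->
     q - p = \sum_i c i *: b i -> `|f q - f p| <= C * \sum_i `|c i| ].
Proof.
move=> oU Ux C1; have [r [C [r0 C0 H]]] := locally_bounded_derivatives b oU Ux C1.
exists r, C; split => // p q c px qx qp.
have [s s01 Hs] : exists2 s : R, 0 < s < 1 & f (p + (q - p)) - f p = 'D_(q - p) f (p + s *: (q - p)).
  apply: mean_value => s s01; have [Uz _] := H _ (segment_ball px qx s01).
  exact: (C1 (q - p)).1.
have s01' : 0 <= s <= 1 by case/andP: s01 => *; rewrite !ltW.
have [Uz Hz] := H _ (segment_ball px qx s01').
move: Hs; rewrite [X in f X - _]addrC subrK => ->.
rewrite qp in Uz Hz *; rewrite (@derive_val _ _ _ _ _ _ _ (derive_sumv b c oU Uz C1)).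
apply: le_trans (ler_norm_sum _ _ _) _; rewrite mulr_sumr; apply: ler_sum => i _.
by rewrite normrM mulrC ler_wpM2r.
Qed.

(** The mean value theorem on the segment and the Lipschitz continuity of the
    derivatives in the directions [b i]; the increment is expanded in these
    directions. *)
Lemma locally_taylor U f x n (b : 'I_n -> V) : open U -> U x -> C1_on U f ->
  (forall i, C1_on U (fun y => 'D_(b i) f y)) ->
  exists r C : R, [/\ 0 < r, 0 <= C & forall p q (c : 'I_n -> R), `|p - x| < r -> `|q - x| < r ->
     q - p = \sum_i c i *: b i ->
     `|f q - f p - \sum_i c i * 'D_(b i) f p| <= C * (\sum_i `|c i|) ^+ 2 ].
Proof.
move=> oU Ux C1 C2; have [r rgt0 rU] := open_ball_norm oU Ux.
have /choice[rC HC] : forall i, exists rC : R * R, [/\ 0 < rC.1, 0 <= rC.2 &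
    forall p q (c : 'I_n -> R), `|p - x| < rC.1 -> `|q - x| < rC.1 ->
     q - p = \sum_i c i *: b i -> `|'D_(b i) f q - 'D_(b i) f p| <= rC.2 * \sum_i `|c i| ].
  by move=> i; have [r' [C' H]] := locally_lipschitz b oU Ux (C2 i); exists (r', C').
exists (\big[Num.min/r]_i (rC i).1), (\sum_i (rC i).2).
split.
- elim/big_ind : _ => // [a a' ? ?|i _]; first by rewrite lt_min; apply/andP.
  by have [] := HC i.
- by apply: sumr_ge0 => i _; have [] := HC i.
move=> p q c px qx qp.
have rm i : \big[Num.min/r]_i (rC i).1 <= (rC i).1 by exact: bigmin_le_cond.
have rm0 : \big[Num.min/r]_i (rC i).1 <= r by exact: bigmin_le_id.
have Us (s : R) : 0 <= s <= 1 -> U (p + s *: (q - p)).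
  by move=> s01; apply: rU; apply: lt_le_trans rm0; exact: segment_ball.
have [s s01 Hs] : exists2 s : R, 0 < s < 1 & f (p + (q - p)) - f p = 'D_(q - p) f (p + s *: (q - p)).
  by apply: mean_value => s s01; apply: (C1 (q - p)).1; exact: Us.
have s01' : 0 <= s <= 1 by case/andP: s01 => *; rewrite !ltW.
have Uz := Us s s01'; have zx := segment_ball px qx s01'.
move: Hs; rewrite [X in f X - _]addrC subrK => ->.
set z := p + s *: (q - p) in Uz zx *.
rewrite qp (@derive_val _ _ _ _ _ _ _ (derive_sumv b c oU Uz C1)) -sumrB.
have zp : z - p = \sum_i (s * c i) *: b i.
  by rewrite /z [X in X - _]addrC addrK qp scaler_sumr; apply: eq_bigr => i _; rewrite scalerA.
apply: le_trans (ler_norm_sum _ _ _) _; rewrite mulr_suml; apply: ler_sum => i _.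
have [_ C0 H] := HC i.
rewrite -mulrBr normrM.
apply: (@le_trans _ _ (\sum_j `|c j| * ((rC i).2 * \sum_j `|c j|))); last first.
  by rewrite -mulr_suml; rewrite le_eqVlt; apply/orP; left; apply/eqP; ring.
rewrite -mulr_suml; apply: ler_pM => //; first by rewrite (bigD1 i)//= lerDl sumr_ge0.
apply: le_trans (H p z _ (lt_le_trans px (rm i)) (lt_le_trans zx (rm i)) zp) _.
rewrite ler_wpM2l//; apply: ler_sum => j _; rewrite normrM.
by case/andP: s01' => s0 s1; rewrite (ger0_norm s0) ler_piMl.
Qed.

End SmoothMaps.

Section Coordinates.
Context {R : realType} {V : normedModType R}.
Implicit Types (x v : V) (U : set V).

Lemma near_open U x : open U -> U x -> \forall y \near x, U y.
Proof. by move=> oU Ux; exact: open_nbhs_nbhs. Qed.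

Lemma near_eq_continuous (W : topologicalType) (f g : V -> W) x : (\forall y \near x, f y = g y) ->
  {for x, continuous f} -> {for x, continuous g}.
Proof.
move=> fg cf; rewrite /prop_for /continuous_at -(nbhs_singleton fg).
by apply: cvg_trans cf; apply: near_eq_cvg.
Qed.

Lemma C1_on_ext U (f g : V -> R) : open U -> (forall x, U x -> f x = g x) -> C1_on U f -> C1_on U g.
Proof.
move=> oU fg C1 v; have [df cf] := C1 v.
have nfg x : U x -> \forall y \near x, f y = g y.
  by move=> Ux; apply: filterS (near_open oU Ux) => y; exact: fg.
split => x Ux; first exact: near_eq_derivable (nfg x Ux) (df x Ux).
apply: near_eq_continuous (cf x Ux).
by apply: filterS (near_open oU Ux) => y Uy; apply: near_eq_derive; exact: nfg.
Qed.

Variable n : nat.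
Implicit Types F : V -> 'rV[R]_n.

Lemma derive_coord F x v l : derivable F x v -> 'D_v (fun z => F z 0 l) x = 'D_v F x 0 l.
Proof. by move=> dF; rewrite derive_mx// mxE. Qed.

Lemma continuous_coord F x l : {for x, continuous F} -> {for x, continuous (fun z => F z 0 l)}.
Proof. by move=> cF; apply: (@continuous_comp _ _ _ F (fun M : 'rV[R]_n => M 0 l)) => //; exact: coord_continuous. Qed.

Lemma C1_on_coord U F l : open U -> C1_on U F -> C1_on U (fun z => F z 0 l).
Proof.
move=> oU C1 v; have [dF cF] := C1 v; split => x Ux.
  by have /derivable_mxP := dF x Ux; apply.
have cc : {for x, continuous (fun z => 'D_v F z 0 l)}.
  by apply: (@continuous_coord (fun z => 'D_v F z)); exact: cF.
apply: (near_eq_continuous _ cc).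
by apply: filterS (near_open oU Ux) => y Uy; rewrite derive_coord//; exact: dF.
Qed.

Definition C2_on U (f : V -> R) := [/\ forall x, U x -> {for x, continuous f}, C1_on U f &
  forall v, C1_on U (fun z => 'D_v f z)].

Lemma class_C2_coord U F l : open U -> class_C 2 U F -> C2_on U (fun z => F z 0 l).
Proof.
move=> oU CF; have C1 : C1_on U F := @class_C1 _ _ _ 1 U F CF.
have [cF HF] := CF; split.
- by move=> x Ux; apply: continuous_coord; exact: cF.
- exact: C1_on_coord.
- move=> v; have [dv Cv] := HF v.
  apply: (@C1_on_ext U (fun z => 'D_v F z 0 l)) => //.
    by move=> x Ux; rewrite derive_coord//; exact: dv.
  exact: (@C1_on_coord U (fun z => 'D_v F z) l oU (@class_C1 _ _ _ 0 U (fun z => 'D_v F z) Cv)).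
Qed.

Lemma class_C2_scalar U (f : V -> R) : class_C 2 U f -> C2_on U f.
Proof.
move=> Cf; have [cf Hf] := Cf; split => //; first exact: (@class_C1 _ _ _ 1 U f Cf).
by move=> v; have [_ Cv] := Hf v; exact: (@class_C1 _ _ _ 0 U (fun z => 'D_v f z) Cv).
Qed.

End Coordinates.

Section UniformRegularity.
Context {R : realType}.
Local Notation V := ('rV[R]_3 * R)%type.

(** Local thresholds have a common positive lower bound on a compact set. *)
Lemma compact_uniform (X : topologicalType) (K : set X) (P : R -> X -> Prop) : compact K ->
  (forall x, K x -> exists2 e0 : R, 0 < e0 & \forall y \near x, forall e, 0 < e <= e0 -> P e y) ->
  exists2 e0 : R, 0 < e0 & forall e, 0 < e <= e0 -> forall x, K x -> P e x.
Proof.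
move=> /compact_near_coveringP cK H.
have [] := cK R (0 : R)^'+ (fun e x => forall e', 0 < e' <= e -> P e' x) _ _.
- move=> x Kx; have [e0 e00 He] := H x Kx.
  exists ([set y | forall e, 0 < e <= e0 -> P e y], [set e | e <= e0]) => /=.
    by split => //; exact: nbhs_right_le.
  move=> [y e] /= [Hy ee0] e' /andP[e'0 e'e]; apply: Hy.
  by rewrite e'0 (le_trans e'e).
move=> d /= d0 Hd; exists (d / 2); first by rewrite divr_gt0.
move=> e /andP[e0 ed] x Kx; apply: (Hd e) => //=; last by rewrite e0 lexx.
by rewrite sub0r normrN gtr0_norm//; lra.
Qed.

Lemma uniform_small n (P : 'I_n -> R -> Prop) :
  (forall l, exists2 e0 : R, 0 < e0 & forall e, 0 < e <= e0 -> P l e) ->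
  exists2 e0 : R, 0 < e0 & forall e, 0 < e <= e0 -> forall l, P l e.
Proof.
move=> H; have /choice[ee Hee] : forall l, exists e0 : R, 0 < e0 /\ forall e, 0 < e <= e0 -> P l e.
  by move=> l; have [e0 ? ?] := H l; exists e0.
exists (\big[Num.min/1]_l ee l).
  by elim/big_ind : _ => // [a a' ? ?|l _]; [rewrite lt_min; apply/andP|case: (Hee l)].
move=> e /andP[e0 ele] l; have [_] := Hee l; apply; rewrite e0/=.
by apply: le_trans ele _; exact: bigmin_le_cond.
Qed.

Definition bx (l : 'I_3) : V := (delta_mx 0 l, 0).
Definition bt : V := (0, 1).

Lemma rV_sub_bx (p q : 'rV[R]_3) (t : R) : (q, t) - (p, t) = \sum_l (q - p) 0 l *: bx l.
Proof.
rewrite sum_ord3; apply/eqP; rewrite -pair_eqE /pair_eq/= subrr !scaler0 !addr0 eqxx andbT.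
by apply/eqP; rewrite {1}[q - p]row_sum_delta sum_ord3.
Qed.

Lemma norm_le_nrm1 n (u : 'rV[R]_n) : `|u| <= nrm1 u.
Proof.
rewrite [leLHS]/Num.Def.normr/= mx_normrE (bigmax_le _ (nrm1_ge0 u))// => i _.
exact: entry_le_nrm1.
Qed.

Lemma nrm1_rowE n (u : 'rV[R]_n) : nrm1 u = \sum_l `|u 0 l|.
Proof. by rewrite /nrm1 big_ord1. Qed.

Lemma norm_pair_sub (p q : 'rV[R]_3) (t : R) : `|((q, t) : V) - (p, t)| <= nrm1 (q - p).
Proof.
by rewrite prod_normE/= subrr normr0 ge_max norm_le_nrm1 nrm1_ge0.
Qed.

(** One parameter bounds all derivatives, the Taylor remainder and the radius of
    its validity, uniformly on the compact space-time surface. *)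
Lemma uniform_C2 (f : V -> R) (U : set V) (G0 : set 'rV[R]_3) (T : R) :
  open U -> compact G0 -> C2_on U f ->
  (forall p t, G0 p -> 0 <= t <= T -> U (p, t)) ->
  exists2 e0 : R, 0 < e0 & forall e, 0 < e <= e0 -> forall p t, G0 p -> 0 <= t <= T ->
    [/\ `|f (p, t)| <= e^-1, forall m, `|'D_(bx m) f (p, t)| <= e^-1, `|'D_bt f (p, t)| <= e^-1 &
      forall q, nrm1 (q - p) <= e ->
        `|f (q, t) - f (p, t) - \sum_m (q - p) 0 m * 'D_(bx m) f (p, t)| <= e^-1 * nrm1 (q - p) ^+ 2 /\
        `|'D_bt f (q, t) - 'D_bt f (p, t)| <= e^-1 * nrm1 (q - p)].
Proof.
move=> oU cG [cf C1 C2] GU.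
pose K : set V := G0 `*` [set` `[0, T]].
have cK : compact K by apply: compact_setX => //; exact: segment_compact.
have [|e0 e00 He] := @compact_uniform V K (fun e z =>
    [/\ `|f z| <= e^-1, forall m, `|'D_(bx m) f z| <= e^-1, `|'D_bt f z| <= e^-1 &
      forall q, nrm1 (q - z.1) <= e ->
        `|f (q, z.2) - f z - \sum_m (q - z.1) 0 m * 'D_(bx m) f z| <= e^-1 * nrm1 (q - z.1) ^+ 2 /\
        `|'D_bt f (q, z.2) - 'D_bt f z| <= e^-1 * nrm1 (q - z.1)]) cK; last first.
  exists e0 => // e ee0 p t Gp tT; apply: (He e ee0 (p, t)).
  by split => //=; rewrite in_itv.
move=> z [Gz tz]; have Uz : U z by case: z Gz tz => p t /= Gp; rewrite in_itv/=; exact: GU.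
have [r1 [M1 [r10 M10 H1]]] := locally_taylor (b := bx) oU Uz C1 (fun i => C2 (bx i)).
have [r2 [M2 [r20 M20 H2]]] := locally_lipschitz bx oU Uz (C2 bt).
have [r3 [M3 [r30 M30 H3]]] := locally_bounded_derivatives bx oU Uz C1.
have [r4 [M4 [r40 M40 H4]]] := locally_bounded_derivatives (fun _ : 'I_1 => bt) oU Uz C1.
have /cvgrPdist_le/(_ _ ltr01)/nbhs_ballP[r5 /= r50 H5] := cf z Uz.
pose r := Num.min r1 (Num.min r2 (Num.min r3 (Num.min r4 r5))).
have r0 : 0 < r by rewrite !lt_min r10 r20 r30 r40.
have rr1 : r <= r1 by rewrite ge_min lexx.
have rr2 : r <= r2 by rewrite !ge_min lexx orbT.
have rr3 : r <= r3 by rewrite !ge_min lexx !orbT.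
have rr4 : r <= r4 by rewrite !ge_min lexx !orbT.
have rr5 : r <= r5 by rewrite !ge_min lexx !orbT.
clearbody r.
pose M := M1 + M2 + M3 + M4 + `|f z| + 1.
have N0 : 0 <= `|f z| by [].
have M0 : 0 < M by rewrite /M; lra.
exists (Num.min (r / 2) M^-1); first by rewrite lt_min divr_gt0// invr_gt0.
have nz : \forall y \near z, `|y - z| < r / 2.
  by apply/nbhs_ballP; exists (r / 2) => /=; [rewrite divr_gt0|move=> y; rewrite -ball_normE/= distrC].
near=> y; move=> e /andP[e0]; rewrite le_min => /andP[er eM].
have yz : `|y - z| < r / 2 by near: y.
have yzr : `|y - z| < r by apply: lt_le_trans yz _; lra.
have Me : M <= e^-1 by rewrite -(invrK M) lef_pV2// posrE invr_gt0.
have [M1M M2M M3M M4M] : [/\ M1 <= M, M2 <= M, M3 <= M & M4 <= M] by rewrite /M; split; lra.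
split.
- apply: le_trans Me; rewrite -[X in `|X|](subrK (f z)); apply: le_trans (ler_normD _ _) _.
  have : `|f z - f y| <= 1 by apply: H5; rewrite -ball_normE/= distrC; exact: lt_le_trans rr5.
  by rewrite distrC /M; lra.
- move=> m; apply: le_trans Me; apply: le_trans M3M.
  by have [_] := H3 y (lt_le_trans yzr rr3); apply.
- apply: le_trans Me; apply: le_trans M4M.
  by have [_ /(_ ord0)] := H4 y (lt_le_trans yzr rr4).
move=> q qe; have yE : y = (y.1, y.2) by case: (y).
have qz : `|(q, y.2) - z| < r.
  have -> : (q, y.2) - z = ((q, y.2) - (y.1, y.2)) + (y - z) by rewrite -yE addrA subrK.
  apply: le_lt_trans (ler_normD _ _) _; have := norm_pair_sub y.1 q y.2; lra.
have qy : (q, y.2) - y = \sum_l (q - y.1) 0 l *: bx l by rewrite {2}yE rV_sub_bx.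
split.
  apply: le_trans (H1 y (q, y.2) _ (lt_le_trans yzr rr1) (lt_le_trans qz rr1) qy) _.
  by rewrite -nrm1_rowE ler_wpM2r ?sqr_ge0//; exact: le_trans Me.
apply: le_trans (H2 y (q, y.2) _ (lt_le_trans yzr rr2) (lt_le_trans qz rr2) qy) _.
by rewrite -nrm1_rowE ler_wpM2r ?nrm1_ge0//; exact: le_trans Me.
Unshelve. all: end_near. Qed.

End UniformRegularity.

(** * Curves in a level set *)

Section TangentCurves.
Context {R : realType}.
Implicit Types (p q tau : 'rV[R]_3).

Lemma is_derive_quadratic (f : R -> R) (w r K : R) : 0 < r ->
  (forall s, `|s| < r -> `|f s - f 0 - s * w| <= K * s ^+ 2) -> is_derive (0 : R) 1 f w.
Proof.
move=> r0 H.
have cl : h^-1 *: ((f \o shift 0) (h *: 1) - f 0) @[h --> (0 : R)^'] --> w.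
  apply/cvgrPdist_le => eps eps0.
  near=> h; have hN0 : h != 0 by near: h; exact: nbhs_dnbhs_neq.
  have hr : `|h| < r by near: h; apply: dnbhs0_lt.
  rewrite /= addr0 -[h *: 1]/(h * 1) mulr1 -[_ *: _]/(_ * _) distrC.
  have -> : h^-1 * (f h - f 0) - w = h^-1 * (f h - f 0 - h * w) by field.
  have h0 : 0 < `|h| by rewrite normr_gt0.
  have K1 : 0 < `|K| + 1 by rewrite ltr_wpDl.
  have he : `|h| < eps / (`|K| + 1) by near: h; apply: dnbhs0_lt; rewrite divr_gt0.
  rewrite normrM normfV -(ler_pM2l h0) mulrA divff ?gt_eqF// mul1r.
  apply: le_trans (H h hr) _; rewrite -(real_normK (num_real h)) expr2 mulrCA ler_pM2l//.
  apply: (@le_trans _ _ ((`|K| + 1) * `|h|)).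
    by rewrite ler_wpM2r// (le_trans (ler_norm K))// lerDl.
  by rewrite mulrC -ler_pdivlMr// ltW.
by split; [apply/cvg_ex; exists w|exact/cvg_lim].
Unshelve. all: end_near. Qed.

(** The curve is [p + s tau + u n] with [|u| <= K s^2].  As the derivative of
    [Phi] is zero along [tau] and not along [n], for large [K] the function
    [Phi] changes sign between the extreme values of [u], and the intermediate
    value theorem gives a zero. *)
Lemma level_set_curve (G0 U : set 'rV[R]_3) (Phi : 'rV[R]_3 -> R) p n tau :
  open U -> C2_on U Phi -> U p -> G0 p -> (forall y, U y -> G0 y <-> Phi y = 0) ->
  'D_n Phi p != 0 -> 'D_tau Phi p = 0 ->
  exists (gam : R -> 'rV[R]_3) (r K : R), [/\ 0 < r, 0 <= K &
    forall s, `|s| < r -> G0 (gam s) /\ nrm1 (gam s - p - s *: tau) <= K * s ^+ 2].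
Proof.
move=> oU [cP C1 C2] Up Gp GP nN0 tau0.
pose e (l : 'I_3) : 'rV[R]_3 := delta_mx 0 l.
have eE (u : 'rV[R]_3) : u = \sum_l u 0 l *: e l by exact: row_sum_delta.
have [r1 [C [r10 C0 HT]]] := locally_taylor (b := e) oU Up C1 (fun i => C2 (e i)).
have [r2 r20 r2U] := open_ball_norm oU Up.
(* Normalized so that the derivative of [Phi] in this direction is one. *)
pose n' := ('D_n Phi p)^-1 *: n.
have Dlin s u : \sum_l (s *: tau + u *: n') 0 l * 'D_(e l) Phi p = u.
  rewrite -(@derive_val _ _ _ _ _ _ _ (derive_sumv e _ oU Up C1)) -eE.
  have dtau := (C1 tau).1 p Up; have dn := (C1 n).1 p Up.
  have H1 := is_deriveZv s dtau; have H2 := is_deriveZv (u * ('D_n Phi p)^-1) dn.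
  rewrite /n' scalerA (@derive_val _ _ _ _ _ _ _ (is_deriveDv _ _ oU Up C1)).
  rewrite (@derive_val _ _ _ _ _ _ _ H1) (@derive_val _ _ _ _ _ _ _ H2) tau0.
  by field.
clearbody n'; have Phip : Phi p = 0 by apply/GP.
pose N := nrm1 n'; pose A := nrm1 tau.
have N0 : 0 <= N by exact: nrm1_ge0.
have A0 : 0 <= A by exact: nrm1_ge0.
(* Larger by one than the constant of the Taylor remainder, so that at
   [u = K s^2] the linear term [u] wins over the remainder. *)
pose K := C * (A + 1) ^+ 2 + 1.
have K0 : 0 < K by rewrite /K ltr_wpDl// mulr_ge0// sqr_ge0.
have nZ s (u : 'rV[R]_3) : nrm1 (s *: u) = `|s| * nrm1 u.
  by rewrite !nrm1_rowE mulr_sumr; apply: eq_bigr => l _; rewrite mxE normrM.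
pose r := Num.min (1 / (K * (N + 1))) (Num.min r1 r2 / (A + 1)).
have KN0 : 0 < K * (N + 1) by rewrite mulr_gt0// ltr_wpDl.
have A10 : 0 < A + 1 by rewrite ltr_wpDl.
have rgt0 : 0 < r by rewrite lt_min !divr_gt0// lt_min r10 r20.
have bnd s u : `|s| < r -> `|u| <= K * s ^+ 2 ->
   nrm1 (s *: tau + u *: n') <= `|s| * (A + 1) /\ `|s *: tau + u *: n'| < Num.min r1 r2.
  move=> sr uK; have b1 : nrm1 (s *: tau + u *: n') <= `|s| * (A + 1).
    apply: le_trans (nrm1D _ _) _; rewrite !nZ mulrDr mulr1 lerD2l.
    have s1 : `|s| * (K * (N + 1)) <= 1.
      by rewrite -ler_pdivlMr//; apply: ltW; apply: lt_le_trans sr _; rewrite ge_min lexx.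
    apply: (@le_trans _ _ (K * s ^+ 2 * N)); first by rewrite ler_wpM2r.
    have -> : K * s ^+ 2 * N = `|s| * (`|s| * (K * N)).
      by rewrite -(real_normK (num_real s)); ring.
    rewrite -[leRHS]mulr1 ler_wpM2l//; apply: le_trans s1.
    by rewrite ler_wpM2l// ler_pM2l// lerDl.
  split => //; apply: le_lt_trans (norm_le_nrm1 _) _; apply: le_lt_trans b1 _.
  by rewrite -ltr_pdivlMr//; apply: lt_le_trans sr _; rewrite ge_min lexx orbT.
have est s u : `|s| < r -> `|u| <= K * s ^+ 2 ->
   `|Phi (p + s *: tau + u *: n') - u| <= (K - 1) * s ^+ 2.
  move=> sr uK; have [b1 b2] := bnd s u sr uK.
  have qp : p + s *: tau + u *: n' - p = s *: tau + u *: n'.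
    by rewrite -[p + _ + _]addrA [X in X - _]addrC addrK.
  have p_lt : `|p - p| < r1 by rewrite subrr normr0.
  have q_lt : `|p + s *: tau + u *: n' - p| < r1.
    by rewrite qp; apply: lt_le_trans b2 _; rewrite ge_min lexx.
  have := HT p _ (fun l => (s *: tau + u *: n') 0 l) p_lt q_lt (etrans qp (eE _)).
  rewrite Dlin Phip subr0 => H.
  apply: le_trans H _; rewrite -nrm1_rowE.
  have -> : (K - 1) * s ^+ 2 = C * (`|s| * (A + 1)) ^+ 2.
    by rewrite exprMn real_normK ?num_real// /K; ring.
  by rewrite ler_wpM2l// ler_sqr ?nnegrE ?nrm1_ge0// mulr_ge0// ltW.
have root s : exists q, `|s| < r -> G0 q /\ nrm1 (q - p - s *: tau) <= (K * N) * s ^+ 2.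
  have [sr|sr] := ltP `|s| r; last by exists p.
  have Ks0 : 0 <= K * s ^+ 2 by rewrite mulr_ge0 ?sqr_ge0// ltW.
  pose f u := Phi (p + s *: tau + u *: n').
  have inU u : `|u| <= K * s ^+ 2 -> U (p + s *: tau + u *: n').
    move=> uK; have [_ b2] := bnd s u sr uK; apply: r2U.
    rewrite -[p + _ + _]addrA [p + _]addrC addrK; apply: lt_le_trans b2 _.
    by rewrite ge_min lexx orbT.
  have [|||u uI fu] := @IVT _ f (- (K * s ^+ 2)) (K * s ^+ 2) 0.
  - by rewrite -subr_ge0 opprK addr_ge0.
  - apply: derivable_within_continuous => u; rewrite in_itv/= -ler_norml => uK.
    have d := (C1 n').1 _ (inU u uK).
    by have [] := is_derive_line d.
  - have e1 : `|f (- (K * s ^+ 2)) - - (K * s ^+ 2)| <= (K - 1) * s ^+ 2.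
      by apply: est => //; rewrite normrN ger0_norm.
    have e2 : `|f (K * s ^+ 2) - K * s ^+ 2| <= (K - 1) * s ^+ 2.
      by apply: est => //; rewrite ger0_norm.
    have s20 := sqr_ge0 s.
    move: e1 e2; rewrite !ler_norml mulrBl mul1r => /andP[_ e1] /andP[e2 _].
    have f1 : f (- (K * s ^+ 2)) <= 0 by lra.
    have f2 : 0 <= f (K * s ^+ 2) by lra.
    by rewrite ge_min f1 le_max f2 orbT.
  have uK : `|u| <= K * s ^+ 2 by rewrite ler_norml; rewrite in_itv/= in uI.
  exists (p + s *: tau + u *: n') => _; split; first by apply/GP => //; exact: inU.
  have -> : p + s *: tau + u *: n' - p - s *: tau = u *: n'.
    by rewrite -[p + _ + _]addrA [p + _]addrC addrK [s *: tau + _]addrC addrK.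
  by rewrite nZ mulrAC ler_wpM2r.
have /choice[gam Hgam] := root.
by exists gam, r, (K * N); split => //; rewrite mulr_ge0// ltW.
Qed.

(** The curve is not known to be continuous away from [0], but its quadratic
    closeness to the tangent line makes it differentiable there. *)
Lemma level_set_tangent_curve (G0 U : set 'rV[R]_3) (Phi : 'rV[R]_3 -> R) p n tau :
  open U -> C2_on U Phi -> U p -> G0 p -> (forall y, U y -> G0 y <-> Phi y = 0) ->
  'D_n Phi p != 0 -> 'D_tau Phi p = 0 ->
  exists (gam : R -> 'rV[R]_3) (r K : R), [/\ 0 < r, 0 <= K, tangent_curve G0 p tau gam &
    forall s, `|s| < r -> G0 (gam s) /\ nrm1 (gam s - p - s *: tau) <= K * s ^+ 2].
Proof.
move=> oU C2 Up Gp GP nN0 tau0.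
have [gam [r [K [r0 K0 H]]]] := level_set_curve oU C2 Up Gp GP nN0 tau0.
have g0 : gam 0 = p.
  have z0 : `|0 : R| < r by rewrite normr0.
  have [_] := H 0 z0; rewrite scale0r subr0 expr0n/= mulr0 => H0.
  apply/rowP => l; apply/eqP; rewrite -subr_eq0 -normr_le0.
  exact: le_trans (entry_dist _ _ _ _) H0.
exists gam, r, K; split => //; split => //.
  have nr : \forall s \near (0 : R), `|s| < r by exact: nbhs0_lt.
  by apply: filterS nr => s sr; have [] := H s sr.
apply: is_derive_mx => i l; rewrite ord1.
apply: (@is_derive_quadratic _ _ r K) => // s sr; have [_ Hs] := H s sr.
by apply: le_trans Hs; rewrite g0; apply: le_trans (entry_le_nrm1 _ 0 l); rewrite !mxE.
Qed.

End TangentCurves.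

(** * Uniform non-degeneracy of the flow map *)

Section Nondegeneracy.
Context {R : realType}.
Local Notation V := ('rV[R]_3 * R)%type.
Implicit Types (p q tau : 'rV[R]_3).

(** The differential of [F] in the spatial direction [tau]. *)
Definition pushfwd (F : V -> 'rV[R]_3) (z : V) tau : 'rV[R]_3 :=
  \row_l \sum_m tau 0 m * 'D_(bx m) (fun y => F y 0 l) z.

Lemma nrm1Z n s (u : 'rV[R]_n) : nrm1 (s *: u) = `|s| * nrm1 u.
Proof. by rewrite !nrm1_rowE mulr_sumr; apply: eq_bigr => l _; rewrite mxE normrM. Qed.

Lemma cvg_bigsum (U : Type) (G : set_system U) {FG : Filter G} (I : finType) (f : I -> U -> R) (l : I -> R) :
  (forall i, f i @ G --> l i) -> (fun u => \sum_i f i u) @ G --> \sum_i l i.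
Proof.
move=> H; elim: (index_enum I) => [|i r IH].
  by rewrite big_nil; under eq_fun do rewrite big_nil; exact: cvg_cst.
by rewrite big_cons; under eq_fun do rewrite big_cons; exact: cvgD.
Qed.

(** Chain rule at [0] along a curve that is only known to be quadratically
    close to its tangent line. *)
Lemma is_derive_pushfwd (G0 : set 'rV[R]_3) (F : V -> 'rV[R]_3) (f : R -> 'rV[R]_3)
    p t tau gam (r K : R) :
  0 < r -> 0 <= K -> gam 0 = p ->
  (forall s, `|s| < r -> G0 (gam s) /\ nrm1 (gam s - p - s *: tau) <= K * s ^+ 2) ->
  (forall s, `|s| < r -> f s = F (gam s, t)) ->
  (exists2 e : R, 0 < e & forall l q, nrm1 (q - p) <= e ->
     `|F (q, t) 0 l - F (p, t) 0 l - \sum_m (q - p) 0 m * 'D_(bx m) (fun y => F y 0 l) (p, t)|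
       <= e^-1 * nrm1 (q - p) ^+ 2) ->
  is_derive (0 : R) 1 f (pushfwd F (p, t) tau).
Proof.
move=> r0 K0 g0 Hg fE [e e0 HT]; apply: is_derive_mx => i l; rewrite ord1 mxE.
pose D m := 'D_(bx m) (fun y => F y 0 l) (p, t).
pose A := nrm1 tau + K; pose B := \sum_m `|D m|.
have A0 : 0 <= A by rewrite addr_ge0 ?nrm1_ge0.
have B0 : 0 <= B by apply: sumr_ge0.
have A10 : 0 < A + 1 by rewrite ltr_wpDl.
pose r' := Num.min r (Num.min 1 (e / (A + 1))).
have r'0 : 0 < r' by rewrite !lt_min r0 ltr01 divr_gt0.
apply: (@is_derive_quadratic _ _ _ r' (e^-1 * A ^+ 2 + B * K)) => // s sr'.
have sr : `|s| < r by apply: lt_le_trans sr' _; rewrite ge_min lexx.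
have s1 : `|s| <= 1 by apply: ltW; apply: lt_le_trans sr' _; rewrite !ge_min lexx orbT.
have se : `|s| < e / (A + 1) by apply: lt_le_trans sr' _; rewrite !ge_min lexx !orbT.
have [_ Hs] := Hg s sr; rewrite (fE s sr) (fE 0) ?normr0// g0.
have gp : nrm1 (gam s - p) <= A * `|s|.
  rewrite -[gam s - p](subrK (s *: tau)); apply: le_trans (nrm1D _ _) _.
  rewrite nrm1Z /A mulrDl addrC mulrC lerD2l; apply: le_trans Hs _.
  by rewrite ler_wpM2l// -(real_normK (num_real s)) expr2 ler_piMr.
have gpe : nrm1 (gam s - p) <= e.
  apply: le_trans gp _; apply: (@le_trans _ _ ((A + 1) * `|s|)).
    by rewrite ler_wpM2r// lerDl.
  by rewrite mulrC -ler_pdivlMr// ltW.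
have E : F (gam s, t) 0 l - F (p, t) 0 l - s * (\sum_m tau 0 m * D m) =
   (F (gam s, t) 0 l - F (p, t) 0 l - \sum_m (gam s - p) 0 m * D m)
   + \sum_m (gam s - p - s *: tau) 0 m * D m.
  have -> : \sum_m (gam s - p - s *: tau) 0 m * D m =
      \sum_m (gam s - p) 0 m * D m - s * (\sum_m tau 0 m * D m).
    by rewrite [s * _]mulr_sumr -sumrB; apply: eq_bigr => m _; rewrite !mxE; ring.
  by ring.
rewrite E; apply: le_trans (ler_normD _ _) _; rewrite mulrDl; apply: lerD.
  apply: le_trans (HT l _ gpe) _; rewrite -mulrA ler_wpM2l ?invr_ge0 ?(ltW e0)//.
  by rewrite -(real_normK (num_real s)) -exprMn ler_sqr ?nnegrE ?nrm1_ge0 ?mulr_ge0.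
apply: le_trans (ler_norm_sum _ _ _) _; rewrite -mulrA /B mulr_suml; apply: ler_sum => m _.
rewrite normrM mulrC ler_wpM2l//; apply: le_trans Hs; exact: entry_le_nrm1.
Qed.

Lemma sphere_compact : compact [set tau : 'rV[R]_3 | nrm1 tau = 1].
Proof.
have cn : continuous (fun tau : 'rV[R]_3 => nrm1 tau).
  under eq_fun do rewrite nrm1_rowE; apply: continuous_sumr => l _ tau.
  have cl : (fun M : 'rV[R]_3 => M 0 l) @ tau --> tau 0 l by exact: coord_continuous.
  exact: cvg_norm cl.
apply: bounded_closed_compact.
  exists 1; split => // M M1 tau /= t1; apply: le_trans (norm_le_nrm1 _) _.
  by rewrite t1 ltW.
apply: (@preimage_closed _ _ (fun tau : 'rV[R]_3 => nrm1 tau) [set 1]); last exact: closed_eq.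
by move=> tau _; exact: cn.
Qed.

Lemma cvg_snd_coord (W : normedModType R) (x : W) tau m :
  (fun y : (W * 'rV[R]_3)%type => y.2 0 m) @ (x, tau) --> tau 0 m.
Proof.
have c : {for (x, tau), continuous (fun y : (W * 'rV[R]_3)%type => y.2 0 m)}.
  apply: (@continuous_comp _ _ _ snd (fun M : 'rV[R]_3 => M 0 m)); first exact: cvg_snd.
  exact: coord_continuous.
exact: c.
Qed.

Lemma cvg_fst_comp (W W' : normedModType R) (h : W -> R) (x : W) (y : W') :
  {for x, continuous h} -> (fun z : (W * W')%type => h z.1) @ (x, y) --> h x.
Proof.
move=> ch; have c : {for (x, y), continuous (fun z : (W * W')%type => h z.1)}.
  by apply: (@continuous_comp _ _ _ fst h); first exact: cvg_fst.
exact: c.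
Qed.

(** By compactness it suffices to argue near one point and one direction.  If
    [tau] is tangent to the surface, a curve in the surface shows that the
    differential of the flow does not vanish on [tau], nor on nearby
    directions.  Otherwise the gradient [lam] of a local defining function is not
    orthogonal to [tau], while it is orthogonal to the surface up to second
    order. *)
Lemma uniform_nondegenerate (G0 : set 'rV[R]_3) (T : R) (X : 'rV[R]_3 -> R -> 'rV[R]_3)
    (U : set V) (F : V -> 'rV[R]_3) :
  smooth_closed_surface G0 -> Defs.nondegenerate G0 T X ->
  open U -> (forall l, C2_on U (fun y => F y 0 l)) ->
  (forall p t, G0 p -> 0 <= t <= T -> U (p, t) /\ F (p, t) = X p t) ->
  exists2 e0 : R, 0 < e0 & forall e, 0 < e <= e0 -> forall p t, G0 p -> 0 <= t <= T ->
    forall tau, nrm1 tau = 1 ->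
      e <= nrm1 (pushfwd F (p, t) tau) \/
      exists lam : 'rV[R]_3, e <= `|dot lam tau| /\
        forall q, G0 q -> nrm1 (q - p) <= e -> `|dot lam (q - p)| <= e^-1 * nrm1 (q - p) ^+ 2.
Proof.
move=> [cG HG] nd oU CF FX.
pose K : set (V * 'rV[R]_3)%type := (G0 `*` [set` `[0, T]]) `*` [set tau | nrm1 tau = 1].
have cK : compact K.
  apply: compact_setX; last exact: sphere_compact.
  by apply: compact_setX => //; exact: segment_compact.
pose P (e : R) (x : (V * 'rV[R]_3)%type) := G0 x.1.1 -> e <= nrm1 (pushfwd F x.1 x.2) \/
      exists lam : 'rV[R]_3, e <= `|dot lam x.2| /\
        forall q, G0 q -> nrm1 (q - x.1.1) <= e -> `|dot lam (q - x.1.1)| <= e^-1 * nrm1 (q - x.1.1) ^+ 2.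
have [|e0 e00 He] := @compact_uniform _ _ K P cK; last first.
  exists e0 => // e ee0 p t Gp tT tau t1.
  have Kx : K ((p, t), tau).
    by apply: (conj (conj Gp _) t1); rewrite /= in_itv.
  exact: (He e ee0 ((p, t), tau) Kx Gp).
move=> [[p t] tau] [/= [/= Gp]]; rewrite in_itv/= => tT t1.
have [Upt _] := FX p t Gp tT.
have [W [Phi [oW Wp CPhi GPhi HPhi]]] := HG p Gp.
have [n nN0] := HPhi p Wp Gp.
have C2Phi : C2_on W Phi by apply: class_C2_scalar; exact: CPhi.
have [_ C1P C2P] := C2Phi.
pose e' (l : 'I_3) : 'rV[R]_3 := delta_mx 0 l.
pose lam q : 'rV[R]_3 := \row_l 'D_(e' l) Phi q.
have lamE q u : W q -> dot (lam q) u = 'D_u Phi q.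
  move=> Wq; rewrite {2}[u]row_sum_delta (@derive_val _ _ _ _ _ _ _ (derive_sumv e' _ oW Wq C1P)).
  by apply: eq_bigr => l _; rewrite mxE mulrC.
(* [lam] is the gradient of the local defining function. *)
have [tau0|tauN0] := eqVneq (dot (lam p) tau) 0.
  have Dtau : 'D_tau Phi p = 0 by rewrite -lamE.
  have [gam [r [Kc [r0 Kc0 tc Hg]]]] := level_set_tangent_curve oW C2Phi Wp Gp GPhi nN0 Dtau.
  have [_ imm] := nd t tT.
  have g0 : gam 0 = p by case: tc.
  have [e1 e10 He1] : exists2 e1 : R, 0 < e1 & forall l q, nrm1 (q - p) <= e1 ->
     `|F (q, t) 0 l - F (p, t) 0 l - \sum_m (q - p) 0 m * 'D_(bx m) (fun y => F y 0 l) (p, t)|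
       <= e1^-1 * nrm1 (q - p) ^+ 2.
    have [e1 e10 H1] := uniform_small (fun l => uniform_C2 oU cG (CF l) (fun p t Gp tT => (FX p t Gp tT).1)).
    have ee1 : 0 < e1 <= e1 by rewrite e10 lexx.
    by exists e1 => // l q qe; have [_ _ _ /(_ q qe)[]] := H1 e1 ee1 l p t Gp tT.
  have dF : is_derive (0 : R) 1 (fun s => X (gam s) t) (pushfwd F (p, t) tau).
    apply: (is_derive_pushfwd r0 Kc0 g0 Hg); last by exists e1.
    by move=> s sr; have [Gs _] := Hg s sr; have [_ ->] := FX (gam s) t Gs tT.
  have tauN : tau != 0.
    apply/eqP => t0; have /eqP := t1; rewrite t0 nrm1_rowE big1.
      by rewrite eq_sym oner_eq0.
    by move=> l _; rewrite mxE normr0.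
  have wN0 := imm p tau gam _ Gp tc dF tauN.
  have w0 : 0 < nrm1 (pushfwd F (p, t) tau).
    rewrite lt_neqAle nrm1_ge0 andbT eq_sym; apply: contra_neq wN0 => w0.
    apply/rowP => l; apply/eqP; rewrite [X in _ == X]mxE -normr_le0 -w0.
    exact: entry_le_nrm1.
  exists (nrm1 (pushfwd F (p, t) tau) / 2); first by rewrite divr_gt0.
  have cpush : (fun x : (V * 'rV[R]_3)%type => nrm1 (pushfwd F x.1 x.2)) @ ((p, t), tau) -->
      nrm1 (pushfwd F (p, t) tau).
    under eq_fun do rewrite nrm1_rowE; rewrite nrm1_rowE; apply: cvg_bigsum => l.
    apply: cvg_norm; under eq_fun do rewrite mxE; rewrite mxE; apply: cvg_bigsum => m.
    apply: cvgM; first exact: cvg_snd_coord.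
    have [_ C1 _] := CF l; have [_ cD] := C1 (bx m).
    exact: (cvg_fst_comp _ (cD (p, t) Upt)).
  have half : nrm1 (pushfwd F (p, t) tau) / 2 < nrm1 (pushfwd F (p, t) tau) by lra.
  have n0 := cvgr_gt _ cpush _ half.
  near=> x; move=> e /andP[e0 ee] _; left; apply: le_trans ee _; apply: ltW.
  near: x; exact: n0.
have [r1 [C [r10 C0 HT]]] := locally_taylor (b := e') oW Wp C1P (fun i => C2P (e' i)).
have [r2 r20 r2W] := open_ball_norm oW Wp.
have d0 : 0 < `|dot (lam p) tau| by rewrite normr_gt0.
pose r := Num.min r1 r2; have r0 : 0 < r by rewrite lt_min r10 r20.
have C10 : 0 < C + 1 by rewrite ltr_wpDl.
exists (Num.min (`|dot (lam p) tau| / 2) (Num.min (r / 2) (C + 1)^-1)).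
  by rewrite !lt_min !divr_gt0//= invr_gt0.
have cdot : (fun x : (V * 'rV[R]_3)%type => `|dot (lam x.1.1) x.2|) @ ((p, t), tau) --> `|dot (lam p) tau|.
  apply: cvg_norm; apply: cvg_bigsum => l.
  apply: cvgM; last exact: cvg_snd_coord.
  under eq_fun do rewrite mxE; rewrite mxE.
  have [_ cD] := C1P (e' l).
  have c1 : {for (p, t), continuous (fun z : V => 'D_(e' l) Phi z.1)} := cvg_fst_comp t (cD p Wp).
  exact: (cvg_fst_comp _ c1).
have half : `|dot (lam p) tau| / 2 < `|dot (lam p) tau| by lra.
have n1 := cvgr_gt _ cdot _ half.
have n2 : \forall x \near ((p, t), tau), `|(x : (V * 'rV[R]_3)%type).1.1 - p| < r / 2.
  have r20' : 0 < r / 2 by rewrite divr_gt0.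
  apply/nbhs_ballP; exists (r / 2) => // x [[+ _] _].
  by rewrite -ball_normE/= distrC.
near=> x; move=> e /andP[e0]; rewrite !le_min => /and3P[e1 e2 e3] Gx; right.
have x1 : `|dot (lam p) tau| / 2 < `|dot (lam x.1.1) x.2| by near: x; exact: n1.
have x2 : `|x.1.1 - p| < r / 2 by near: x; exact: n2.
have rr1 : r <= r1 by rewrite ge_min lexx.
have rr2 : r <= r2 by rewrite ge_min lexx orbT.
exists (lam x.1.1); split; first by apply: le_trans e1 _; exact: ltW.
move=> q Gq qe.
have px : `|x.1.1 - p| < r by apply: lt_le_trans x2 _; lra.
have qp : `|q - p| < r.
  rewrite -[q - p](subrKA x.1.1); apply: le_lt_trans (ler_normD _ _) _.
  have := norm_le_nrm1 (q - x.1.1); lra.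
have Wx : W x.1.1 by apply: r2W; exact: lt_le_trans rr2.
have Wq : W q by apply: r2W; exact: lt_le_trans rr2.
have := HT x.1.1 q (fun l => (q - x.1.1) 0 l) (lt_le_trans px rr1) (lt_le_trans qp rr1) (row_sum_delta _).
have -> : Phi q = 0 by apply/GPhi.
have -> : Phi x.1.1 = 0 by apply/GPhi.
rewrite subrr sub0r normrN -nrm1_rowE => H.
have -> : dot (lam x.1.1) (q - x.1.1) = \sum_l (q - x.1.1) 0 l * 'D_(e' l) Phi x.1.1.
  by apply: eq_bigr => l _; rewrite [lam _ _ _]mxE mulrC.
apply: le_trans H _; rewrite ler_wpM2r ?sqr_ge0//.
have : C + 1 <= e^-1 by rewrite -(invrK (C + 1)) lef_pV2// posrE invr_gt0.
by lra.
Unshelve. all: end_near. Qed.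

End Nondegeneracy.

(** * Geometry of the exact nodal surfaces *)

Section ExactNodes.
Context {R : realType} (k : nat).
Local Notation V := ('rV[R]_3 * R)%type.
Local Notation Tri := (@ref_triangle R).
Implicit Types (p q tau : 'rV[R]_3).

Lemma lattice_inhabited : exists a : lattice k, true.
Proof.
case: (pickP (fun _ : lattice k => true)) => [a _|none]; first by exists a.
have := @sum_lagrange R k (0, 0); rewrite big1 => [|a]; last by have := none a.
by move/eqP; rewrite eq_sym oner_eq0.
Qed.

(** The data of the flow map that enter the estimates on one element: bounds, a
    Taylor expansion in space, and the alternative of [uniform_nondegenerate]. *)
Definition flow_bounds (G0 : set 'rV[R]_3) (T : R) (F : V -> 'rV[R]_3) (eps : R) :=
  0 < eps /\ forall p t, G0 p -> 0 <= t <= T ->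
    [/\ forall l, [/\ `|F (p, t) 0 l| <= eps^-1, forall m, `|'D_(bx m) (fun y => F y 0 l) (p, t)| <= eps^-1 &
           `|'D_bt (fun y => F y 0 l) (p, t)| <= eps^-1 ],
        forall l q, nrm1 (q - p) <= eps ->
        `|F (q, t) 0 l - F (p, t) 0 l - \sum_m (q - p) 0 m * 'D_(bx m) (fun y => F y 0 l) (p, t)|
            <= eps^-1 * nrm1 (q - p) ^+ 2 /\
        `|'D_bt (fun y => F y 0 l) (q, t) - 'D_bt (fun y => F y 0 l) (p, t)| <= eps^-1 * nrm1 (q - p) &
        forall tau, nrm1 tau = 1 ->
          eps <= nrm1 (pushfwd F (p, t) tau) \/
          exists lam : 'rV[R]_3, eps <= `|dot lam tau| /\
            forall q, G0 q -> nrm1 (q - p) <= eps -> `|dot lam (q - p)| <= eps^-1 * nrm1 (q - p) ^+ 2].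

Lemma flow_bounds_exist (G0 : set 'rV[R]_3) (T : R) (X : 'rV[R]_3 -> R -> 'rV[R]_3)
    (U : set V) (F : V -> 'rV[R]_3) :
  smooth_closed_surface G0 -> Defs.nondegenerate G0 T X ->
  open U -> class_C 2 U F ->
  (forall p t, G0 p -> 0 <= t <= T -> U (p, t) /\ F (p, t) = X p t) ->
  exists eps, flow_bounds G0 T F eps.
Proof.
move=> sG nd oU CF FX; have CFl l : C2_on U (fun y => F y 0 l) by exact: class_C2_coord.
have cG : compact G0 by case: sG.
have [e1 e10 H1] := uniform_nondegenerate sG nd oU CFl FX.
have [e2 e20 H2] := uniform_small (fun l => uniform_C2 oU cG (CFl l) (fun p t Gp tT => (FX p t Gp tT).1)).
exists (Num.min e1 e2); split=> [|p t Gp tT]; first by rewrite lt_min e10.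
have e0 : 0 < Num.min e1 e2 by rewrite lt_min e10.
have le1 : 0 < Num.min e1 e2 <= e1 by rewrite e0 ge_min lexx.
have le2 : 0 < Num.min e1 e2 <= e2 by rewrite e0 ge_min lexx orbT.
split.
- by move=> l; have [h1 h2 h3 _] := H2 _ le2 l p t Gp tT.
- by move=> l; have [_ _ _] := H2 _ le2 l p t Gp tT.
- exact: H1.
Qed.

Lemma pushfwdZ (F : V -> 'rV[R]_3) z a tau : pushfwd F z (a *: tau) = a *: pushfwd F z tau.
Proof.
by apply/rowP => l; rewrite !mxE mulr_sumr; apply: eq_bigr => m _; rewrite mxE mulrA.
Qed.

Lemma nrm1_eq0 n (u : 'rV[R]_n) : nrm1 u = 0 -> u = 0.
Proof.
move=> u0; apply/rowP => l; apply/eqP; rewrite [X in _ == X]mxE -normr_le0 -u0.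
exact: entry_le_nrm1.
Qed.

Lemma nrm1_frob2_row n (u : 'rV[R]_n) : nrm1 u ^+ 2 <= n%:R * frob2 u.
Proof. by have := nrm1_sqr_le u; rewrite mul1n. Qed.

Lemma nrm1_row_le m n (A : 'M[R]_(m, n)) i : nrm1 (row i A) <= nrm1 A.
Proof.
have -> : nrm1 (row i A) = \sum_j `|A i j|.
  by rewrite nrm1_rowE; apply: eq_bigr => j _; rewrite mxE.
by rewrite [leRHS]/nrm1 (bigD1 i)//= lerDl sumr_ge0// => j _; exact: sumr_ge0.
Qed.

Lemma immersive_algebra (Y E B S P : R) :
  2^-1 * Y <= E -> B <= Y -> P <= S + 4^-1 * B -> E <= P -> 4^-1 * Y <= S.
Proof. by move=> *; lra. Qed.

Lemma half_not_le (Y B : R) : 0 < Y -> 12 * B <= Y -> Y / 2 <= B -> False.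
Proof. by move=> *; lra. Qed.

Section OneElement.
Variables (G0 : set 'rV[R]_3) (T : R) (F : V -> 'rV[R]_3) (eps CL : R).
Hypothesis (fb : flow_bounds G0 T F eps).
Hypothesis CL0 : 0 < CL.
Hypothesis HCL : forall (a : lattice k) (xi : (R * R)%type), Tri xi ->
  `|lagrange a xi| <= CL /\ forall r, `|ref_grad (lagrange a : _ -> R) xi r| <= CL.
Variables (tr : triangulation R k) (e : 'I_(nb_elts tr)) (h : R).
Hypothesis h0 : 0 < h.
Hypothesis nG : forall j, G0 (row j (init_node tr)).
Hypothesis nh : forall a b, nrm1 (row (local_node e a) (init_node tr) - row (local_node e b) (init_node tr)) <= 3 * h.
Hypothesis h_eps : 3 * h <= eps.
Variables (t : R).
Hypothesis tT : 0 <= t <= T.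

Let N : R := #|{: lattice k}|%:R.
Let xs : nodal tr := \matrix_(j, l) F (row j (init_node tr), t) 0 l.
Let vs : nodal tr := \matrix_(j, l) 'D_bt (fun y => F y 0 l) (row j (init_node tr), t).
Let J0 xi := jac (init_node tr) e xi.

Let sum_lattice_le (f : lattice k -> R) B : (forall a, `|f a| <= B) -> `|\sum_a f a| <= N * B.
Proof.
move=> fB; apply: le_trans (ler_norm_sum _ _ _) _.
by rewrite /N mulr_natl -sumr_const; apply: ler_sum => a _.
Qed.

(** The Jacobian of the nodal interpolation of the velocity only sees
    differences of nodal velocities, which are of order [h]. *)
Lemma velocity_bounds xi : Tri xi ->
  nrm1 (jac vs e xi) <= 18 * N * CL * eps^-1 * h /\ nrm1 (elt_map vs e xi) <= 3 * N * CL * eps^-1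
  /\ nrm1 (elt_map xs e xi) <= 3 * N * CL * eps^-1.
Proof.
move=> Txi; have [eps0 Hfb] := fb; have [a0 _] := lattice_inhabited.
have ei0 : 0 <= eps^-1 by rewrite invr_ge0 ltW.
set p := row (local_node e a0) (init_node tr).
have [_ Hp _] := Hfb p t (nG _) tT.
split; last split.
- have J r l : `|jac vs e xi r l| <= N * (eps^-1 * (3 * h) * CL).
    rewrite (jac_nodes vs e xi (row (local_node e a0) vs)); apply: sum_lattice_le => a.
    rewrite normrM; apply: ler_pM => //; last by have [_] := HCL a Txi; apply.
    rewrite !mxE; set q := row (local_node e a) (init_node tr).
    have [|_ H] := Hp l q; first by apply: le_trans h_eps; exact: nh.
    by apply: le_trans H _; rewrite ler_wpM2l//; exact: nh.
  have -> : 18 * N * CL * eps^-1 * h = 2 * (3 * (N * (eps^-1 * (3 * h) * CL))) by ring.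
  rewrite /nrm1 sum_ord2 !sum_ord3 mulr_natl mulr2n; apply: lerD;
   rewrite mulr_natl mulrS mulr2n addrA !lerD//.
- rewrite nrm1_row3; have J l : `|elt_map vs e xi 0 l| <= N * (CL * eps^-1).
    rewrite elt_mapE; apply: sum_lattice_le => a; rewrite normrM; apply: ler_pM => //.
      by have [] := HCL a Txi.
    by rewrite mxE; have [/(_ l)[]] := Hfb _ t (nG (local_node e a)) tT.
  have -> : 3 * N * CL * eps^-1 = N * (CL * eps^-1) + N * (CL * eps^-1) + N * (CL * eps^-1) by ring.
  by rewrite !lerD.
rewrite nrm1_row3; have J l : `|elt_map xs e xi 0 l| <= N * (CL * eps^-1).
  rewrite elt_mapE; apply: sum_lattice_le => a; rewrite normrM; apply: ler_pM => //.
    by have [] := HCL a Txi.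
  by rewrite mxE; have [/(_ l)[]] := Hfb _ t (nG (local_node e a)) tT.
have -> : 3 * N * CL * eps^-1 = N * (CL * eps^-1) + N * (CL * eps^-1) + N * (CL * eps^-1) by ring.
by rewrite !lerD.
Qed.

(** Taylor expansion around one node: up to [O(h^2)], the Jacobian of the
    transported element is the differential of the flow applied to the initial
    Jacobian. *)
Lemma jac_expansion a0 xi r l : Tri xi ->
  `|jac xs e xi r l - pushfwd F (row (local_node e a0) (init_node tr), t) (row r (J0 xi)) 0 l|
    <= 9 * N * CL * eps^-1 * h ^+ 2.
Proof.
move=> Txi; have [eps0 Hfb] := fb.
have ei0 : 0 <= eps^-1 by rewrite invr_ge0 ltW.
set p := row (local_node e a0) (init_node tr).
have [_ Hp _] := Hfb p t (nG _) tT.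
pose D m := 'D_(bx m) (fun y => F y 0 l) (p, t).
have -> : jac xs e xi r l - pushfwd F (p, t) (row r (J0 xi)) 0 l =
    \sum_a (F (row (local_node e a) (init_node tr), t) 0 l - F (p, t) 0 l
      - \sum_m (row (local_node e a) (init_node tr) - p) 0 m * D m) * ref_grad (lagrange a) xi r.
  under [RHS]eq_bigr do rewrite mulrBl; rewrite sumrB; congr (_ - _).
    rewrite (jac_nodes xs e xi (row (local_node e a0) xs)); apply: eq_bigr => a _.
    by congr (_ * _); rewrite !mxE.
  rewrite mxE; under [RHS]eq_bigr do rewrite mulr_suml.
  rewrite exchange_big/=; apply: eq_bigr => m _.
  rewrite mxE /J0 (jac_nodes (init_node tr) e xi p) mulr_suml; apply: eq_bigr => a _.
  by rewrite -/(D m); ring.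
have -> : 9 * N * CL * eps^-1 * h ^+ 2 = N * (eps^-1 * (3 * h) ^+ 2 * CL) by ring.
apply: sum_lattice_le => a; rewrite normrM; apply: ler_pM => //; last by have [_] := HCL a Txi; apply.
set q := row (local_node e a) (init_node tr).
have [|H _] := Hp l q; first by apply: le_trans h_eps; exact: nh.
apply: le_trans H _; rewrite ler_wpM2l// ler_sqr ?nnegrE ?nrm1_ge0 ?mulr_ge0 ?(ltW h0)//.
exact: nh.
Qed.

Lemma initial_jac_le xi : Tri xi -> nrm1 (J0 xi) <= 18 * N * CL * h.
Proof.
move=> Txi; have [a0 _] := lattice_inhabited.
have J r l : `|J0 xi r l| <= N * (3 * h * CL).
  rewrite /J0 (jac_nodes _ e xi (row (local_node e a0) (init_node tr))); apply: sum_lattice_le => a.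
  rewrite normrM; apply: ler_pM => //; last by have [_] := HCL a Txi; apply.
  by apply: le_trans (nh a a0); exact: entry_le_nrm1.
have -> : 18 * N * CL * h = 2 * (3 * (N * (3 * h * CL))) by ring.
rewrite /nrm1 sum_ord2 !sum_ord3 mulr_natl mulr2n; apply: lerD;
  rewrite mulr_natl mulrS mulr2n addrA !lerD//.
Qed.

Lemma pushfwd_le p tau l : G0 p -> `|pushfwd F (p, t) tau 0 l| <= eps^-1 * nrm1 tau.
Proof.
move=> Gp; have [eps0 Hfb] := fb; have [/(_ l)[_ H _] _ _] := Hfb p t Gp tT.
rewrite mxE; apply: le_trans (ler_norm_sum _ _ _) _; rewrite nrm1_rowE mulr_sumr.
by apply: ler_sum => m _; rewrite normrM mulrC ler_wpM2r.
Qed.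

Lemma transported_jac_le xi : Tri xi ->
  nrm1 (jac xs e xi) <= 6 * (eps^-1 * (18 * N * CL) + 9 * N * CL * eps^-1 * eps) * h.
Proof.
move=> Txi; have [eps0 Hfb] := fb; have [a0 _] := lattice_inhabited.
have ei0 : 0 <= eps^-1 by rewrite invr_ge0 ltW.
have N0 : 0 <= N by exact: ler0n.
have J r l : `|jac xs e xi r l| <= (eps^-1 * (18 * N * CL) + 9 * N * CL * eps^-1 * eps) * h.
  have E := jac_expansion a0 r l Txi; set p := row (local_node e a0) (init_node tr) in E.
  rewrite -[jac xs e xi r l](subrK (pushfwd F (p, t) (row r (J0 xi)) 0 l)).
  apply: le_trans (ler_normD _ _) _; rewrite mulrDl addrC; apply: lerD.
    apply: le_trans (pushfwd_le _ _ (nG _)) _; rewrite -mulrA ler_wpM2l//.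
    by apply: le_trans (initial_jac_le Txi); exact: nrm1_row_le.
  apply: le_trans E _; rewrite expr2 mulrA; apply: ler_wpM2r; first exact: ltW.
  rewrite ler_wpM2l//; first by nonneg.
  by apply: le_trans h_eps; rewrite ler_peMl ?ler1n// ltW.
have -> : 6 * (eps^-1 * (18 * N * CL) + 9 * N * CL * eps^-1 * eps) * h =
  2 * (3 * ((eps^-1 * (18 * N * CL) + 9 * N * CL * eps^-1 * eps) * h)) by ring.
rewrite /nrm1 sum_ord2 !sum_ord3 mulr_natl mulr2n; apply: lerD;
  rewrite mulr_natl mulrS mulr2n addrA !lerD//.
Qed.

Lemma mulmx_row2 (w : 'rV[R]_2) (J : 'M[R]_(2, 3)) l :
  (w *m J) 0 l = w 0 0 * J 0 l + w 0 1 * J 1 l.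
Proof. by rewrite mxE sum_ord2. Qed.

Lemma pushfwd_mulmx z (w : 'rV[R]_2) (J : 'M[R]_(2, 3)) l :
  pushfwd F z (w *m J) 0 l = w 0 0 * pushfwd F z (row 0 J) 0 l + w 0 1 * pushfwd F z (row 1 J) 0 l.
Proof.
rewrite !mxE !mulr_sumr -big_split/=; apply: eq_bigr => m _.
by rewrite mulmx_row2 !(mxE, mulrA) mulrDl.
Qed.

(** The Jacobian is a combination of differences of nodes, all of which lie on
    the surface, so a local defining function vanishes at all of them. *)
Lemma nearly_tangent lam a0 (w : 'rV[R]_2) xi : Tri xi ->
  (forall q, G0 q -> nrm1 (q - row (local_node e a0) (init_node tr)) <= eps ->
     `|dot lam (q - row (local_node e a0) (init_node tr))|
       <= eps^-1 * nrm1 (q - row (local_node e a0) (init_node tr)) ^+ 2) ->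
  `|dot lam (w *m J0 xi)| <= nrm1 w * (9 * N * CL * eps^-1 * h ^+ 2).
Proof.
move=> Txi; set p := row (local_node e a0) (init_node tr) => Hlam.
have [eps0 _] := fb; have ei0 : 0 <= eps^-1 by rewrite invr_ge0 ltW.
have D r : `|\sum_l lam 0 l * J0 xi r l| <= 9 * N * CL * eps^-1 * h ^+ 2.
  have -> : \sum_l lam 0 l * J0 xi r l =
      \sum_a dot lam (row (local_node e a) (init_node tr) - p) * ref_grad (lagrange a) xi r.
    under [RHS]eq_bigr do rewrite mulr_suml; rewrite exchange_big/=; apply: eq_bigr => l _.
    by rewrite /J0 (jac_nodes _ e xi p) mulr_sumr; apply: eq_bigr => a _; rewrite mulrA.
  have -> : 9 * N * CL * eps^-1 * h ^+ 2 = N * (eps^-1 * (3 * h) ^+ 2 * CL) by ring.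
  apply: sum_lattice_le => a; rewrite normrM; apply: ler_pM => //; last by have [_] := HCL a Txi; apply.
  apply: le_trans (Hlam _ (nG _) (le_trans (nh _ _) h_eps)) _.
  rewrite ler_wpM2l// ler_sqr ?nnegrE ?nrm1_ge0 ?mulr_ge0 ?(ltW h0)//.
  exact: nh.
have -> : dot lam (w *m J0 xi) = w 0 0 * (\sum_l lam 0 l * J0 xi 0 l) + w 0 1 * (\sum_l lam 0 l * J0 xi 1 l).
  rewrite !mulr_sumr -big_split; apply: eq_bigr => l _ /=.
  by rewrite mulmx_row2; ring.
apply: le_trans (ler_normD _ _) _; rewrite !normrM nrm1_rowE sum_ord2 mulrDl.
by apply: lerD; rewrite ler_wpM2l.
Qed.

(** The image [w J0] of a vector under the initial Jacobian is bounded below and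
    nearly tangent.  For small [h] the second alternative of
    [uniform_nondegenerate] is excluded, so the differential of the flow does not
    shrink [w J0] by more than [eps], and [jac_expansion] carries this over to
    the transported element. *)
Lemma transported_immersive c xi : Tri xi -> 0 < c ->
  (forall w : 'rV[R]_2, c * h * enorm w <= enorm (w *m J0 xi)) ->
  108 * N * CL * eps^-1 * h <= eps * c ->
  immersive ((eps * c) ^+ 2 / 48 * h ^+ 2) (jac xs e xi).
Proof.
move=> Txi c0 HJ hs w; have [eps0 Hfb] := fb; have [a0 _] := lattice_inhabited.
set W := nrm1 w; set p := row (local_node e a0) (init_node tr).
have W0 : 0 <= W by exact: nrm1_ge0.
set tau := w *m J0 xi; set B := 9 * N * CL * eps^-1 * h.
have Bh : 9 * N * CL * eps^-1 * h ^+ 2 = B * h by rewrite /B; ring.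
have hB : 12 * B <= eps * c by apply: le_trans hs; rewrite /B le_eqVlt; apply/orP; left; apply/eqP; ring.
clearbody B.
have ec0 : 0 < eps * c by rewrite mulr_gt0.
have tauW : c * h * W / 2 <= nrm1 tau.
  apply: le_trans (enorm_le_nrm1 _); apply: le_trans (HJ w).
  rewrite -mulrA ler_wpM2l ?mulr_ge0 ?(ltW h0) ?(ltW c0)//.
  by rewrite ler_pdivrMr// mulrC; exact: nrm1_le_enorm.
have [W00|WN0] := eqVneq W 0.
  have -> : w = 0 by exact: nrm1_eq0.
  have -> : frob2 (0 : 'rV[R]_2) = 0 by rewrite frob2_row2 !mxE expr0n/= addr0.
  by rewrite mulr0 frob2_ge0.
have Wgt0 : 0 < W by rewrite lt_neqAle eq_sym WN0.
have tgt0 : 0 < nrm1 tau by apply: lt_le_trans tauW; rewrite divr_gt0// !mulr_gt0.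
have Z (u : 'rV[R]_3) : nrm1 ((nrm1 tau)^-1 *: u) = nrm1 u / nrm1 tau.
  by rewrite nrm1Z ger0_norm ?invr_ge0 ?(ltW tgt0)// mulrC.
have [_ _ /(_ ((nrm1 tau)^-1 *: tau))] := Hfb p t (nG _) tT.
rewrite Z divff ?gt_eqF// => /(_ erefl) [|[lam [lam1 lam2]]]; last first.
  have := nearly_tangent w Txi lam2; rewrite -/tau -/W Bh => D.
  rewrite dotC dotZl normrM ger0_norm ?invr_ge0 ?(ltW tgt0)// dotC in lam1.
  rewrite mulrC ler_pdivlMr// in lam1.
  (* [lam] would have to see at least [eps] of [w J0], but sees [O(h^2)] only. *)
  have : eps * (c * h * W / 2) <= W * (B * h).
    by apply: le_trans D; apply: le_trans lam1; rewrite ler_wpM2l// ltW.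
  have -> : eps * (c * h * W / 2) = (eps * c / 2) * (h * W) by ring.
  have -> : W * (B * h) = B * (h * W) by ring.
  rewrite ler_pM2r ?mulr_gt0// => Y2.
  by have := half_not_le ec0 hB Y2.
rewrite pushfwdZ Z ler_pdivlMr// => push.
have rho l : `|(w *m jac xs e xi) 0 l - pushfwd F (p, t) tau 0 l| <= W * (B * h).
  rewrite mulmx_row2 pushfwd_mulmx.
  have E r := jac_expansion a0 r l Txi; rewrite -/p Bh in E.
  have -> : w 0 0 * jac xs e xi 0 l + w 0 1 * jac xs e xi 1 l -
     (w 0 0 * pushfwd F (p, t) (row 0 (J0 xi)) 0 l + w 0 1 * pushfwd F (p, t) (row 1 (J0 xi)) 0 l) =
     w 0 0 * (jac xs e xi 0 l - pushfwd F (p, t) (row 0 (J0 xi)) 0 l) +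
     w 0 1 * (jac xs e xi 1 l - pushfwd F (p, t) (row 1 (J0 xi)) 0 l) by ring.
  apply: le_trans (ler_normD _ _) _; rewrite !normrM /W nrm1_rowE sum_ord2 mulrDl.
  by apply: lerD; rewrite ler_wpM2l.
have low : eps * c * h * W / 4 <= nrm1 (w *m jac xs e xi).
  have tri : nrm1 (pushfwd F (p, t) tau) <= nrm1 (w *m jac xs e xi) + 3 * (W * (B * h)).
    rewrite -[pushfwd F (p, t) tau](subrK (w *m jac xs e xi)) addrC.
    apply: le_trans (nrm1D _ _) _; rewrite lerD2l nrm1_row3.
    have -> : 3 * (W * (B * h)) = W * (B * h) + W * (B * h) + W * (B * h) by ring.
    have rho' l : `|(pushfwd F (p, t) tau - w *m jac xs e xi) 0 l| <= W * (B * h).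
      apply: le_trans (rho l); rewrite distrC le_eqVlt; apply/orP; left; apply/eqP.
      by congr (`|_|); rewrite [in LHS]mxE [X in _ + X]mxE.
    by rewrite !lerD.
  have p1 : eps * (c * h * W / 2) <= eps * nrm1 tau by rewrite ler_wpM2l// ltW.
  have p2 : 12 * B * (h * W) <= eps * c * (h * W) by rewrite ler_wpM2r// mulr_ge0// ltW.
  have E1 : eps * (c * h * W / 2) = 2^-1 * (eps * c * (h * W)) by ring.
  have E2 : eps * c * h * W / 4 = 4^-1 * (eps * c * (h * W)) by ring.
  have E3 : 3 * (W * (B * h)) = 4^-1 * (12 * B * (h * W)) by field.
  rewrite E2; rewrite E1 in p1; rewrite E3 in tri; move: p1 p2 tri push.
  exact: immersive_algebra.
have f1 : nrm1 (w *m jac xs e xi) ^+ 2 <= 3 * frob2 (w *m jac xs e xi) by exact: nrm1_frob2_row.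
have f2 : frob2 w <= W ^+ 2 by exact: frob2_le_nrm1.
have f3 : (eps * c * h * W / 4) ^+ 2 <= nrm1 (w *m jac xs e xi) ^+ 2.
  by rewrite ler_sqr ?nnegrE ?nrm1_ge0 ?divr_ge0 ?mulr_ge0 ?(ltW ec0) ?(ltW h0) ?(ltW eps0) ?(ltW c0).
have f4 : (eps * c) ^+ 2 / 48 * h ^+ 2 * frob2 w <= (eps * c) ^+ 2 / 48 * h ^+ 2 * W ^+ 2.
  by rewrite ler_wpM2l// mulr_ge0 ?divr_ge0 ?sqr_ge0.
apply: le_trans f4 _.
have -> : (eps * c) ^+ 2 / 48 * h ^+ 2 * W ^+ 2 = (eps * c * h * W / 4) ^+ 2 / 3 by field.
by rewrite ler_pdivrMr// [leRHS]mulrC; exact: le_trans f3 f1.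
Qed.

End OneElement.
End ExactNodes.

Section ExactMesh.
Context {R : realType} (k : nat).
Local Notation V := ('rV[R]_3 * R)%type.
Local Notation Tri := (@ref_triangle R).

(** The time derivative of the exact nodes, in terms of the extended flow map. *)
Definition nodal_velocity (tr : triangulation R k) (F : V -> 'rV[R]_3) (t : R) : nodal tr :=
  \matrix_(j, l) 'D_bt (fun y => F y 0 l) (row j (init_node tr), t).

(** The mesh size is taken so small that every element lies in the range of the
    local expansions of [flow_bounds]. *)
Lemma exact_mesh_bounds (k0 : (0 < k)%N) (G0 : set 'rV[R]_3) (T : R) (X : 'rV[R]_3 -> R -> 'rV[R]_3)
    (U : set V) (F : V -> 'rV[R]_3) (I : Type) (tri : I -> triangulation R k) :
  smooth_closed_surface G0 -> Defs.nondegenerate G0 T X -> open U -> class_C 2 U F ->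
  (forall p t, G0 p -> 0 <= t <= T -> U (p, t) /\ F (p, t) = X p t) ->
  admissible_family G0 tri ->
  exists C c h0 : R, [/\ 0 < C, 0 < c, 0 < h0 &
    forall i, mesh_size (tri i) <= h0 -> forall t, 0 <= t <= T ->
      regular_mesh C c (@elt_diam _ _ (tri i)) (exact_nodes (tri i) X t) /\
      forall e xi, Tri xi ->
        [/\ nrm1 (jac (nodal_velocity (tri i) F t) e xi) <= C * elt_diam e,
            nrm1 (elt_map (nodal_velocity (tri i) F t) e xi) <= C &
            nrm1 (elt_map (exact_nodes (tri i) X t) e xi) <= C] ].
Proof.
move=> sG nd oU CF FX [trg [cs cs0 shape] _].
have [eps fb] := flow_bounds_exist sG nd oU CF FX; have [eps0 _] := fb.
have [CL CL0 HCL] := @lagrange_bounds R k.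
have ei0 : 0 <= eps^-1 by rewrite invr_ge0 ltW.
pose N : R := #|{: lattice k}|%:R; have N0 : 0 <= N by exact: ler0n.
pose K1 := 18 * N * CL * eps^-1; have K10 : 0 <= K1 by rewrite /K1; nonneg.
pose K2 := 6 * (eps^-1 * (18 * N * CL) + 9 * N * CL * eps^-1 * eps).
have K20 : 0 <= K2 by rewrite /K2; nonneg.
pose K3 := 3 * N * CL * eps^-1; have K30 : 0 <= K3 by rewrite /K3; nonneg.
pose h0 := Num.min (eps / 3) (eps * cs / (108 * N * CL * eps^-1 + 1)).
have D0 : 0 < 108 * N * CL * eps^-1 + 1 by rewrite ltr_wpDl//; nonneg.
exists (K1 + K2 + K3 + 1), ((eps * cs) ^+ 2 / 48), h0; split.
- by rewrite ltr_wpDl// !addr_ge0.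
- by rewrite divr_gt0// exprn_gt0// mulr_gt0.
- by rewrite lt_min !divr_gt0// mulr_gt0.
move=> i hi t tT; have [nG _ conf _ _] := trg i.
have -> : exact_nodes (tri i) X t = \matrix_(j, l) F (row j (init_node (tri i)), t) 0 l.
  by apply/matrixP => j l; rewrite !mxE; have [_ ->] := FX _ _ (nG j) tT.
have H (e : 'I_(nb_elts (tri i))) xi : Tri xi -> [/\ 0 < elt_diam e, 3 * elt_diam e <= eps &
    108 * N * CL * eps^-1 * elt_diam e <= eps * cs].
  have eh : elt_diam e <= h0 := le_trans (elt_diam_le_mesh e) hi.
  split; first exact: elt_diam_gt0.
    by rewrite mulrC -ler_pdivlMr//; apply: le_trans eh _; rewrite ge_min lexx.
  have : elt_diam e <= eps * cs / (108 * N * CL * eps^-1 + 1) by apply: le_trans eh _; rewrite ge_min lexx orbT.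
  rewrite ler_pdivlMr// => hh; apply: le_trans hh; rewrite mulrC ler_wpM2l ?lerDl//.
  by have := elt_diam_gt0 conf e => /ltW.
have lK1 : K1 <= K1 + K2 + K3 + 1 by rewrite -!addrA lerDl !addr_ge0.
have lK2 : K2 <= K1 + K2 + K3 + 1 by rewrite (addrC K1) -!addrA lerDl !addr_ge0.
have lK3 : K3 <= K1 + K2 + K3 + 1 by rewrite -addrA (addrC _ (K3 + 1)) -addrA lerDl !addr_ge0.
move: (K1 + K2 + K3 + 1) lK1 lK2 lK3 => C lK1 lK2 lK3.
split=> [e xi Txi|e xi Txi].
  have [d0 d1 d2] := H e xi Txi; have nh := nodes_le_diam (tr := tri i) k0 e.
  split.
    have b := transported_jac_le fb CL0 HCL d0 nG nh d1 tT Txi.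
    apply: le_trans b _.
    by rewrite ler_wpM2r// ltW.
  have sh w : cs * elt_diam e * enorm w <= enorm (w *m jac (init_node (tri i)) e xi).
    by have /andP[] := shape i e xi w Txi.
  have im := transported_immersive fb HCL d0 nG nh d1 tT Txi cs0 sh. have im2 := im d2. exact: im2.
have [d0 d1 d2] := H e xi Txi; have nh := nodes_le_diam (tr := tri i) k0 e.
have [b1 [b2 b3]] := velocity_bounds fb HCL nG nh d1 tT Txi.
split.
- by apply: le_trans b1 _; rewrite ler_wpM2r// ltW.
- exact: le_trans b2 lK3.
- exact: le_trans b3 lK3.
Qed.

End ExactMesh.

(** * Continuity in time of the matrices *)

Section JointContinuity.
Context {R : realType}.
Local Notation T := (@ref_triangle R).
Implicit Types (G H : R -> (R * R)%type -> R) (t : R).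

(** Continuity in time and space together, at all points of the triangle over
    the time [t]. *)
Definition jcont G t := forall xi, T xi ->
  (fun p : (R * (R * R))%type => G p.1 p.2) @ (t, xi) --> G t xi.

Lemma jcontD G H t : jcont G t -> jcont H t -> jcont (fun s xi => G s xi + H s xi) t.
Proof. by move=> cG cH xi Txi; apply: cvgD; [exact: cG|exact: cH]. Qed.

Lemma jcontM G H t : jcont G t -> jcont H t -> jcont (fun s xi => G s xi * H s xi) t.
Proof. by move=> cG cH xi Txi; apply: cvgM; [exact: cG|exact: cH]. Qed.

Lemma jcont_cst c t : jcont (fun _ _ => c) t.
Proof. by move=> xi _; exact: cvg_cst. Qed.

Lemma jcont_sum (I : finType) (G : I -> R -> (R * R)%type -> R) t :
  (forall i, jcont (G i) t) -> jcont (fun s xi => \sum_i G i s xi) t.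
Proof.
by move=> cG xi Txi; apply: (cvg_bigsum (f := fun i p => G i p.1 p.2)) => i; exact: cG.
Qed.

Lemma jcont_space (f : (R * R)%type -> R) t : continuous f -> jcont (fun _ xi => f xi) t.
Proof.
move=> cf xi _; apply: (@cvg_comp _ _ _ snd f) (cf xi); exact: cvg_snd.
Qed.

Lemma jcont_time (f : R -> R) t : f @ t --> f t -> jcont (fun s _ => f s) t.
Proof.
move=> cf xi _; apply: (@cvg_comp _ _ _ fst f) cf; exact: cvg_fst.
Qed.

Lemma jcont_comp (f : R -> R) G t : continuous f -> jcont G t -> jcont (fun s xi => f (G s xi)) t.
Proof.
by move=> cf cG xi Txi; apply: (@cvg_comp _ _ _ _ f) (cf _); exact: cG.
Qed.

(** The reference triangle being compact, the integrands converge uniformly. *)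
Lemma continuous_Itri G t : (forall s, bddmeas (G s)) -> jcont G t -> (fun s => Itri (G s)) @ t --> Itri (G t).
Proof.
move=> gG cG; apply/cvgrPdist_le => eps eps0.
have A0 : 0 <= Itri (fun _ : R * R => 1 : R) by apply: Itri_ge0 => *.
set A := Itri _ in A0.
have A1 : 0 < A + 1 by rewrite ltr_wpDl.
pose eta := eps / (A + 1); have eta0 : 0 < eta by rewrite divr_gt0.
have cov : \forall s \near t, T `<=` (fun xi => `|G t xi - G s xi| <= eta).
  have /compact_near_coveringP cT := @compact_ref_triangle R.
  apply: (cT R (nbhs t) (fun s xi => `|G t xi - G s xi| <= eta)) => xi Txi.
  have /cvgrPdist_le/(_ (eta / 2)) := cG xi Txi.
  rewrite divr_gt0// => /(_ isT) [[B1 B2] /= [nB1 nB2] BB].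
  exists (B2, B1) => //= -[xi' s] /= [B2x B1s].
  have b1 := BB (s, xi') (conj B1s B2x); have b2 := BB (t, xi') (conj (nbhs_singleton nB1) B2x).
  rewrite /= in b1 b2.
  rewrite -[G t xi' - _](subrKA (G t xi)) addrC.
  apply: le_trans (ler_normD _ _) _; rewrite [leRHS](splitr eta).
  by apply: lerD => //; rewrite distrC.
near=> s.
have Hs : T `<=` (fun xi => `|G t xi - G s xi| <= eta) by near: s; exact: cov.
have gc : bddmeas (fun _ : R * R => eta) by exact: bddmeas_cst.
have E : Itri (fun _ : R * R => eta) = eta * A.
  by rewrite /A -ItriZ; [apply: eq_Itri => xi _; rewrite mulr1|exact: bddmeas_cst].
have EA : eta * A <= eps.
  by rewrite /eta mulrAC ler_pdivrMr// ler_wpM2l ?lerDl// ltW.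
rewrite -ItriB//; apply: le_trans EA; rewrite -E ler_norml; apply/andP; split.
  rewrite -mulN1r -ItriZ//; apply: le_Itri => [||xi Txi]; [exact: bddmeas_cst|exact: bddmeasB|].
  by have := Hs xi Txi; rewrite mulN1r ler_norml => /andP[].
apply: le_Itri => [||xi Txi] //; first exact: bddmeasB.
by have := Hs xi Txi; rewrite ler_norml => /andP[].
Unshelve. all: by end_near. Qed.

End JointContinuity.

Section MeshContinuity.
Context {R : realType} (k : nat) (tr : triangulation R k).
Local Notation T := (@ref_triangle R).
Variables (P : R -> nodal tr) (a : 'I_(nb_elts tr) -> R) (t : R).
Hypothesis a0 : forall e, 0 < a e.
Hypothesis nP : forall s, nondegenerate_mesh a (P s).
Hypothesis cP : forall j l, (fun s => P s j l) @ t --> P t j l.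

Lemma jcont_elt_map e l : jcont (fun s xi => elt_map (P s) e xi 0 l) t.
Proof.
under eq_fun do under eq_fun do rewrite elt_mapE.
apply: (jcont_sum (G := fun b s xi => lagrange b xi * P s (local_node e b) l)) => b; apply: jcontM; last exact: (jcont_time (f := fun s => P s _ l)).
by apply: jcont_space; exact: planar_continuous (planar_lagrange b).
Qed.

Lemma jcont_jac e r l : jcont (fun s xi => jac (P s) e xi r l) t.
Proof.
under eq_fun do under eq_fun do rewrite jacE.
apply: (jcont_sum (G := fun b s xi => P s (local_node e b) l * ref_grad (lagrange b) xi r)) => b; apply: jcontM; first exact: (jcont_time (f := fun s => P s _ l)).
by apply: jcont_space; exact: continuous_ref_grad.
Qed.

Lemma jcont_cross e l : jcont (fun s xi => crossJ (jac (P s) e xi) 0 l) t.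
Proof.
have H (r s : 'I_2) (i j m n : 'I_3) : jcont (fun u xi =>
    jac (P u) e xi r i * jac (P u) e xi s j - jac (P u) e xi r m * jac (P u) e xi s n) t.
  by move=> xi Txi; apply: cvgB; apply: cvgM; exact: jcont_jac.
have : l \in [:: 0; 1; 2] by case: l => -[|[|[|//]]] h; rewrite !inE.
rewrite !inE => /or3P[] /eqP ->; under eq_fun do under eq_fun do rewrite crossJE; exact: H.
Qed.

Lemma jcont_area e : jcont (fun s xi => areaJ (jac (P s) e xi)) t.
Proof.
under eq_fun do under eq_fun do rewrite /areaJ det_gram /frob2 big_ord1.
apply: (jcont_comp (G := fun s xi => \sum_j crossJ (jac (P s) e xi) 0 j ^+ 2)) => [z|].
  exact: sqrt_continuous.
by apply: (jcont_sum (G := fun l s xi => crossJ (jac (P s) e xi) 0 l ^+ 2)) => l; apply: jcontM; exact: jcont_cross.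
Qed.

Lemma jcont_gram e r s : jcont (fun u xi => (jac (P u) e xi *m (jac (P u) e xi)^T) r s) t.
Proof.
under eq_fun do under eq_fun do rewrite mxE.
apply: (jcont_sum (G := fun l u xi => jac (P u) e xi r l * (jac (P u) e xi)^T l s)) => l.
apply: jcontM; first exact: jcont_jac.
by under eq_fun do under eq_fun do rewrite mxE; exact: jcont_jac.
Qed.

Lemma jcont_stiffJ e w z :
  jcont (fun s xi => stiffJ (jac (P s) e xi) (jac w e xi) (jac z e xi)) t.
Proof.
have cj (x : nodal tr) r l : jcont (fun _ xi => jac x e xi r l) t.
  by apply: jcont_space; exact: continuous_jac.
move=> xi Txi; apply: cvgM; last first.
  apply: cvgV; last exact: jcont_area.
  have p : 0 < areaJ (jac (P t) e xi) := lt_le_trans (a0 e) (@nP t e xi Txi).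
  have p2 : areaJ (jac (P t) e xi) != 0 by rewrite gt_eqF.
  exact: p2.
pose G l (s : R) xi := (jac (P s) e xi *m (jac (P s) e xi)^T) 1 1 * (jac w e xi 0 l * jac z e xi 0 l)
  - (jac (P s) e xi *m (jac (P s) e xi)^T) 0 1 * (jac w e xi 0 l * jac z e xi 1 l + jac w e xi 1 l * jac z e xi 0 l)
  + (jac (P s) e xi *m (jac (P s) e xi)^T) 0 0 * (jac w e xi 1 l * jac z e xi 1 l).
apply: (jcont_sum (G := G)) => // l {xi Txi} xi Txi.
apply: cvgD; [apply: cvgB|]; (apply: cvgM; first exact: jcont_gram); [|apply: cvgD|];
  by apply: cvgM; exact: cj.
Qed.

Lemma mxtrace_delta n (A : 'M[R]_n) i j :
  A i j = \tr ((delta_mx i 0 : 'M[R]_(n, 3))^T *m A *m delta_mx j 0).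
Proof.
rewrite trmx_delta mxtrace_mulC mulmxA mul_delta_mx /mxtrace (bigD1 j)//= big1 ?addr0.
  rewrite mxE (bigD1 i)//= big1 ?addr0 => [|l li].
    by rewrite mxE !eqxx mul1r.
  by rewrite mxE (negPf li) andbF mul0r.
move=> l lj; rewrite mxE big1 // => m _; by rewrite mxE (negPf lj) mul0r.
Qed.

Lemma mxtrace_delta_load (b : nodal tr) j l : b j l = \tr ((delta_mx j l : nodal tr)^T *m b).
Proof.
rewrite trmx_delta /mxtrace (bigD1 l)//= big1 ?addr0.
  rewrite mxE (bigD1 j)//= big1 ?addr0 => [|i ij]; first by rewrite mxE !eqxx mul1r.
  by rewrite mxE (negPf ij) andbF mul0r.
by move=> i il; rewrite mxE big1 // => m _; rewrite mxE (negPf il) mul0r.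
Qed.

Lemma continuous_Kmx alpha i j : (fun s => Kmx alpha (P s) i j) @ t --> Kmx alpha (P t) i j.
Proof.
under eq_fun do rewrite mxtrace_delta (Kmx_form _ _ _ a0 (@nP _)); rewrite mxtrace_delta (Kmx_form _ _ _ a0 (@nP _)).
apply: cvg_bigsum => e; apply: (continuous_Itri (G := fun s xi => _)) => [s|].
  exact: bddmeas_Kmx_dens.
apply: jcontD.
  apply: jcontM; first exact: jcont_area.
  by apply: jcont_sum => l; apply: jcontM; apply: jcont_space;
     exact: continuous_elt_map.
by apply: jcontM; [exact: jcont_cst|exact: jcont_stiffJ].
Qed.

Lemma continuous_Amx beta i j : (fun s => Amx beta (P s) i j) @ t --> Amx beta (P t) i j.
Proof.
have E s : Amx beta (P s) i j = beta * stiffness (P s) i j by rewrite mxE.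
under eq_fun do rewrite E; rewrite E; apply: cvgM; first exact: cvg_cst.
under eq_fun do rewrite mxtrace_delta (stiffJ_form _ _ a0 (@nP _)); rewrite mxtrace_delta (stiffJ_form _ _ a0 (@nP _)).
apply: cvg_bigsum => e; apply: (continuous_Itri (G := fun s xi => _)) => [s|].
  exact: bddmeas_stiffJ.
exact: jcont_stiffJ.
Qed.

Lemma continuous_load g (th : R -> R) j l :
  (forall s e, bddmeas (fun xi => g (elt_map (P s) e xi, th s))) ->
  (forall e, jcont (fun s xi => g (elt_map (P s) e xi, th s)) t) ->
  (fun s => load g (P s) (th s) j l) @ t --> load g (P t) (th t) j l.
Proof.
move=> gg cg.
under eq_fun => s do rewrite mxtrace_delta_load (load_form _ a0 (@nP _) (gg s)).
rewrite mxtrace_delta_load (load_form _ a0 (@nP _) (gg t)).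
apply: cvg_bigsum => e; apply: (continuous_Itri (G := fun s xi => _)) => [s|].
  by apply: bddmeasM; [exact: gg|exact: bddmeas_dot_cross].
apply: jcontM => //; apply: jcont_sum => m; apply: jcontM; first exact: jcont_cross.
by apply: jcont_space; exact: continuous_elt_map.
Qed.

End MeshContinuity.

Section MatrixContinuity.
Context {R : realType}.

(** Entrywise continuity, which is preserved by matrix algebra. *)
Definition mcont m n (A : R -> 'M[R]_(m, n)) t := forall i j, (fun s => A s i j) @ t --> A t i j.

Lemma mcont_mul m n p (A : R -> 'M[R]_(m, n)) (B : R -> 'M[R]_(n, p)) t :
  mcont A t -> mcont B t -> mcont (fun s => A s *m B s) t.
Proof.
move=> cA cB i j; under eq_fun do rewrite mxE; rewrite mxE.
apply: (cvg_bigsum (f := fun l s => A s i l * B s l j)) => l; exact: cvgM.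
Qed.

Lemma mcontD m n (A B : R -> 'M[R]_(m, n)) t : mcont A t -> mcont B t -> mcont (fun s => A s + B s) t.
Proof. by move=> cA cB i j; under eq_fun do rewrite mxE; rewrite mxE; exact: cvgD. Qed.

Lemma mcontN m n (A : R -> 'M[R]_(m, n)) t : mcont A t -> mcont (fun s => - A s) t.
Proof. by move=> cA i j; under eq_fun do rewrite mxE; rewrite mxE; exact: cvgN. Qed.

Lemma mcont_tr m n (A : R -> 'M[R]_(m, n)) t : mcont A t -> mcont (fun s => (A s)^T) t.
Proof. by move=> cA i j; under eq_fun do rewrite mxE; rewrite mxE; exact: cA. Qed.

Lemma mcont_trace n (A : R -> 'M[R]_n) t : mcont A t -> (fun s => \tr (A s)) @ t --> \tr (A t).
Proof. by move=> cA; apply: (cvg_bigsum (f := fun i s => A s i i)) => i; exact: cA. Qed.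

Lemma mcont_det n (A : R -> 'M[R]_n) t : mcont A t -> (fun s => \det (A s)) @ t --> \det (A t).
Proof.
move=> cA; apply: (cvg_bigsum (f := fun (p : 'S_n) s => (-1) ^+ p * \prod_i A s i (p i))) => p.
apply: cvgM; first exact: cvg_cst.
have : forall r : seq 'I_n, (fun s => \prod_(i <- r) A s i (p i)) @ t --> \prod_(i <- r) A t i (p i).
  elim=> [|i r IH].
    by under eq_fun do rewrite big_nil; rewrite big_nil; exact: cvg_cst.
  under eq_fun do rewrite big_cons; rewrite big_cons.
  by apply: cvgM => //; exact: cA.
exact.
Qed.

Lemma mcont_inv n (A : R -> 'M[R]_n) t : (forall s, A s \in unitmx) -> mcont A t ->
  mcont (fun s => invmx (A s)) t.
Proof.
move=> uA cA i j; have E s : invmx (A s) i j = (\det (A s))^-1 * \adj (A s) i j.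
  by rewrite /invmx uA mxE.
under eq_fun do rewrite E; rewrite E; apply: cvgM.
  apply: cvgV; last exact: mcont_det.
  by have := uA t; rewrite unitmxE unitfE.
under eq_fun do rewrite mxE; rewrite mxE; apply: cvgM; first exact: cvg_cst.
apply: (mcont_det (A := fun s => row' j (col' i (A s)))) => r s.
by under eq_fun do rewrite !mxE; rewrite !mxE; exact: cA.
Qed.

End MatrixContinuity.

(** * Gronwall inequality and continuation argument *)

Section Gronwall.
Context {R : realType}.
Local Notation mu := (@lebesgue_measure R).
Implicit Types (y dy phi : R -> R).

Lemma continuous_integrable phi a b : continuous phi -> mu.-integrable `[a, b] (EFin \o phi).
Proof.
move=> cphi; apply: continuous_compact_integrable; first exact: segment_compact.
exact: continuous_subspaceT.
Qed.

(** The function [exp (- K s) y s - K * (integral of phi over [0, s])] is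
    nonincreasing, because [phi] is nonnegative and [exp (- K s) <= 1]. *)
Lemma gronwall (K t0 : R) y dy phi : 0 <= K -> 0 <= t0 -> continuous y -> continuous phi ->
  (forall s, 0 <= phi s) -> y 0 <= 0 ->
  (forall s : R, 0 < s < t0 -> is_derive s 1 y (dy s) /\ dy s <= K * (y s + phi s)) ->
  y t0 <= K * expR (K * t0) * \int[mu]_(s in `[0, t0]) phi s.
Proof.
move=> K0; rewrite le_eqVlt => /predU1P[<-|t00] cy cphi phi0 y0 H.
  by apply: le_trans y0 _; rewrite !mulr_ge0 ?expR_ge0 ?Rintegral_ge0//.
pose Phi u := \int[mu]_(s in `[0, u]) phi s.
have dPhi (s : R) : 0 < s -> is_derive s 1 Phi (phi s).
  move=> s0; have s1 : s < s + 1 by rewrite ltrDl.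
  have [d1 d2] := continuous_FTC1_closed s1 (continuous_integrable 0 (s + 1) cphi) s0 (cphi s).
  by apply: DeriveDef; [exact: d1|rewrite -derive1E; exact: d2].
pose E (s : R) := expR (- K * s).
have dE (s : R) : is_derive s 1 E (- K * E s).
  have h : is_derive s 1 (fun s : R => - K * s) (- K).
    by apply: (is_derive_eq (is_deriveZ _ _)); rewrite /GRing.scale /= mulr1.
  have e := is_derive_expR (- K * s).
  by have := is_derive1_comp e h; rewrite /GRing.scale/= [X in is_derive _ _ _ X]mulrC.
have cE : continuous E.
  move=> s; apply: (@continuous_comp _ _ _ (fun s => - K * s) expR); last exact: continuous_expR.
  by apply: cvgM; [exact: cvg_cst|exact: cvg_id].
pose z s := E s * y s - K * Phi s.
have dz (s : R) : 0 < s < t0 -> is_derive s 1 z (E s * dy s + y s * (- K * E s) - K * phi s).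
  move=> s0t; have [h1 _] := H s s0t; have /andP[s0 _] := s0t.
  have h2 := dPhi s s0.
  apply: (is_derive_eq (is_deriveB (is_deriveM (dE s) h1) (is_deriveZ K h2))).
  by [].
have cz : {within `[0, t0], continuous z}.
  move=> s; apply: cvgB.
    apply: cvgM; apply: continuous_subspaceT => {}s; last exact: cy.
    exact: cE.
  apply: cvgM; first exact: cvg_cst.
  exact: (parameterized_integral_continuous (ltW t00) (continuous_integrable 0 t0 cphi)).
(* The derivative is at most [K phi (exp (- K s) - 1) <= 0]. *)
have mono : z t0 <= z 0.
  apply: (@ler0_derive1_le_cc _ z 0 t0 _ _ cz).
  - by move=> s; rewrite in_itv/= => /dz[].
  - move=> s; rewrite in_itv/= => /[dup] s0t /dz ds; rewrite derive1E derive_val.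
    have /andP[s0 _] := s0t; have [_ h] := H s s0t.
    have E1 : E s <= 1 by rewrite -expR0 ler_expR mulNr oppr_le0 mulr_ge0// ltW.
    have e0 : 0 <= E s by exact: expR_ge0.
    have h1 : E s * dy s <= E s * (K * (y s + phi s)) by rewrite ler_wpM2l.
    have h2 : E s * (K * phi s) <= K * phi s by rewrite ler_piMl// mulr_ge0.
    have -> : E s * dy s + y s * (- K * E s) - K * phi s = 
      (E s * dy s - E s * (K * (y s + phi s))) + (E s * (K * phi s) - K * phi s) by ring.
    by rewrite -[leRHS]addr0 lerD// subr_le0.
  - by rewrite in_itv/= lexx ltW.
  - by rewrite in_itv/= lexx ltW.
  - exact: ltW.
have z0 : z 0 <= 0.
  rewrite /z /Phi set_itv1 Rintegral_set1 mulr0 subr0 /E mulr0 expR0 mul1r//.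
have zt : E t0 * y t0 <= K * Phi t0 by rewrite -subr_le0; apply: le_trans mono z0.
rewrite -/(Phi t0).
have -> : y t0 = expR (K * t0) * (E t0 * y t0) by rewrite mulrA /E mulNr -expRD subrr expR0 mul1r.
have -> : K * expR (K * t0) * Phi t0 = expR (K * t0) * (K * Phi t0) by rewrite [K * expR _]mulrC mulrA.
by rewrite ler_wpM2l// expR_ge0.
Qed.

(** Up to the infimum of the times at which [y > B], the differential inequality
    is available, so Gronwall gives [y < B] at this infimum, and by continuity
    shortly afterwards: a contradiction. *)
Lemma bootstrap (T K B : R) y dy phi : 0 <= K -> continuous y -> continuous phi ->
  (forall s, 0 <= phi s) -> y 0 <= 0 ->
  (forall s : R, 0 < s < T -> is_derive s 1 y (dy s) /\ (y s <= B -> dy s <= K * (y s + phi s))) ->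
  (forall t, 0 <= t <= T -> K * expR (K * t) * \int[mu]_(s in `[0, t]) phi s < B) ->
  forall t, 0 <= t <= T ->
    y t <= B /\ y t <= K * expR (K * t) * \int[mu]_(s in `[0, t]) phi s.
Proof.
move=> K0 cy cphi phi0 y0 H HB.
have yB : forall t, 0 <= t <= T -> y t <= B.
  move=> t1 t1T; rewrite leNgt; apply/negP => yt1.
  pose S := [set s | 0 <= s <= T /\ B < y s].
  have lS : lbound S 0 by move=> s [/andP[]].
  have iS : has_inf S by split; [exists t1|exists 0].
  have s0 : 0 <= inf S by apply: lb_le_inf; [exists t1|].
  have sT : inf S <= T.
    by apply: le_trans (_ : t1 <= T); [apply: inf_lbound; [exists 0|split]|case/andP: t1T].
  have ys : y (inf S) < B.
    apply: le_lt_trans (HB _ (introT andP (conj s0 sT))).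
    apply: (gronwall (dy := dy)) => // s /andP[s1 s2].
    have [|h1 h2] := H s; first by rewrite s1 (lt_le_trans s2).
    split => //; apply: h2; rewrite leNgt; apply/negP => yB.
    have : inf S <= s by apply: inf_lbound; [exists 0|split => //; rewrite (ltW s1) ltW// (lt_le_trans s2)].
    by rewrite leNgt s2.
  have /nbhs_ballP[r /= r0 Hr] : \forall s \near inf S, y s < B.
    have c : y s @[s --> inf S] --> y (inf S) := cy (inf S).
    exact: (cvgr_lt _ c _ ys).
  have [u [/andP[u0 uT] yu] ur] := inf_adherent r0 iS.
  have : y u < B.
    apply: Hr; rewrite /ball/= distrC ger0_norm; first by rewrite ltrBlDl.
    by rewrite subr_ge0; apply: inf_lbound; [exists 0|split => //; rewrite u0 uT].
  by move/lt_trans => /(_ _ yu); rewrite ltxx.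
move=> t tT; split; first exact: yB.
have /andP[t0 tT'] := tT; apply: (gronwall (dy := dy)) => // s /andP[s0 st].
have sT : s <= T by apply: le_trans tT'; exact: ltW.
have [|h1 h2] := H s; first by rewrite s0 (lt_le_trans st).
by split => //; apply/h2/yB; rewrite (ltW s0).
Qed.

End Gronwall.

(** * One-sided time derivatives *)

Section TimeDerivative.
Context {R : realType}.
Variable T : R.
Hypothesis T0 : 0 < T.
Local Notation V := ('rV[R]_3 * R)%type.
Implicit Types (t s : R).

(** Composition with this retraction of the line on [[0, T]] turns one-sided
    continuity at the end points into continuity. *)
Definition clamp s := Num.max 0 (Num.min s T).

Lemma clamp_itv s : 0 <= clamp s <= T.
Proof. by rewrite /clamp le_max lexx/= ge_max (ltW T0) ge_min lexx orbT. Qed.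

Lemma clamp_id s : 0 <= s <= T -> clamp s = s.
Proof. by move=> /andP[s0 sT]; rewrite /clamp (min_idPl sT) (max_idPr s0). Qed.

Lemma continuous_clamp : continuous clamp.
Proof.
move=> s; have c1 : {for s, continuous (cst T : R -> R^o)} by exact: cvg_cst.
have c2 : {for s, continuous (cst 0 : R -> R^o)} by exact: cvg_cst.
have c3 : {for s, continuous (id : R -> R^o)} by exact: cvg_id.
exact: (continuous_max c2 (continuous_min c3 c1)).
Qed.

(** Points of [[0, T]] accumulate at each of its points, which makes one-sided
    derivatives unique. *)
Lemma within_time_proper t : 0 <= t <= T -> ProperFilter (within `[0, T] t^').
Proof.
move=> /andP[t0 tT]; apply: Build_ProperFilter_ex => A.
move=> /nbhs_ballP[r /= r0 Hr].
pose d := Num.min r T / 2; have m0 : 0 < Num.min r T by rewrite lt_min r0.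
have d0 : 0 < d by rewrite divr_gt0.
have dr : d < r by apply: lt_le_trans (_ : Num.min r T <= r); [rewrite ltr_pdivrMr// mulr2n mulrDr mulr1 ltrDl|rewrite ge_min lexx].
have dT : d <= T / 2 by rewrite ler_wpM2r ?invr_ge0// ge_min lexx orbT.
have [tT2|tT2] := leP t (T / 2).
  exists (t + d); apply: Hr => /=.
  - by rewrite /ball/= opprD addrA subrr sub0r normrN ger0_norm// ltW.
  - by rewrite gt_eqF// ltrDl.
  - by rewrite in_itv/= addr_ge0// ?(ltW d0)//= [leRHS](splitr T) lerD.
exists (t - d); apply: Hr => /=.
- by rewrite /ball/= opprB addrC subrK ger0_norm// ltW.
- by rewrite lt_eqF// ltrBlDr ltrDl.
- rewrite in_itv/= subr_ge0 (le_trans dT (ltW tT2))/=.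
  by rewrite lerBlDr (le_trans tT)// lerDl ltW.
Qed.

Lemma has_tderivP (f : R -> R) t l : has_tderiv T f t l <->
  forall e, 0 < e -> exists2 r, 0 < r & forall s, 0 <= s <= T -> s != t -> `|s - t| < r ->
    `|l - (s - t)^-1 * (f s - f t)| <= e.
Proof.
split=> [/cvgrPdist_le H e e0|H].
  have /nbhs_ballP[r /= r0 Hr] := H e e0; exists r => // s sT st sr.
  by apply: (Hr s) => //=; rewrite /ball/= distrC.
apply/cvgrPdist_le => e e0; have [r r0 Hr] := H e e0.
apply/nbhs_ballP; exists r => //= s sr st sT; apply: Hr => //.
by move: sr; rewrite /ball/= distrC.
Qed.

Lemma has_tderiv_entries m n (f : R -> 'M[R]_(m, n)) t l :
  has_tderiv T f t l <-> forall i j, has_tderiv T (fun s => f s i j) t (l i j).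
Proof.
have E s i j : tquot f t s i j = tquot (fun s => f s i j) t s by rewrite /tquot !mxE.
split=> [H i j|H].
  rewrite /has_tderiv; under eq_fun do rewrite -E.
  by apply: (@cvg_comp _ _ _ (tquot f t) (fun A : 'M[R]_(m, n) => A i j)) H _; exact: coord_continuous.
apply/cvgrPdist_le => e e0; near=> s.
rewrite [leLHS]/Num.norm/= mx_normrE; apply/bigmax_leP; split => [|[i j] _ /=]; first exact: ltW.
rewrite !mxE; have := E s i j; rewrite /tquot !mxE => ->.
move: i j; near: s; apply: filter_forall => i; apply: filter_forall => j.
by have /cvgrPdist_le := H i j; exact.
Unshelve. all: by end_near. Qed.

Lemma has_tderivB m n (f f' : R -> 'M[R]_(m, n)) t l l' : 0 <= t <= T ->
  has_tderiv T f t l -> has_tderiv T f' t l' -> has_tderiv T (fun s => f s - f' s) t (l - l').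
Proof.
move=> tT h1 h2; have FF := within_time_proper tT; rewrite /has_tderiv.
have -> : tquot (fun s => f s - f' s) t = fun s => tquot f t s - tquot f' t s.
  by apply/funext => s; rewrite /tquot -scalerBr !opprB addrACA [in RHS]addrACA [- f' s + _]addrC.
exact: cvgB h1 h2.
Qed.

Lemma eq_has_tderiv m n (f f' : R -> 'M[R]_(m, n)) t l : 0 <= t <= T ->
  (forall s, 0 <= s <= T -> f s = f' s) -> has_tderiv T f t l -> has_tderiv T f' t l.
Proof.
move=> tT E /has_tderiv_entries H; apply/has_tderiv_entries => i j; apply/has_tderivP => e e0.
have /has_tderivP/(_ e e0)[r r0 Hr] := H i j; exists r => // s sT st sr.
by rewrite -!E//; exact: Hr.
Qed.

Lemma tderiv_eq m n (f : R -> 'M[R]_(m, n)) t l : 0 <= t <= T -> has_tderiv T f t l -> tderiv T f t = l.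
Proof. by move=> tT H; have FF := within_time_proper tT; exact/cvg_lim. Qed.

(** The derivative of the extended flow map in the time direction, restricted to
    [[0, T]]. *)
Lemma has_tderiv_flow (G : V -> R) (f : R -> R) p t : derivable G (p, t) bt -> 0 <= t <= T ->
  (forall s, 0 <= s <= T -> f s = G (p, s)) -> has_tderiv T f t ('D_bt G (p, t)).
Proof.
move=> dG tT fG; apply/has_tderivP => e e0.
have /cvgrPdist_le/(_ e e0)/nbhs_ballP[r /= r0 Hr] :
  h^-1 *: (G (h *: bt + (p, t)) - G (p, t)) @[h --> 0^'] --> 'D_bt G (p, t) by exact: dG.
exists r => // s sT st sr; rewrite !fG//.
have := Hr (s - t); rewrite /ball/= sub0r normrN => /(_ sr).
rewrite subr_eq0 => /(_ st).
have -> : (s - t) *: (bt : V) + (p, t) = (p, s).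
  by rewrite /bt; congr (_, _) => /=; rewrite ?scaler0 ?add0r// /GRing.scale/= mulr1 subrK.
by [].
Qed.

Lemma has_tderiv_is_derive (f : R -> R) t l : has_tderiv T f t l -> 0 < t < T -> is_derive t 1 f l.
Proof.
move=> /has_tderivP H /andP[t0 tT].
have c : h^-1 *: (f (h *: 1 + t) - f t) @[h --> 0^'] --> l.
  apply/cvgrPdist_le => e e0; have [r r0 Hr] := H e e0.
  have m0 : 0 < Num.min r (Num.min t (T - t)) by rewrite !lt_min r0 t0 subr_gt0.
  apply/nbhs_ballP; exists (Num.min r (Num.min t (T - t))) => //= h.
  rewrite /ball/= sub0r normrN !lt_min => /and3P[hr ht hT] h0.
  have := Hr (h + t); rewrite addrK => H1; rewrite /GRing.scale/= mulr1; apply: H1 => //.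
    by move: ht hT; rewrite !ltr_norml => /andP[? _] /andP[_ ?]; apply/andP; split; lra.
  by rewrite -subr_eq0 addrK.
by split; [apply/cvg_ex; exists l|exact/cvg_lim].
Qed.

Lemma has_tderiv_continuous (f : R -> R) t l : has_tderiv T f t l -> 0 <= t <= T ->
  (fun s => f (clamp s)) @ t --> f t.
Proof.
move=> /has_tderivP H tT; apply/cvgrPdist_le => e e0.
have [r r0 Hr] := H 1 ltr01.
have L0 : 0 < `|l| + 1 by rewrite ltr_wpDl.
have c : clamp s @[s --> t] --> clamp t by exact: continuous_clamp.
rewrite clamp_id// in c; near=> s.
have s1 : `|t - clamp s| < r.
  by near: s; have /cvgrPdist_lt := c; exact.
have s2 : `|t - clamp s| <= e / (`|l| + 1).
  by near: s; have /cvgrPdist_le := c; apply; rewrite divr_gt0.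
have [->|st] := eqVneq (clamp s) t; first by rewrite subrr normr0 ltW.
rewrite distrC in s1; have := Hr _ (clamp_itv s) st s1; set q := _^-1 * _ => q1.
have E : f (clamp s) - f t = (clamp s - t) * q by rewrite mulrA divff ?mul1r// subr_eq0.
rewrite distrC E normrM; apply: le_trans (_ : `|t - clamp s| * (`|l| + 1) <= e); last by rewrite -ler_pdivlMr.
rewrite distrC ler_wpM2l//; rewrite -[q](subKr l) addrC.
by apply: le_trans (ler_normD _ _) _; rewrite addrC normrN lerD2l.
Unshelve. all: by end_near. Qed.

Lemma has_tderiv_clamp (f : R -> R) : (forall t, 0 <= t <= T -> exists l, has_tderiv T f t l) ->
  continuous (fun s => f (clamp s)).
Proof.
move=> H t; have [l Hl] := H _ (clamp_itv t).
have c := has_tderiv_continuous Hl (clamp_itv t).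
have ci s : clamp (clamp s) = clamp s by rewrite clamp_id// clamp_itv.
have : (fun s => f (clamp (clamp s))) @ t --> f (clamp t).
  by apply: (@cvg_comp _ _ _ clamp (fun s => f (clamp s))) c; exact: continuous_clamp.
by under eq_fun do rewrite ci.
Qed.

End TimeDerivative.

(** * Lipschitz data and derivatives of quadratic forms *)

Section LipschitzData.
Context {R : realType}.
Local Notation V := ('rV[R]_3 * R)%type.

Lemma lipschitz_bound (g : V -> R) : lipschitz g ->
  exists2 L : R, 0 <= L & forall u u' t t', `|g (u, t) - g (u', t')| <= L * (nrm1 (u - u') + `|t - t'|).
Proof.
move=> [M [_ H]]; pose L := Num.max 0 (M + 1).
have ML : M < L by rewrite /L lt_max ltrDl ltr01 orbT.
have L0 : 0 <= L by rewrite /L le_max lexx.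
exists L => // u u' t t'; have := H L ML ((u, t), (u', t')) (conj I I) => /= /le_trans; apply.
rewrite ler_wpM2l// [leLHS]/Num.Def.normr/= ge_max lerDr nrm1_ge0 andbT.
by apply: le_trans (norm_le_nrm1 _) _; rewrite lerDl.
Qed.

Variables (g : V -> R) (L : R).
Hypothesis gL : forall u u' t t', `|g (u, t) - g (u', t')| <= L * (nrm1 (u - u') + `|t - t'|).

Lemma cvg_lipschitz (U : Type) (Fl : set_system U) (FF : Filter Fl) (E : U -> 'rV[R]_3) (th : U -> R)
    (E0 : 'rV[R]_3) (t0 : R) :
  (forall l, (fun u => E u 0 l) @ Fl --> E0 0 l) -> th @ Fl --> t0 ->
  (fun u => g (E u, th u)) @ Fl --> g (E0, t0).
Proof.
move=> cE cth; apply: (@cvg_dist_le _ _ _ _ _ (fun u => L * (nrm1 (E0 - E u) + `|t0 - th u|))).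
  by apply: nearW => u; exact: gL.
have c0 : `|t0 - th u| @[u --> Fl] --> (0 : R).
  have c : (t0 - th u) @[u --> Fl] --> t0 - t0 by apply: cvgB => //; exact: cvg_cst.
  have := cvg_norm c; rewrite subrr normr0 => /(_ FF); exact.
have c1 : nrm1 (E0 - E u) @[u --> Fl] --> (0 : R).
  under eq_fun do rewrite nrm1_rowE sum_ord3 !mxE.
  have cl l : `|E0 0 l - E u 0 l| @[u --> Fl] --> (0 : R).
    have c : (E0 0 l - E u 0 l) @[u --> Fl] --> E0 0 l - E0 0 l by apply: cvgB => //; exact: cvg_cst.
    have := cvg_norm c; rewrite subrr normr0 => /(_ FF); exact.
  have := cvgD (cvgD (cl 0) (cl 1)) (cl 2); rewrite !addr0; exact.
have c2 : L @[u --> Fl] --> L by exact: cvg_cst.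
have := cvgM c2 (cvgD c1 c0); rewrite addr0 mulr0; exact.
Qed.

Lemma bddmeas_lipschitz k (tr : triangulation R k) (y : nodal tr) e t :
  bddmeas (fun xi => g (elt_map y e xi, t)).
Proof.
apply: bddmeas_continuous => xi; apply: cvg_lipschitz; last exact: cvg_cst.
by move=> l; exact: continuous_elt_map.
Qed.

Lemma jcont_lipschitz k (tr : triangulation R k) (P : R -> nodal tr) (th : R -> R) t e :
  (forall j l, (fun s => P s j l) @ t --> P t j l) -> th @ t --> th t ->
  jcont (fun s xi => g (elt_map (P s) e xi, th s)) t.
Proof.
move=> cP cth xi Txi; apply: cvg_lipschitz.
  by move=> l; exact: jcont_elt_map.
by apply: (jcont_time cth Txi).
Qed.

End LipschitzData.

Section QuadraticForms.
Context {R : realType}.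

Definition mderive m n (A : R -> 'M[R]_(m, n)) (s : R) (D : 'M[R]_(m, n)) :=
  forall i j, is_derive s 1 (fun u : R => A u i j) (D i j).

(** Product rule; the two terms agree by symmetry. *)
Lemma mderive_form n p (S : 'M[R]_n) (A : R -> 'M[R]_(n, p)) (s : R) D : S^T = S -> mderive A s D ->
  is_derive s 1 (fun u : R => \tr ((A u)^T *m S *m A u)) (2 * \tr ((A s)^T *m S *m D)).
Proof.
move=> SS dA.
have E (B C : 'M[R]_(n, p)) : \tr (B^T *m S *m C) = \sum_l \sum_j \sum_i (S i j * B i l * C j l).
  apply: eq_bigr => l _; rewrite mxE; apply: eq_bigr => j _; rewrite mxE mulr_suml.
  by apply: eq_bigr => i _; rewrite mxE; ring.
have sw : \tr (D^T *m S *m A s) = \tr ((A s)^T *m S *m D).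
  by rewrite -mxtrace_tr !trmx_mul trmxK SS mulmxA.
have H : is_derive s 1 (fun u : R => \sum_l \sum_j \sum_i (S i j * A u i l * A u j l))
    (\sum_l \sum_j \sum_i (S i j * A s i l * D j l + S i j * D i l * A s j l)).
  apply: is_derive_bigsum => l _; apply: is_derive_bigsum => j _; apply: is_derive_bigsum => i _.
  have h1 := dA i l; have h2 := dA j l.
  apply: (is_derive_eq (is_deriveM (is_deriveZ (S i j) h1) h2)).
  by transitivity (S i j * A s i l * D j l + A s j l * (S i j * D i l)); [|ring].
have -> : (fun u : R => \tr ((A u)^T *m S *m A u)) = fun u => \sum_l \sum_j \sum_i (S i j * A u i l * A u j l).
  by apply/funext => u; exact: E.
have -> : 2 * \tr ((A s)^T *m S *m D) =
    \sum_l \sum_j \sum_i (S i j * A s i l * D j l + S i j * D i l * A s j l).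
  rewrite mulr_natl mulr2n -[X in _ + X]sw !E -big_split/=; apply: eq_bigr => l _.
  by rewrite -big_split/=; apply: eq_bigr => j _; rewrite -big_split.
exact: H.
Qed.

(** Expand the form at [A - B]. *)
Lemma cross_form_le n p (S : 'M[R]_n) (A B : 'M[R]_(n, p)) : S^T = S ->
  0 <= \tr ((A - B)^T *m S *m (A - B)) ->
  2 * \tr (A^T *m S *m B) <= \tr (A^T *m S *m A) + \tr (B^T *m S *m B).
Proof.
move=> SS; have sw : \tr (B^T *m S *m A) = \tr (A^T *m S *m B).
  by rewrite -mxtrace_tr !trmx_mul trmxK SS mulmxA.
have -> : \tr ((A - B)^T *m S *m (A - B)) =
    \tr (A^T *m S *m A) + \tr (B^T *m S *m B) - 2 * \tr (A^T *m S *m B).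
  have -> : (A - B)^T = A^T - B^T by rewrite linearB.
  rewrite !(mulmxBl, mulmxBr) !raddfB/= sw mulr_natl mulr2n.
  by move: (\tr _) (\tr _) (\tr _) => a b c; ring.
by rewrite subr_ge0.
Qed.

End QuadraticForms.

(** * The error on one mesh *)

Section InverseForm.
Context {R : realType}.

(** The value at [r] of the inverse form is the value of the form at
    [invmx K *m r]. *)
Lemma inverse_form_ge0 n p (K : 'M[R]_n) (r : 'M[R]_(n, p)) : K^T = K -> K \in unitmx ->
  (forall w : 'M[R]_(n, p), 0 <= \tr (w^T *m K *m w)) -> 0 <= \tr (r^T *m invmx K *m r).
Proof.
move=> KT uK K0; have := K0 (invmx K *m r).
by rewrite trmx_mul trmx_inv KT -[r^T *m _ *m K]mulmxA mulVmx// mulmx1 mulmxA.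
Qed.

End InverseForm.

Section OneMesh.
Context {R : realType} (k : nat).
Local Notation V := ('rV[R]_3 * R)%type.
Local Notation Tri := (@ref_triangle R).
Local Notation mu := (@lebesgue_measure R).
Variables (alpha beta T : R) (g : V -> R) (L : R).
Hypothesis T0 : 0 < T.
Hypothesis gL : forall u u' t t', `|g (u, t) - g (u', t')| <= L * (nrm1 (u - u') + `|t - t'|).
Variables (G0 : set 'rV[R]_3) (X : 'rV[R]_3 -> R -> 'rV[R]_3) (U : set V) (F : V -> 'rV[R]_3).
Hypothesis oU : open U.
Hypothesis CF : class_C 2 U F.
Hypothesis FX : forall p t, G0 p -> 0 <= t <= T -> U (p, t) /\ F (p, t) = X p t.
Variable tr : triangulation R k.
Hypothesis nG : forall j, G0 (row j (init_node tr)).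

Local Notation xs := (exact_nodes tr X).
Local Notation ws := (nodal_velocity tr F).

Lemma exact_nodes_tderiv t : 0 <= t <= T -> has_tderiv T xs t (ws t).
Proof.
move=> tT; apply/has_tderiv_entries => j l; rewrite mxE.
have [_ C1 _] := class_C2_coord l oU CF.
apply: has_tderiv_flow => // [|s sT].
  by have [d _] := C1 bt; apply: d; have [] := FX (nG j) tT.
by rewrite mxE; have [_ ->] := FX (nG j) sT.
Qed.

Lemma exact_velocitiesE t : 0 <= t <= T -> exact_velocities tr T X t = ws t.
Proof. by move=> tT; apply: tderiv_eq => //; exact: exact_nodes_tderiv. Qed.

Lemma mcont_exact_nodes t : mcont (fun s => xs (clamp T s)) t.
Proof.
move=> j l; apply: (has_tderiv_clamp T0 (f := fun s => xs s j l)) => s sT.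
by exists (ws s j l); have /has_tderiv_entries := exact_nodes_tderiv sT; exact.
Qed.

Lemma mcont_velocity t : mcont (fun s => ws (clamp T s)) t.
Proof.
move=> j l; under eq_fun do rewrite mxE; rewrite mxE.
have [_ C1 _] := class_C2_coord l oU CF; have [_ c] := C1 bt.
have [Ut _] := FX (nG j) (clamp_itv T0 t).
apply: (@cvg_comp _ _ _ (fun s => (row j (init_node tr), clamp T s) : V)
  (fun z => 'D_bt (fun y => F y 0 l) z)) (c _ Ut).
have c1 : (fun _ : R => row j (init_node tr)) @ t --> row j (init_node tr) by exact: cvg_cst.
exact: (cvg_pair c1 (@continuous_clamp _ T t)).
Qed.

(** The functional [M d_v] obtained by inserting the exact nodal values into
    the discrete equation. *)
Definition residual t : nodal tr := Kmx alpha (xs t) *m ws t + Amx beta (xs t) *m xs t - load g (xs t) t.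

Definition residual_sqr t := \tr ((residual t)^T *m invmx (Kmx alpha (xs t)) *m residual t).

Variables (a : 'I_(nb_elts tr) -> R).
Hypothesis a0 : forall e, 0 < a e.
Hypothesis nd : forall t, 0 <= t <= T -> nondegenerate_mesh a (xs t).
Hypothesis Ku : forall t, 0 <= t <= T -> Kmx alpha (xs t) \in unitmx.
Hypothesis Kge0 : forall t, 0 <= t <= T -> forall w : nodal tr, 0 <= \tr (w^T *m Kmx alpha (xs t) *m w).

Lemma residual_sqr_ge0 t : 0 <= t <= T -> 0 <= residual_sqr t.
Proof.
by move=> tT; apply: inverse_form_ge0; [exact: Kmx_sym|exact: Ku|exact: Kge0].
Qed.

Lemma defect_residual t d : 0 <= t <= T -> is_defect alpha beta g T X t d ->
  mass (xs t) *m d = residual t.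
Proof.
by move=> tT; rewrite /is_defect exact_velocitiesE// /residual => ->; rewrite addrAC subrr add0r.
Qed.

(** The defect enters the dual norm only through [M d_v], whose continuity in
    time can be read off the equation. *)
Lemma norm_star_residual t d : 0 <= t <= T -> is_defect alpha beta g T X t d ->
  norm_star alpha (xs t) d ^+ 2 = residual_sqr t.
Proof.
move=> tT dd; have E : \tr (d^T *m mass (xs t) *m invmx (Kmx alpha (xs t)) *m mass (xs t) *m d) = residual_sqr t.
  by rewrite /residual_sqr -(defect_residual tT dd) trmx_mul mass_sym mulmxA.
by rewrite /norm_star E sqr_sqrtr// residual_sqr_ge0.
Qed.

Lemma continuous_residual_sqr : continuous (fun s => residual_sqr (clamp T s)).
Proof.
move=> t; have cP : mcont (fun s => xs (clamp T s)) t by exact: mcont_exact_nodes.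
have nP s : nondegenerate_mesh a (xs (clamp T s)) by apply: nd; exact: clamp_itv.
have cK : mcont (fun s => Kmx alpha (xs (clamp T s))) t.
  by move=> i j; exact: (continuous_Kmx (P := fun s => xs (clamp T s)) a0 nP cP).
have cA : mcont (fun s => Amx beta (xs (clamp T s))) t.
  by move=> i j; exact: (continuous_Amx (P := fun s => xs (clamp T s)) a0 nP cP).
have cL : mcont (fun s => load g (xs (clamp T s)) (clamp T s)) t.
  move=> j l; apply: (continuous_load (P := fun s => xs (clamp T s)) (th := clamp T) a0 nP cP) => [s e|e].
    exact: (bddmeas_lipschitz gL).
  by apply: (jcont_lipschitz gL) => //; exact: continuous_clamp.
have cr : mcont (fun s => residual (clamp T s)) t.
  apply: (mcontD (B := fun s => - load g (xs (clamp T s)) (clamp T s))); last exact: mcontN.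
  apply: mcontD; last exact: mcont_mul.
  by apply: mcont_mul => //; exact: mcont_velocity.
apply: (mcont_trace (A := fun s => (residual (clamp T s))^T *m invmx (Kmx alpha (xs (clamp T s))) *m residual (clamp T s))).
apply: mcont_mul => //; apply: mcont_mul; first exact: mcont_tr.
by apply: mcont_inv => // s; apply: Ku; exact: clamp_itv.
Qed.

Variables (h : 'I_(nb_elts tr) -> R) (delta K1 ka Cinv B : R).
Hypothesis K10 : 0 <= K1.
Hypothesis ka0 : 0 < ka.
Hypothesis delta0 : 0 < delta.
Hypothesis h0 : forall e, 0 < h e.
Hypothesis Kge : forall t, 0 <= t <= T -> forall w : nodal tr,
  ka * energy h w <= \tr (w^T *m Kmx alpha (xs t) *m w).
Hypothesis stab : forall t, 0 <= t <= T -> forall x v : nodal tr,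
  (forall e xi, Tri xi -> nrm1 (jac (x - xs t) e xi) <= delta * h e) ->
  Kmx alpha x *m v + Amx beta x *m x = load g x t ->
  \tr ((v - ws t)^T *m Kmx alpha (xs t) *m (v - ws t)) <= K1 * (energy h (x - xs t) + residual_sqr t).
Hypothesis inv : forall (w : nodal tr) e xi, Tri xi -> nrm1 (jac w e xi) ^+ 2 <= Cinv * energy h w.
Hypothesis Cinv0 : 0 <= Cinv.
Hypothesis BC : forall e, Cinv * B <= (delta * h e) ^+ 2.
Local Notation KK := (1 + K1 / ka).
Hypothesis HB : forall t, 0 <= t <= T ->
  KK * expR (KK * t) * \int[mu]_(s in `[0, t]) residual_sqr (clamp T s) < B.

Lemma small_energy (w : nodal tr) : energy h w <= B ->
  forall e xi, Tri xi -> nrm1 (jac w e xi) <= delta * h e.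
Proof.
move=> wB e xi Txi; rewrite -ler_sqr ?nnegrE ?nrm1_ge0 ?mulr_ge0 ?(ltW delta0) ?(ltW (h0 e))//.
apply: le_trans (inv w e Txi) _; apply: le_trans (BC e).
by rewrite ler_wpM2l.
Qed.

Variables (x v : R -> nodal tr).
Hypothesis sol : semidiscrete_solution alpha beta g T x v.
Hypothesis X0 : forall p, G0 p -> X p 0 = p.

Lemma energy_algebra (k1 ka' E r EV D : R) : 0 <= k1 -> 0 < ka' -> 0 <= E -> 0 <= r -> D <= E + EV ->
  ka' * EV <= k1 * (E + r) -> D <= (1 + k1 / ka') * (E + r).
Proof.
move=> k10 ka'0 E0 r0 h1; rewrite mulrC -ler_pdivlMr// => h2; apply: le_trans h1 _.
by rewrite mulrDl mul1r lerD ?lerDl// mulrAC.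
Qed.

(** The derivative of the energy of the position error is twice its product
    with the velocity error, hence bounded by the two energies; stability turns
    this into the differential inequality of [bootstrap]. *)
Lemma position_error t : 0 <= t <= T -> energy h (x t - xs t) <= B /\
  energy h (x t - xs t) <= KK * expR (KK * t) * \int[mu]_(s in `[0, t]) residual_sqr (clamp T s).
Proof.
have [x0 Hsol] := sol.
have KK0 : 0 <= KK by rewrite addr_ge0// divr_ge0// ltW.
pose er s := x (clamp T s) - xs (clamp T s).
have er_id s : 0 <= s <= T -> er s = x s - xs s by move=> sT; rewrite /er clamp_id.
have derr s : 0 <= s <= T -> has_tderiv T er s (v s - ws s).
  move=> sT; apply: (eq_has_tderiv (f := fun s => x s - xs s)) => // [u uT|]; first by rewrite er_id.
  by apply: has_tderivB => //; [case: (Hsol s sT)|exact: exact_nodes_tderiv].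
pose S := energy_mx h.
pose y s := energy h (er s); pose dy s := 2 * \tr ((er s)^T *m S *m (v s - ws s)).
have dery s : 0 < s < T -> is_derive s 1 y (dy s).
  move=> sT; have sT' : 0 <= s <= T by case/andP: sT => *; rewrite !ltW.
  have -> : y = fun s => \tr ((er s)^T *m S *m er s) by apply/funext => u; rewrite /y energyE.
  apply: mderive_form; first exact: energy_mx_sym.
  move=> i j; apply: (has_tderiv_is_derive (T := T)) => //.
  by have /has_tderiv_entries := derr s sT'; exact.
have cy : continuous y.
  have -> : y = fun s => \tr ((er s)^T *m S *m er s) by apply/funext => u; rewrite /y energyE.
  move=> s; apply: (mcont_trace (A := fun s => (er s)^T *m S *m er s)).
  have cer : mcont er s.
    move=> i j; have -> : (fun u => er u i j) = fun u => (fun u => x u i j - xs u i j) (clamp T u).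
      by apply/funext => u; rewrite /er !mxE.
    have -> : er s i j = (fun u => x u i j - xs u i j) (clamp T s) by rewrite /er !mxE.
    apply: (has_tderiv_clamp T0 (f := fun u => x u i j - xs u i j)) => u uT.
    exists ((v u - ws u) i j).
    have -> : (fun u => x u i j - xs u i j) = fun u => (x u - xs u) i j by apply/funext => ?; rewrite !mxE.
    have /has_tderiv_entries := has_tderivB T0 uT (proj1 (Hsol u uT)) (exact_nodes_tderiv uT); exact.
  apply: mcont_mul => //; apply: mcont_mul; first exact: mcont_tr.
  by move=> i j; exact: cvg_cst.
have y0 : y 0 <= 0.
  have T00 : (0 : R) <= 0 <= T by rewrite lexx ltW.
  rewrite /y er_id// x0.
  have -> : init_node tr - xs 0 = 0.
    by apply/matrixP => j l; rewrite !mxE X0// mxE subrr.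
  by rewrite energyE mulmx0 mxtrace0.
have dyle s : 0 < s < T -> y s <= B -> dy s <= KK * (y s + residual_sqr (clamp T s)).
  move=> sT yB; have sT' : 0 <= s <= T by case/andP: sT => *; rewrite !ltW.
  have c1 : dy s <= energy h (er s) + energy h (v s - ws s).
    rewrite !energyE; apply: cross_form_le; first exact: energy_mx_sym.
    by rewrite -energyE; exact: energy_ge0.
  rewrite /y er_id// in yB c1 *; rewrite clamp_id//.
  have [_ eqs] := Hsol s sT'.
  have c2 := stab sT' (small_energy yB) eqs.
  have c3 := le_trans (Kge sT' (v s - ws s)) c2.
  move: c1 c3; have := residual_sqr_ge0 sT'; have := energy_ge0 h (x s - xs s).
  exact: energy_algebra.
move=> tT; have [b1 b2] := bootstrap KK0 cy continuous_residual_sqr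
  (fun s => residual_sqr_ge0 (clamp_itv T0 s)) y0 (fun s sT => conj (dery s sT) (dyle s sT)) HB tT.
by rewrite -er_id.
Qed.

End OneMesh.

Section Constants.
Context {R : realType}.
Local Notation mu := (@lebesgue_measure R).

Lemma Rintegral_le (phi : R -> R) t A : continuous phi -> 0 <= t ->
  (forall s, 0 <= s <= t -> phi s <= A) -> \int[mu]_(s in `[0, t]) phi s <= A * t.
Proof.
move=> cphi t0 H; have -> : A * t = \int[mu]_(s in `[0, t]) A.
  rewrite Rintegral_cst//= lebesgue_measure_itv/= lte_fin.
  case: ltP => [_|t0']; first by rewrite /= subr0.
  by have -> : t = 0 by apply/le_anti; rewrite t0 t0'.
have ic : mu.-integrable `[0, t] (EFin \o (fun=> A)).
  by apply: continuous_integrable => s; exact: cvg_cst.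
have ip := continuous_integrable 0 t cphi.
by apply: (le_Rintegral _ ip ic) => // s; rewrite /= in_itv/=; exact: H.
Qed.

(** An order strictly larger than one beats every constant on fine meshes. *)
Lemma small_mesh (kappa sigma Q : R) : 1 < kappa -> 0 < sigma -> 0 <= Q ->
  exists2 h0 : R, 0 < h0 & forall M, 0 < M -> M <= h0 -> Q * (M `^ kappa) ^+ 2 < sigma * M ^+ 2.
Proof.
move=> k1 s0 Q0; have q0 : 0 < kappa - 1 by rewrite subr_gt0.
(* With [M ^ (kappa - 1) <= tau] the claim reduces to [Q tau^2 <= Q tau < sigma]. *)
pose tau := Num.min 1 (sigma / (Q + 1)); have Q1 : 0 < Q + 1 by rewrite ltr_wpDl.
have tau0 : 0 < tau by rewrite lt_min ltr01 divr_gt0.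
have tau1 : tau <= 1 by rewrite ge_min lexx.
have tauQ : Q * tau < sigma.
  have : (Q + 1) * tau <= sigma by rewrite mulrC -ler_pdivlMr// ge_min lexx orbT.
  by apply: lt_le_trans; rewrite mulrDl mul1r ltrDl.
exists (tau `^ (kappa - 1)^-1); first exact: powR_gt0.
move=> M M0 Mh; have pt : M `^ (kappa - 1) <= tau.
  have -> : tau = (tau `^ (kappa - 1)^-1) `^ (kappa - 1).
    by rewrite -powRrM mulVf ?gt_eqF// powRr1// ltW.
  by apply: ge0_ler_powR => //; rewrite ?nnegrE ?powR_ge0 ?(ltW M0) ?(ltW q0).
have -> : M `^ kappa = M * M `^ (kappa - 1).
  have E : kappa = 1 + (kappa - 1) by rewrite addrC subrK.
  by rewrite [in LHS]E [LHS]powRD ?(gt_eqF M0) ?implybT// powRr1// ltW.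
set p := M `^ _ in pt *; have p0 : 0 <= p by exact: powR_ge0.
have p2 : p ^+ 2 <= tau.
  by apply: le_trans (_ : 1 * tau <= _); [rewrite expr2 ler_pM// (le_trans pt)|rewrite mul1r].
have -> : Q * (M * p) ^+ 2 = Q * p ^+ 2 * M ^+ 2 by ring.
rewrite ltr_pM2r ?exprn_gt0//.
by apply: le_lt_trans tauQ; rewrite ler_wpM2l.
Qed.

End Constants.

Section Member.
Context {R : realType} (k : nat).
Local Notation V := ('rV[R]_3 * R)%type.
Local Notation Tri := (@ref_triangle R).

Lemma regular_meshW (tr : triangulation R k) C C' c (h : 'I_(nb_elts tr) -> R) x :
  (forall e, 0 < h e) -> C <= C' -> regular_mesh C c h x -> regular_mesh C' c h x.
Proof.
move=> h0 CC rx e xi Txi; have [b im] := rx e xi Txi; apply: (conj _ im).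
by apply: le_trans b _; rewrite ler_wpM2r// ltW.
Qed.

Lemma energy_no_elt (tr : triangulation R k) h (w : nodal tr) : ~ (exists e : 'I_(nb_elts tr), true) ->
  energy h w = 0.
Proof. by move=> none; apply: big1 => e _; case: none; exists e. Qed.

End Member.

Section Member.
Context {R : realType} (k : nat).
Hypothesis k0 : (0 < k)%N.
Local Notation V := ('rV[R]_3 * R)%type.
Local Notation Tri := (@ref_triangle R).
Local Notation mu := (@lebesgue_measure R).
Variables (alpha beta T : R) (g : V -> R) (L : R).
Hypothesis al0 : 0 < alpha.
Hypothesis T0 : 0 < T.
Hypothesis gL : forall u u' t t', `|g (u, t) - g (u', t')| <= L * (nrm1 (u - u') + `|t - t'|).
Variables (G0 : set 'rV[R]_3) (X : 'rV[R]_3 -> R -> 'rV[R]_3) (U : set V) (F : V -> 'rV[R]_3).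
Hypothesis oU : open U.
Hypothesis CF : class_C 2 U F.
Hypothesis FX : forall p t, G0 p -> 0 <= t <= T -> U (p, t) /\ F (p, t) = X p t.
Hypothesis X0 : forall p, G0 p -> X p 0 = p.
Variable tr : triangulation R k.
Hypothesis trG : triangulates tr G0.
Local Notation xs := (exact_nodes tr X).
Local Notation ws := (nodal_velocity tr F).
Local Notation h := (@elt_diam R k tr).
Local Notation res2 := (@residual_sqr R k alpha beta g X F tr).
Variables (C c delta K1 Cinv cq : R).
Hypothesis C0 : 0 < C.
Hypothesis c0 : 0 < c.
Hypothesis delta0 : 0 < delta.
Hypothesis K10 : 0 <= K1.
Hypothesis Cinv0 : 0 < Cinv.
Hypothesis cq0 : 0 < cq.
Hypothesis reg : forall t, 0 <= t <= T -> regular_mesh C c h (xs t).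
Local Notation ka := (Num.min c (alpha * c / (6 * C ^+ 2))).
Local Notation kb := (6 * C ^+ 2 + 18 * alpha * C ^+ 2 / c).
Local Notation KK := (1 + K1 / ka).

Lemma coercivity_gt0 : 0 < ka.
Proof. by rewrite lt_min c0 divr_gt0// ?mulr_gt0// exprn_gt0. Qed.

Lemma diam_gt0 e : 0 < h e.
Proof. by case: trG => _ _ conf _ _; exact: elt_diam_gt0. Qed.

Lemma exact_Kmx_unit t : 0 <= t <= T -> Kmx alpha (xs t) \in unitmx.
Proof.
by move=> tT; case: trG => _ cover _ _ _; exact: (Kmx_unit k0 diam_gt0 cover al0 C0 c0 (reg tT)).
Qed.

Lemma exact_Kmx_equiv t (w : nodal tr) : 0 <= t <= T ->
  ka * energy h w <= \tr (w^T *m Kmx alpha (xs t) *m w) <= kb * energy h w.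
Proof. by move=> tT; exact: (Kmx_form_equiv diam_gt0 w al0 C0 c0 (reg tT)). Qed.

Lemma exact_Kmx_ge0 t (w : nodal tr) : 0 <= t <= T -> 0 <= \tr (w^T *m Kmx alpha (xs t) *m w).
Proof.
move=> tT; have /andP[b _] := exact_Kmx_equiv w tT; apply: le_trans b.
by rewrite mulr_ge0 ?energy_ge0// ltW// coercivity_gt0.
Qed.

Hypothesis stab : forall t, 0 <= t <= T -> forall x v : nodal tr,
  (forall e xi, Tri xi -> nrm1 (jac (x - xs t) e xi) <= delta * h e) ->
  Kmx alpha x *m v + Amx beta x *m x = load g x t ->
  \tr ((v - ws t)^T *m Kmx alpha (xs t) *m (v - ws t)) <= K1 * (energy h (x - xs t) + res2 t).
Hypothesis inv : forall (w : nodal tr) e xi, Tri xi -> nrm1 (jac w e xi) ^+ 2 <= Cinv * energy h w.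
Hypothesis quasi : forall e, cq * mesh_size tr <= h e.
Variables (d : R -> nodal tr) (cc kappa : R).
Hypothesis dd : forall t, 0 <= t <= T -> is_defect alpha beta g T X t (d t).
Hypothesis dle : forall t, 0 <= t <= T -> norm_star alpha (xs t) (d t) <= cc * mesh_size tr `^ kappa.
Hypothesis fine_mesh : 0 < mesh_size tr ->
  KK * expR (KK * T) * (cc ^+ 2 * T) * (mesh_size tr `^ kappa) ^+ 2
    < (delta * cq) ^+ 2 / Cinv * mesh_size tr ^+ 2.
Variables (x v : R -> nodal tr).
Hypothesis sol : semidiscrete_solution alpha beta g T x v.

Let dint t := \int[mu]_(s in `[0, t]) (norm_star alpha (xs s) (d s)) ^+ 2.

Let area_lb e := c * h e ^+ 2.

Let area_lb_gt0 e : 0 < area_lb e.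
Proof. by rewrite mulr_gt0// exprn_gt0// diam_gt0. Qed.

Let nd t : 0 <= t <= T -> nondegenerate_mesh area_lb (xs t).
Proof. by move=> tT; apply: (regular_nondegenerate diam_gt0 c0 (reg tT)). Qed.

Let nG j : G0 (row j (init_node tr)). Proof. by case: trG. Qed.

Let star_res t : 0 <= t <= T -> norm_star alpha (xs t) (d t) ^+ 2 = res2 t.
Proof.
move=> tT; exact: (norm_star_residual T0 oU CF FX nG exact_Kmx_unit (fun t tT w => exact_Kmx_ge0 w tT) tT (dd tT)).
Qed.

Let cres : continuous (fun s => res2 (clamp T s)).
Proof. exact: (continuous_residual_sqr T0 gL oU CF FX nG area_lb_gt0 nd exact_Kmx_unit). Qed.

Let dintE t : 0 <= t <= T -> dint t = \int[mu]_(s in `[0, t]) res2 (clamp T s).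
Proof.
move=> /andP[t0 tT]; apply: eq_Rintegral => s; rewrite inE/= in_itv/= => /andP[s0 st].
have sT : 0 <= s <= T by rewrite s0 (le_trans st).
by rewrite (clamp_id sT); exact: star_res.
Qed.

Let KK0 : 0 <= KK. Proof. by rewrite addr_ge0// divr_ge0// ltW// coercivity_gt0. Qed.

Let exp_le t : 0 <= t <= T -> KK * expR (KK * t) <= KK * expR (KK * T).
Proof. by move=> /andP[_ tT]; rewrite ler_wpM2l// ler_expR ler_wpM2l. Qed.

Let dint_ge0 t : 0 <= dint t.
Proof. by apply: Rintegral_ge0 => s _; exact: sqr_ge0. Qed.

Let dint_le t : 0 <= t <= T -> dint t <= cc ^+ 2 * T * (mesh_size tr `^ kappa) ^+ 2.
Proof.
move=> tT; have /andP[t0 tT'] := tT; rewrite dintE//.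
have -> : cc ^+ 2 * T * (mesh_size tr `^ kappa) ^+ 2 = (cc * mesh_size tr `^ kappa) ^+ 2 * T by ring.
apply: le_trans (Rintegral_le (A := (cc * mesh_size tr `^ kappa) ^+ 2) cres t0 _) _ => [s /andP[s0 st]|].
  have sT : 0 <= s <= T by rewrite s0 (le_trans st).
  rewrite (clamp_id sT) -(star_res sT) ler_sqr ?nnegrE ?sqrtr_ge0//; first exact: dle.
  by apply: le_trans (dle sT); exact: sqrtr_ge0.
by rewrite ler_wpM2l// sqr_ge0.
Qed.

(** Below the threshold [B] the inverse estimate yields the smallness of the
    position error that stability requires; quasi-uniformity turns the
    diameter of each element into the mesh size.  A mesh without elements has
    zero energy and zero mesh size, and is treated apart. *)
Lemma member_estimate t : 0 <= t <= T ->
  energy h (x t - xs t) <= KK * expR (KK * T) * dint t /\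
  \tr ((v t - ws t)^T *m Kmx alpha (xs t) *m (v t - ws t)) <= K1 * (energy h (x t - xs t) + res2 t).
Proof.
move=> tT; have rhs0 : 0 <= KK * expR (KK * T) * dint t by rewrite !mulr_ge0 ?expR_ge0.
have [_ /(_ t tT)[_ eqt]] := sol.
have [[e0 _]|none] := pselect (exists e : 'I_(nb_elts tr), true); last first.
  rewrite energy_no_elt//; split => //; have := stab tT (x := x t) _ eqt.
  by rewrite energy_no_elt//; apply => e; case: none; exists e.
have M0 : 0 < mesh_size tr by apply: lt_le_trans (elt_diam_le_mesh e0); exact: diam_gt0.
pose B := (delta * cq) ^+ 2 / Cinv * mesh_size tr ^+ 2.
have BC e : Cinv * B <= (delta * h e) ^+ 2.
  have -> : Cinv * B = (delta * (cq * mesh_size tr)) ^+ 2.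
    by rewrite /B; field; rewrite gt_eqF.
  by rewrite ler_sqr ?nnegrE ?mulr_ge0 ?ler_wpM2l ?(ltW delta0) ?(ltW cq0) ?(ltW M0) ?(ltW (diam_gt0 e)).
have HB s : 0 <= s <= T -> KK * expR (KK * s) * \int[mu]_(u in `[0, s]) res2 (clamp T u) < B.
  move=> sT; rewrite -dintE//; apply: le_lt_trans (fine_mesh M0).
  rewrite -[leRHS]mulrA; apply: ler_pM => //; first by rewrite mulr_ge0// expR_ge0.
  - exact: exp_le.
  - exact: dint_le.
have [E1 E2] := position_error T0 gL oU CF FX nG area_lb_gt0 nd exact_Kmx_unit
  (fun t tT w => exact_Kmx_ge0 w tT) K10 coercivity_gt0 delta0 diam_gt0
  (fun t tT w => proj1 (andP (exact_Kmx_equiv w tT))) stab inv (ltW Cinv0) BC HB sol X0 tT.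
split.
  by apply: le_trans E2 _; rewrite -dintE// ler_wpM2r//; exact: exp_le.
by apply: stab => //; exact: (small_energy delta0 diam_gt0 inv (ltW Cinv0) BC E1).
Qed.

Lemma member_norms t : 0 <= t <= T -> let M0 := KK * expR (KK * T) in
  norm_K alpha (xs t) (x t - xs t) ^+ 2 <= kb * M0 * dint t /\
  norm_K alpha (xs t) (v t - exact_velocities tr T X t) ^+ 2 <=
    K1 * norm_star alpha (xs t) (d t) ^+ 2 + K1 * M0 * dint t.
Proof.
move=> tT M0; have [E1 E2] := member_estimate tT.
rewrite (exact_velocitiesE T0 oU CF FX nG tT) (star_res tT) /norm_K.
rewrite !sqr_sqrtr; try exact: exact_Kmx_ge0.
split.
  have /andP[_ b] := exact_Kmx_equiv (x t - xs t) tT; apply: le_trans b _.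
  rewrite -[leRHS]mulrA ler_wpM2l// addr_ge0//; first by rewrite mulr_ge0// sqr_ge0.
  by rewrite divr_ge0 ?(ltW c0)// !mulr_ge0 ?sqr_ge0// ltW.
by apply: le_trans E2 _; rewrite mulrDr addrC lerD2l -[leRHS]mulrA ler_wpM2l.
Qed.

End Member.

(** * The convergence estimate *)

Theorem proposition10p1 (R : realType) (k : nat) (k_gt0 : (0 < k)%N) :
  exists m : nat,
  forall (alpha beta T : R) (g : ('rV[R]_3 * R)%type -> R)
         (Gamma0 : set 'rV[R]_3) (X : 'rV[R]_3 -> R -> 'rV[R]_3)
         (I : Type) (tri : I -> triangulation R k),
    0 < alpha -> 0 < beta -> 0 < T -> lipschitz g ->
    smooth_closed_surface Gamma0 ->
    unique_regular_solution m alpha beta g Gamma0 T X ->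
    admissible_family Gamma0 tri ->
  forall (d : forall i, R -> nodal (tri i)) (c kappa : R),
    (forall i t, 0 <= t <= T -> is_defect alpha beta g T X t (d i t)) ->
    1 < kappa ->
    (forall i t, 0 <= t <= T ->
       norm_star alpha (exact_nodes (tri i) X t) (d i t)
         <= c * mesh_size (tri i) `^ kappa) ->
  exists h0 C : R, 0 < h0 /\ 0 < C /\
  forall i, mesh_size (tri i) <= h0 ->
  forall x v : R -> nodal (tri i),
    semidiscrete_solution alpha beta g T x v ->
  forall t, 0 <= t <= T ->
    let xs := exact_nodes (tri i) X in
    let vs := exact_velocities (tri i) T X in
    let dint := \int[@lebesgue_measure R]_(s in `[0, t])
                  (norm_star alpha (xs s) (d i s)) ^+ 2 in
    (norm_K alpha (xs t) (x t - xs t)) ^+ 2 <= C * dint /\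
    (norm_K alpha (xs t) (v t - vs t)) ^+ 2
      <= C * (norm_star alpha (xs t) (d i t)) ^+ 2 + C * dint.
Proof.
exists 2%N => alpha beta T g G0 X I tri al0 be0 T0 lipg sG [[[U [F [oU CF FX]]] nd X0 _] _] adm
  d c kappa dd kap1 dle.
have [L L0 gL] := lipschitz_bound lipg.
have [C1 [c1 [h1 [C10 c10 h10 mesh]]]] := exact_mesh_bounds k_gt0 sG nd oU CF FX adm.
have [trg _ [cq cq0 quasi]] := adm.
have [Cinv Cinv0 Hinv] := @mesh_inverse_estimate R k.
(* This also bounds the values of [g] on the exact surfaces, by comparison with
   its value at the origin. *)
pose C := C1 + (`|g (0, 0)| + L * (C1 + T)).
have B0 : 0 <= `|g (0, 0)| + L * (C1 + T) by rewrite addr_ge0// mulr_ge0// addr_ge0// ltW.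
have C1C : C1 <= C by rewrite lerDl.
have C0 : 0 < C by exact: lt_le_trans C1C.
have gC : `|g (0, 0)| + L * (C1 + T) <= C by rewrite lerDr ltW.
have [delta [K1 [delta0 [K10 stab]]]] := @stability_estimate R k alpha beta C c1 L al0 be0 C0 c10 L0.
set ka := Num.min c1 (alpha * c1 / (6 * C ^+ 2)).
have ka0 : 0 < ka by exact: coercivity_gt0.
pose KK := 1 + K1 / ka; have KK0 : 0 <= KK by rewrite addr_ge0// divr_ge0 ?(ltW K10) ?(ltW ka0).
have Q0 : 0 <= KK * expR (KK * T) * (c ^+ 2 * T)
  by exact: (mulr_ge0 (mulr_ge0 KK0 (expR_ge0 _)) (mulr_ge0 (sqr_ge0 c) (ltW T0))).
have sg0 : 0 < (delta * cq) ^+ 2 / Cinv by rewrite divr_gt0// exprn_gt0// mulr_gt0.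
have [h2 h20 small] := small_mesh kap1 sg0 Q0.
pose kb := 6 * C ^+ 2 + 18 * alpha * C ^+ 2 / c1.
pose M0 := KK * expR (KK * T).
have M00 : 0 <= M0 by rewrite mulr_ge0 ?expR_ge0.
have kb0 : 0 <= kb.
  have C20 : 0 <= C ^+ 2 by exact: sqr_ge0.
  apply: addr_ge0; first exact: mulr_ge0.
  apply: divr_ge0 (ltW c10); apply: mulr_ge0 => //; apply: mulr_ge0 => //; exact: ltW.
exists (Num.min h1 h2), (kb * M0 + K1 * M0 + K1); split; first by rewrite lt_min h10.
split; first by rewrite ltr_wpDl// addr_ge0// mulr_ge0// ltW.
move=> i hi x v sol t tT xs vs dint.
have hi1 : mesh_size (tri i) <= h1 by apply: le_trans hi _; rewrite ge_min lexx.
have hi2 : mesh_size (tri i) <= h2 by apply: le_trans hi _; rewrite ge_min lexx orbT.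
have hd e : 0 < elt_diam e := diam_gt0 (trg i) e.
have reg s : 0 <= s <= T -> regular_mesh C c1 (@elt_diam _ _ (tri i)) (exact_nodes (tri i) X s).
  by move=> sT; have [r _] := mesh i hi1 s sT; exact: (regular_meshW hd C1C r).
have [_ cover _ _ _] := trg i.
have dint0 : 0 <= dint by apply: Rintegral_ge0 => s _; exact: sqr_ge0.
have gxs s e xi : 0 <= s <= T -> ref_triangle xi -> `|g (elt_map (exact_nodes (tri i) X s) e xi, s)| <= C.
  move=> sT Txi; have [_ /(_ e xi Txi)[_ _ bx]] := mesh i hi1 s sT.
  have := gL (elt_map (exact_nodes (tri i) X s) e xi) 0 s 0; rewrite !subr0 => gs.
  move: bx gs; move: (elt_map _ e xi) => u bu gs.
  have /andP[s0 sT'] := sT; apply: le_trans gC.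
  rewrite -[g (u, s)](subrK (g (0, 0))) addrC; apply: le_trans (ler_normD _ _) _.
  by rewrite lerD2l; apply: le_trans gs _; rewrite ler_wpM2l// lerD// ger0_norm.
have st s : 0 <= s <= T -> forall y w : nodal (tri i),
  (forall e xi, ref_triangle xi -> nrm1 (jac (y - exact_nodes (tri i) X s) e xi) <= delta * elt_diam e) ->
  Kmx alpha y *m w + Amx beta y *m y = load g y s ->
  \tr ((w - nodal_velocity (tri i) F s)^T *m Kmx alpha (exact_nodes (tri i) X s) *m (w - nodal_velocity (tri i) F s))
    <= K1 * (energy (@elt_diam _ _ (tri i)) (y - exact_nodes (tri i) X s) + residual_sqr alpha beta g X F (tri i) s).
  move=> sT y w sm eqy.
  have uK := exact_Kmx_unit k_gt0 al0 (trg i) C0 c10 reg sT.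
  have vb e xi : ref_triangle xi -> nrm1 (jac (nodal_velocity (tri i) F s) e xi) <= C * elt_diam e /\
      nrm1 (elt_map (nodal_velocity (tri i) F s) e xi) <= C.
    move=> Txi; have [_ /(_ e xi Txi)[b1 b2 _]] := mesh i hi1 s sT.
    apply: conj; last exact: le_trans b2 C1C.
    by apply: le_trans b1 _; rewrite ler_wpM2r// ltW.
  have gsp u u' : `|g (u, s) - g (u', s)| <= L * nrm1 (u - u').
    by have := gL u u' s s; rewrite subrr normr0 addr0.
  apply: (stab (tri i) _ y (exact_nodes (tri i) X s) w (nodal_velocity (tri i) F s)
    (residual alpha beta g X F (tri i) s) g s hd (reg s sT) uK vb (fun e xi => gxs s e xi sT)
    (fun z e => bddmeas_lipschitz gL z e s) gsp sm eqy).
  by rewrite /residual [RHS]addrC subrK.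
have [E1 E2] := @member_norms R k k_gt0 alpha beta T g L al0 T0 gL G0 X U F oU CF FX X0 (tri i) (trg i)
  C c1 delta K1 Cinv cq C0 c10 delta0 (ltW K10) Cinv0 cq0 reg st
  (fun w e xi Txi => proj1 (Hinv _ _ w e xi Txi)) (quasi i) (d i) c kappa (dd i) (dle i)
  (fun M0 => small _ M0 hi2) x v sol t tT.
have K1M0 : 0 <= K1 * M0 by rewrite mulr_ge0// ltW.
split.
  by apply: le_trans E1 _; rewrite ler_wpM2r// -addrA lerDl addr_ge0// ltW.
apply: le_trans E2 _; apply: lerD; rewrite ler_wpM2r ?sqr_ge0//.
  by rewrite lerDr addr_ge0// mulr_ge0.
by rewrite addrAC lerDr addr_ge0 ?(ltW K10)// mulr_ge0.
Qed.
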